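(* Let $\lambda\in P^+$ and let $\xi=(\xi_0\ge\cdots\ge\xi_{n-1}\ge\xi_n>0)$ be a partition of $\lambda_2$ with $n>0$ such that either $\xi_{n-1}>\xi_n$ or $\xi_{n-1}=\xi_n\ge2$. Let $\boldsymbol\xi=(\lambda_1,\xi)$ and $v_{\boldsymbol\xi}$ the generator of $V(\boldsymbol\xi)$. Then there is a short exact sequence of $\mathfrak g[t]$-modules $$0\to\operatorname{Ker}\phi\to V(\boldsymbol\xi)\xrightarrow{\phi}V(\boldsymbol\xi^+)\to0,\qquad\operatorname{Ker}\phi=U(\mathfrak g[t])(y_2\otimes t^n)^{\xi_n}v_{\boldsymbol\xi},$$ with $\phi(v_{\boldsymbol\xi})=v_{\boldsymbol\xi^+}$, and $\dim V(\boldsymbol\xi)=4^{n+1}\xi_0\xi_1\cdots\xi_n$. Moreover, with $s=n\xi_n$: (i) If $\xi_{n-1}>\xi_n$, then $\operatorname{Ker}\phi$ has a filtration by graded submodules $\operatorname{Ker}\phi=V_0\supset V_1\supset V_2\supset V_3\supset(0)$ with $V_0/V_1\cong\tau_sV(f_{\xi_n}(\boldsymbol\xi^-))$, $V_1/V_2\cong\tau_sV(f_{\xi_n-1}((\hat{\boldsymbol\xi})^-))$, $V_2/V_3\cong\tau_sV(f_{\xi_n}((\hat{\boldsymbol\xi})^-))$, and $V_3\cong\tau_sV(f_{\xi_n-1}((\tilde{\boldsymbol\xi})^-))$ if $\xi_n>1$, $V_3=0$ if $\xi_n=1$. (ii) If $\xi_{n-1}=\xi_n\ge2$ and $n\ge2$,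 then $\operatorname{Ker}\phi$ has a filtration by graded submodules $\operatorname{Ker}\phi=V_0\supset V_1\supset\cdots\supset V_5\supset(0)$ with $V_0/V_1\cong\tau_sV(f_{\xi_n}(\boldsymbol\xi^-))$, $V_1/V_2\cong\tau_{s}V(f_{\xi_n-1}(((\hat{\boldsymbol\xi})^-)^+))$, $V_2/V_3\cong\tau_{s+n-1}V(f_{\xi_n}(((\hat{\boldsymbol\xi})^-)^-))$, $V_3/V_4\cong\tau_{s+n-1}V(f_{\xi_n-1}(\widehat{(\hat{\boldsymbol\xi})^-}))$, $V_4/V_5\cong\tau_sV(f_{\xi_n}((\hat{\boldsymbol\xi})^-))$, $V_5\cong\tau_sV(f_{\xi_n-1}((\tilde{\boldsymbol\xi})^-))$. All isomorphisms are of graded $\mathfrak g[t]$-modules.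
   Context: $\mathfrak g=\mathfrak{sl}(1|2)$ ($3\times3$ complex supertrace-zero matrices, superbracket $[A,B]=AB-(-1)^{|A||B|}BA$), $x_1=E_{12},x_2=E_{23},x_3=E_{13},y_1=E_{21},y_2=E_{32},y_3=E_{31}$ ($x_2,y_2$ even, others odd), $h_1=E_{11}+E_{22}$, $h_2=E_{22}-E_{33}$, $\mathfrak h=\operatorname{span}\{h_1,h_2\}$, $\mathfrak n^+=\operatorname{span}\{y_1,x_2,x_3\}$; weights $\lambda\leftrightarrow(\lambda_1,\lambda_2)=(\lambda(h_1),\lambda(h_2))$; $P^+=\{\lambda:\lambda_2\in\mathbb Z_{>0}\}\cup\{0\}$. $\mathfrak g[t]=\mathfrak g\otimes\mathbb C[t]$, graded by $t$-degree. Graded local Weyl module $W(\lambda)$: generated by an even degree-$0$ vector $w_\lambda$ with $\mathfrak n^+[t]w_\lambda=0$, $(h\otimes t^r)w_\lambda=\delta_{r,0}\lambda(h)w_\lambda$, $(y_2\otimes1)^{\lambda_2+1}w_\lambda=0$. For a partition $\xi=(\xi_0\ge\cdots\ge\xi_n\ge0)$ of $\lambda_2$ and $\boldsymbol\xi=(\lambda_1,\xi)$, the graded Chari–Venkatesh module $V(\boldsymbol\xi)$ is the quotient of $W(\lambda)$ by the submodule generated by all $(x_2\otimes t)^s(y_2\otimes1)^{r+s}w_\lambda$ with $r,s>0$, $0\le k\le n$, $s>kr+\xi_{k+1}+\cdots+\xi_n$; $v_{\boldsymbol\xi}$ is the image of $w_\lambda$ (the module only depends on $\lambda_1$ and the nonzero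 parts' effect through these relations; partitions may have trailing zero parts). Operations on a partition $\eta=(\eta_0\ge\cdots\ge\eta_m)$ with $m\ge1$ and $\eta_m>0$: $\eta^+=(\eta_0,\dots,\eta_{\ell-1},\eta_\ell+1,\eta_{\ell+1},\dots,\eta_{m-1},\eta_m-1)$ with $\ell$ the minimal index in $\{0,\dots,m-1\}$ such that $\eta_\ell=\eta_{m-1}$; $\eta^-=(\eta_0,\dots,\eta_{m-2},\eta_{m-1}-\eta_m)$; $\hat\eta=(\eta_0,\dots,\eta_{m-1},\eta_m-1)$; $\tilde\eta=(\eta_0,\dots,\eta_{m-1},\eta_m-2)$ (for $\eta_m\ge2$). Thus $(\hat\xi)^-=(\xi_0,\dots,\xi_{n-2},\xi_{n-1}-\xi_n+1)$ and $(\tilde\xi)^-=(\xi_0,\dots,\xi_{n-2},\xi_{n-1}-\xi_n+2)$. When $\xi_{n-1}=\xi_n$ and $n\ge2$: $(\hat\xi)^-=(\xi_0,\dots,\xi_{n-2},1)$, $\widehat{(\hat\xi)^-}=(\xi_0,\dots,\xi_{n-2},0)$, $((\hat\xi)^-)^-=(\xi_0,\dots,\xi_{n-3},\xi_{n-2}-1)$, $((\hat\xi)^-)^+=(\xi_0,\dots,\xi_{l-1},\xi_l+1,\xi_{l+1},\dots,\xi_{n-2},0)$ with $l$ minimal in $\{0,\dots,n-2\}$ such that $\xi_l=\xi_{n-2}$. All operations on $\boldsymbol\xi=(\lambda_1,\xi)$ act on the partition entry, and $f_m(\lambda_1,\xi)=(\lambda_1-m,\xi)$. For a graded module $V$, $\tau_sV$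 is $V$ with degrees increased by $s$, i.e. $(\tau_sV)[k]=V[k-s]$. *)

(* Defs.v *)
From HB Require Import structures.
From mathcomp Require Import all_boot all_order all_algebra.
Set Implicit Arguments. Unset Strict Implicit. Unset Printing Implicit Defensive.
Import Order.TTheory GRing.Theory Num.Theory.
Local Open Scope ring_scope.

(* ---------- the Lie superalgebra g = sl(1|2) ---------- *)
Inductive gb := X1 | X2 | X3 | Y1 | Y2 | Y3 | H1 | H2.
Definition gbs : seq gb := [:: X1; X2; X3; Y1; Y2; Y3; H1; H2].

Definition godd (a : gb) : bool :=
  match a with X1 | X3 | Y1 | Y3 => true | _ => false end.

Section G.
Variable F : fieldType.

Definition Emat (i j : nat) : 'M[F]_3 := delta_mx (inord i.-1) (inord j.-1).

Definition gmat (a : gb) : 'M[F]_3 :=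
  match a with
  | X1 => Emat 1 2 | X2 => Emat 2 3 | X3 => Emat 1 3
  | Y1 => Emat 2 1 | Y2 => Emat 3 2 | Y3 => Emat 3 1
  | H1 => Emat 1 1 + Emat 2 2 | H2 => Emat 2 2 - Emat 3 3
  end.

Definition ssign (a b : gb) : F := if godd a && godd b then -1 else 1.

Definition sbr (a b : gb) : 'M[F]_3 := gmat a *m gmat b - ssign a b *: (gmat b *m gmat a).

(* coordinates of a supertrace-zero matrix M (M11 - M22 - M33 = 0) in the basis:
   M = M12 x1 + M23 x2 + M13 x3 + M21 y1 + M32 y2 + M31 y3 + M11 h1 - M33 h2 *)
Definition gcoord (M : 'M[F]_3) (c : gb) : F :=
  let e i j := M (inord i.-1) (inord j.-1) in
  match c with
  | X1 => e 1 2 | X2 => e 2 3 | X3 => e 1 3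
  | Y1 => e 2 1 | Y2 => e 3 2 | Y3 => e 3 1
  | H1 => e 1 1 | H2 => - e 3 3
  end.

Definition gactM (V : lmodType F) (rho : gb -> nat -> V -> V) (M : 'M[F]_3) (r : nat)
  (u : V) : V := \sum_(c <- gbs) gcoord M c *: rho c r u.

End G.

(* gact a r = action of (a (x) t^r) *)
Record gmod (F : fieldType) := GMod {
  gcar :> lmodType F;
  gact : gb -> nat -> gcar -> gcar;
  gact_lin : forall a r (k : F) (u w : gcar),
      gact a r (k *: u + w) = k *: gact a r u + gact a r w;
  gact_br : forall a b r s (u : gcar),
      gact a r (gact b s u) - ssign F a b *: gact b s (gact a r u)
      = gactM gact (sbr F a b) (r + s) u
}.
Arguments gact {F} _ _ _ _.

Section Mods.
Variable F : fieldType.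

(* a grading by t-degree, given by the family of degree projections pi k : V -> V[k] *)
Definition is_grading (V : gmod F) (pi : nat -> V -> V) : Prop :=
  [/\ forall k (c : F) (u w : V), pi k (c *: u + w) = c *: pi k u + pi k w,
      forall k l (u : V), pi k (pi l u) = if k == l then pi k u else 0,
      forall u : V, exists N, u = \sum_(k < N) pi k u
    & forall a r k (u : V), gact V a r (pi k u) = pi (k + r)%N (gact V a r u)].

Definition is_submodule (V : gmod F) (S : V -> Prop) : Prop :=
  [/\ S 0, forall (c : F) u w, S u -> S w -> S (c *: u + w)
    & forall a r u, S u -> S (gact V a r u)].

Definition is_graded_submodule (V : gmod F) (pi : nat -> V -> V) (S : V -> Prop) : Prop :=
  is_submodule S /\ forall k u, S u -> S (pi k u).

Definition gen_sub (V : gmod F) (w : V) (u : V) : Prop :=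
  forall S : V -> Prop, is_submodule S -> S w -> S u.

Definition is_modmap (V W : gmod F) (f : V -> W) : Prop :=
  (forall (c : F) u w, f (c *: u + w) = c *: f u + f w) /\
  (forall a r u, f (gact V a r u) = gact W a r (f u)).

Definition dim_eq (V : gmod F) (N : nat) : Prop :=
  exists b : 'I_N -> V,
    (forall c : 'I_N -> F, \sum_(i < N) c i *: b i = 0 -> forall i, c i = 0) /\
    (forall u : V, exists c : 'I_N -> F, u = \sum_(i < N) c i *: b i).

(* data boldxi = (lambda_1, xi), with xi = (xi_0,...,xi_n) a seq nat *)
Definition cvdata := (F * seq nat)%type.

Definition cvrel (d : cvdata) (M : gmod F) (m : M) : Prop :=
  let l1 := d.1 in let xi := d.2 in let l2 := sumn xi in
  [/\ forall r, gact M Y1 r m = 0 /\ gact M X2 r m = 0 /\ gact M X3 r m = 0,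
      forall r, gact M H1 r m = (if r == 0%N then l1 else 0) *: m,
      forall r, gact M H2 r m = (if r == 0%N then l2%:R else 0) *: m,
      iter l2.+1 (gact M Y2 0%N) m = 0
    & forall r s k, (0 < r)%N -> (0 < s)%N -> (k < size xi)%N ->
        (k * r + sumn (drop k.+1 xi) < s)%N ->
        iter s (gact M X2 1%N) (iter (r + s) (gact M Y2 0%N) m) = 0].

(* (V, pi, v) is the graded Chari-Venkatesh module V(d) with generator v:
   graded, v of degree 0, generated by v, v satisfies the relations, and
   V is universal (the quotient of U(g[t]) by the left ideal of relations). *)
Definition isCV (d : cvdata) (V : gmod F) (pi : nat -> V -> V) (v : V) : Prop :=
  [/\ is_grading pi, pi 0%N v = v, (forall u, gen_sub v u), cvrel d v
    & forall (M : gmod F) (m : M), cvrel d m ->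
        exists f : V -> M, is_modmap f /\ f v = m].

(* the subquotient A/B (A, B graded submodules of V) is isomorphic to tau_s W
   as graded g[t]-modules: (tau_s W)[k] = W[k-s] *)
Definition sq_iso (V : gmod F) (pi : nat -> V -> V) (A B : V -> Prop) (s : nat)
  (W : gmod F) (piW : nat -> W -> W) : Prop :=
  exists q : V -> W,
  [/\ forall (c : F) u w, A u -> A w -> q (c *: u + w) = c *: q u + q w,
      forall a r u, A u -> q (gact V a r u) = gact W a r (q u),
      (forall k u, A u -> q (pi (k + s)%N u) = piW k (q u)) /\
      (forall k u, A u -> (k < s)%N -> q (pi k u) = 0),
      forall w, exists u, A u /\ q u = w
    & forall u, A u -> (q u = 0 <-> B u)].

Definition sq_cv (V : gmod F) (pi : nat -> V -> V) (A B : V -> Prop) (s : nat)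
  (d : cvdata) : Prop :=
  forall (W : gmod F) (piW : nat -> W -> W) (w : W), isCV d piW w -> sq_iso pi A B s piW.

Definition fdata (m : nat) (d : cvdata) : cvdata := (d.1 - m%:R, d.2).

End Mods.

Local Close Scope ring_scope.
Definition pplus (e : seq nat) : seq nat :=
  let m := (size e).-1 in
  let l := find (fun x => x == nth 0%N e m.-1) e in
  rcons (set_nth 0%N (take m e) l (nth 0%N e l).+1) (nth 0%N e m - 1).
Definition pminus (e : seq nat) : seq nat :=
  let m := (size e).-1 in
  rcons (take m.-1 e) (nth 0%N e m.-1 - nth 0%N e m).
Definition phat (e : seq nat) : seq nat :=
  let m := (size e).-1 in rcons (take m e) (nth 0%N e m - 1).
Definition ptilde (e : seq nat) : seq nat :=
  let m := (size e).-1 in rcons (take m e) (nth 0%N e m - 2).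

(* Main.v *)
(** Put y(u) = sum_p (y_2 ⊗ t^p) u^p.  By Garland's formula the relations of V(l1, xi) say that
    the coefficients of (u y(u))^r v vanish in degrees above sum_j min(r, xi_j); in particular they
    only depend on the multiset of parts of xi.  With a = xi_(n-1), x = xi_n, the four vectors
        (y_2 t^n)^x v,  (y_2 t^n)^(x-1) (x_1 t^n) v,  (y_2 t^n)^(x-1) (y_3 t^n) v,
        (y_2 t^n)^(x-2) (y_3 t^n) (x_1 t^n) v
    generate the kernel of V(xi) -> V(xi^+), and each of them, modulo the ones after it, satisfies
    the relations of the Chari-Venkatesh module in which the parts a, x are replaced by a - x,
    a - x + 1, a - x + 1, a - x + 2, respectively.  When a = x the second layer has
    one part 1 and is itself filtered in the same way with (n - 1, 1) in place of (n, x).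
    Induction bounds dim V(xi) above by 4^(n+1) xi_0 ... xi_n.
    For the lower bound, evaluate at n + 1 distinct scalars highest weight sl(1|2)-modules of
    dimension 4 xi_j (quadruples of binary forms); the tensor product is generated by its highest
    weight vector, and its associated graded for the t-degree is a quotient of V(xi).
    Since the dimensions of the layers then add up exactly, every layer attains its upper bound.
    The submodule of A/B + W generated by the pair of generators is therefore the graph of an
    isomorphism A/B -> W. *)

Require Import Defs.
From HB Require Import structures.
From mathcomp Require Import all_boot all_order all_algebra.
From mathcomp Require Import zify ring.
From Stdlib Require Import FunctionalExtensionality PropExtensionality ClassicalEpsilon.
Set Implicit Arguments. Unset Strict Implicit. Unset Printing Implicit Defensive.
Import Order.TTheory GRing.Theory Num.Theory.
Local Open Scope ring_scope.

(** The relations of a layer hold only modulo the generators of the later layers, so relations and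
    upper bounds are stated modulo a submodule [S] of an arbitrary module. The count closes because
    a x - (a+1)(x-1) = a - x + 1, while the four new parts add up to 4(a - x + 1). For a = x > 1 it
    fails by one: if D is attached to the other parts, the four layers are bounded by D, 4D, 4D and
    8D, in all 17D, but the kernel has dimension 16D. The excess sits in the second layer. There y_2
    t^(n-1) kills the first generator, and applying x_3 and then y_1 to this relation shows that y_3
    t^(n-1) sends the second generator into the later layers. Seeing this requires the further
    filtration of that layer: one of its sublayers disappears and 3D remains. If moreover n = 1, no
    other part is left. The first layer would belong to the partition (0) with lambda_1 arbitrary,
    where no bound by 1 is available; the kernel is then bounded by 16 directly, through products of
    the four odd root vectors. *)

(** * Structure constants of sl(1|2) *)

Definition gb_entry (a : gb) (i j : nat) : int :=
  match a, i, j with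
  | X1, 0%N, 1%N | X2, 1%N, 2%N | X3, 0%N, 2%N => 1
  | Y1, 1%N, 0%N | Y2, 2%N, 1%N | Y3, 2%N, 0%N => 1
  | H1, 0%N, 0%N | H1, 1%N, 1%N | H2, 1%N, 1%N => 1
  | H2, 2%N, 2%N => -1
  | _, _, _ => 0
  end.

Lemma gmat_entry (F : fieldType) a (i j : 'I_3) : gmat F a i j = (gb_entry a i j)%:~R.
Proof.
have E k : (k < 3)%N -> (i == inord k) = (i == k :> nat) by move=> kl; rewrite -val_eqE /= inordK.
have E' k : (k < 3)%N -> (j == inord k) = (j == k :> nat) by move=> kl; rewrite -val_eqE /= inordK.
case: a; rewrite /gmat /Emat !mxE ?E ?E' //=.
all: case: i {E} => [[|[|[|i]]] hi] //=; case: j {E'} => [[|[|[|j]]] hj] //=.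
all: by rewrite ?addr0 ?add0r ?subr0 ?sub0r ?oppr0 ?rmorphN1.
Qed.

(** Integral structure constants: with [gb_entry] they let every bracket be checked by computation
    in [int], once for all fields. *)
Definition lie_table (a b : gb) : seq (int * gb) :=
  match a, b with
  | X1, X2 => [:: (1, X3)] | X2, X1 => [:: (-1, X3)]
  | X1, Y1 | Y1, X1 => [:: (1, H1)]
  | X1, Y3 | Y3, X1 => [:: (1, Y2)]
  | X2, Y2 => [:: (1, H2)] | Y2, X2 => [:: (-1, H2)]
  | X2, Y3 => [:: (1, Y1)] | Y3, X2 => [:: (-1, Y1)]
  | X3, Y1 | Y1, X3 => [:: (1, X2)]
  | X3, Y2 => [:: (1, X1)] | Y2, X3 => [:: (-1, X1)]
  | X3, Y3 | Y3, X3 => [:: (1, H1); (-1, H2)]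
  | Y1, Y2 => [:: (-1, Y3)] | Y2, Y1 => [:: (1, Y3)]
  | H1, X2 => [:: (1, X2)] | X2, H1 => [:: (-1, X2)]
  | H1, X3 => [:: (1, X3)] | X3, H1 => [:: (-1, X3)]
  | H1, Y2 => [:: (-1, Y2)] | Y2, H1 => [:: (1, Y2)]
  | H1, Y3 => [:: (-1, Y3)] | Y3, H1 => [:: (1, Y3)]
  | H2, X1 => [:: (-1, X1)] | X1, H2 => [:: (1, X1)]
  | H2, X2 => [:: (2, X2)] | X2, H2 => [:: (-2, X2)]
  | H2, X3 => [:: (1, X3)] | X3, H2 => [:: (-1, X3)]
  | H2, Y1 => [:: (1, Y1)] | Y1, H2 => [:: (-1, Y1)]
  | H2, Y2 => [:: (-2, Y2)] | Y2, H2 => [:: (2, Y2)]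
  | H2, Y3 => [:: (-1, Y3)] | Y3, H2 => [:: (1, Y3)]
  | _, _ => [::]
  end.

Definition gb_eqb (a b : gb) : bool :=
  match a, b with
  | X1, X1 | X2, X2 | X3, X3 | Y1, Y1 | Y2, Y2 | Y3, Y3 | H1, H1 | H2, H2 => true
  | _, _ => false
  end.

Lemma gb_eqP : Equality.axiom gb_eqb.
Proof. by case; case; constructor. Qed.
HB.instance Definition _ := hasDecEq.Build gb gb_eqP.

Definition lie_coef (a b c : gb) : int :=
  foldr (fun p x => (if p.2 == c then p.1 else 0) + x) 0 (lie_table a b).

Definition comm_entry (a b : gb) (i j : nat) : int :=
  (gb_entry a i 0%N * gb_entry b 0%N j + gb_entry a i 1%N * gb_entry b 1%N j
   + gb_entry a i 2%N * gb_entry b 2%N j)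
  - (if godd a && godd b then -1 else 1) *
    (gb_entry b i 0%N * gb_entry a 0%N j + gb_entry b i 1%N * gb_entry a 1%N j
   + gb_entry b i 2%N * gb_entry a 2%N j).

Lemma sbr_entry (F : fieldType) a b (i j : 'I_3) : sbr F a b i j = (comm_entry a b i j)%:~R.
Proof.
rewrite /sbr !mxE !big_ord_recr !big_ord0 /= !gmat_entry /= !add0r /comm_entry.
rewrite rmorphB rmorphM !rmorphD !rmorphM /= /ssign.
by case: ifP => _; rewrite ?rmorphN1 ?rmorph1.
Qed.

Lemma gcoord_sbr (F : fieldType) a b c : gcoord (sbr F a b) c = (lie_coef a b c)%:~R.
Proof.
have gE d (M : 'M[F]_3) (h : nat -> nat -> int) :
    (forall i j : 'I_3, M i j = (h i j)%:~R) -> gcoord M d =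
    (match d with X1 => h 0%N 1%N | X2 => h 1%N 2%N | X3 => h 0%N 2%N | Y1 => h 1%N 0%N | Y2 => h 2%N 1%N
     | Y3 => h 2%N 0%N | H1 => h 0%N 0%N | H2 => - h 2%N 2%N end)%:~R.
  by move=> hM; case: d; rewrite /gcoord hM ?inordK //= rmorphN.
rewrite (gE c _ (comm_entry a b)); last exact: sbr_entry.
by congr (_%:~R); case: a; case: b; case: c; vm_compute.
Qed.

Lemma gactM_table (F : fieldType) (V : lmodType F) (rho : gb -> nat -> V -> V) a b r u :
  gactM rho (sbr F a b) r u = \sum_(p <- lie_table a b) p.1%:~R *: rho p.2 r u.
Proof.
rewrite /gactM; under eq_bigr do rewrite gcoord_sbr.
have h (c : gb) (L : seq (int * gb)) :
    (foldr (fun p x => (if p.2 == c then p.1 else 0) + x) 0 L : int)%:~R =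
    \sum_(p <- L) (if p.2 == c then p.1%:~R else 0) :> F.
  elim: L => [|p L IH] /=; first by rewrite big_nil.
  by rewrite big_cons rmorphD /= IH; case: ifP => _; rewrite ?rmorph0.
under eq_bigr => c _ do rewrite /lie_coef h scaler_suml.
rewrite exchange_big /=; apply: eq_bigr => -[k d] _ /=.
rewrite (bigD1_seq d) //=; last by case: d.
  rewrite eqxx big1 ?addr0 // => e /negPf; rewrite eq_sym => ->.
  by rewrite scale0r.
Qed.

(** * Submodules and powers of y(u) *)

Section GmodBasics.
Variables (F : fieldType) (V : gmod F).
Implicit Types (u w m : V) (S T : V -> Prop) (a b : gb) (r s p q : nat).

Lemma gactD a r u w : gact V a r (u + w) = gact V a r u + gact V a r w.
Proof. by have := gact_lin a r 1 u w; rewrite !scale1r. Qed.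

Lemma gact0 a r : gact V a r 0 = 0.
Proof. by apply: (@addrI _ (gact V a r 0)); rewrite -gactD !addr0. Qed.

Lemma gactZ a r (k : F) u : gact V a r (k *: u) = k *: gact V a r u.
Proof. by have := gact_lin a r k u 0; rewrite gact0 !addr0. Qed.

Lemma gactN a r u : gact V a r (- u) = - gact V a r u.
Proof. by rewrite -scaleN1r gactZ scaleN1r. Qed.

Lemma gactB a r u w : gact V a r (u - w) = gact V a r u - gact V a r w.
Proof. by rewrite gactD gactN. Qed.

Lemma gactMn a r k u : gact V a r (u *+ k) = gact V a r u *+ k.
Proof. by elim: k => [|k IH]; rewrite ?mulr0n ?gact0 // !mulrSr gactD IH. Qed.

Lemma gact_sum a r I (l : seq I) (P : pred I) (f : I -> V) :
  gact V a r (\sum_(i <- l | P i) f i) = \sum_(i <- l | P i) gact V a r (f i).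
Proof. by apply: (big_morph _ (gactD a r) (gact0 a r)). Qed.

Lemma gact_swap a b r s u :
  gact V a r (gact V b s u) = ssign F a b *: gact V b s (gact V a r u)
    + \sum_(p <- lie_table a b) p.1%:~R *: gact V p.2 (r + s) u.
Proof. by rewrite -gactM_table -gact_br addrC subrK. Qed.

Definition even_swap a b := ~~ (godd a && godd b).

Lemma gact_comm a b r s u : even_swap a b -> lie_table a b = [::] ->
  gact V a r (gact V b s u) = gact V b s (gact V a r u).
Proof. by rewrite /even_swap => /negPf h e; rewrite gact_swap e big_nil addr0 /ssign h scale1r. Qed.

Lemma gact_even a b c (k : int) r s u : even_swap a b -> lie_table a b = [:: (k, c)] ->
  gact V a r (gact V b s u) = gact V b s (gact V a r u) + k%:~R *: gact V c (r + s) u.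
Proof.
by rewrite /even_swap => /negPf h e; rewrite gact_swap e big_seq1 /ssign h scale1r.
Qed.

Lemma gact_odd0 a b r s u : ~~ even_swap a b -> lie_table a b = [::] ->
  gact V a r (gact V b s u) = - gact V b s (gact V a r u).
Proof. by rewrite negbK => h e; rewrite gact_swap e big_nil addr0 /ssign h scaleN1r. Qed.

Lemma gact_odd a b c (k : int) r s u : ~~ even_swap a b -> lie_table a b = [:: (k, c)] ->
  gact V a r (gact V b s u) = - gact V b s (gact V a r u) + k%:~R *: gact V c (r + s) u.
Proof. by rewrite negbK => h e; rewrite gact_swap e big_seq1 /ssign h scaleN1r. Qed.

Section Subm.
Variables (S : V -> Prop) (HS : is_submodule S).
Lemma subm0 : S 0. Proof. by case: HS. Qed.
Lemma submZD (c : F) u w : S u -> S w -> S (c *: u + w). Proof. by case: HS => _ h _; apply: h. Qed.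
Lemma subm_act a r u : S u -> S (gact V a r u). Proof. by case: HS => _ _; apply. Qed.
Lemma submD u w : S u -> S w -> S (u + w). Proof. by move=> hu hw; rewrite -[u]scale1r; apply: submZD. Qed.
Lemma submZ (c : F) u : S u -> S (c *: u). Proof. by move=> hu; rewrite -[_ *: _]addr0; apply: submZD => //; apply: subm0. Qed.
Lemma submN u : S u -> S (- u). Proof. by rewrite -scaleN1r; apply: submZ. Qed.
Lemma submB u w : S u -> S w -> S (u - w). Proof. by move=> hu hw; apply: submD => //; apply: submN. Qed.
Lemma submMn k u : S u -> S (u *+ k). Proof. by rewrite -scaler_nat; apply: submZ. Qed.
Lemma subm_sum I (l : seq I) (P : pred I) (f : I -> V) :
  (forall i, P i -> S (f i)) -> S (\sum_(i <- l | P i) f i).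
Proof. by move=> h; apply: big_ind => //; [apply: subm0 | apply: submD]. Qed.
Lemma subm_iter a r k u : S u -> S (iter k (gact V a r) u).
Proof. by move=> hu; elim: k => //= k; apply: subm_act. Qed.
Lemma submDr u w : S w -> S (u + w) -> S u.
Proof. by move=> hw huw; rewrite -[u](addrK w); apply: submB. Qed.
Lemma submDK u w : S (u + w) -> S w -> S u.
Proof. by move=> huw hw; apply: submDr huw. Qed.
Lemma submZr (c : F) u : c != 0 -> S (c *: u) -> S u.
Proof. by move=> c0 /(submZ c^-1); rewrite scalerA mulVf // scale1r. Qed.
End Subm.

(** Quotient modules are never formed: this is the preimage in [V] of the cyclic submodule that the
    class of [w] generates modulo the submodule [S]. *)
Definition genS S w u : Prop := forall T, is_submodule T -> (forall v, S v -> T v) -> T w -> T u.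

Lemma genS_sub S w : is_submodule (genS S w).
Proof.
split=> [T hT _ _|c u v hu hv T hT hST hw|a r u hu T hT hST hw].
- exact: subm0.
- by apply: submZD => //; [apply: hu | apply: hv].
- by apply: subm_act => //; apply: hu.
Qed.

Lemma genS_gen S w : genS S w w. Proof. by []. Qed.
Lemma genS_incl S w u : S u -> genS S w u. Proof. by move=> hu T _ h _; apply: h. Qed.
Lemma genS_min S w T : is_submodule T -> (forall v, S v -> T v) -> T w -> forall u, genS S w u -> T u.
Proof. by move=> hT h hw u; apply. Qed.

(** Product of a power series of operators with a power series of vectors, read off in degree
    [s]. *)
Definition cv (A : nat -> V -> V) (f : nat -> V) (s : nat) : V :=
  \sum_(p < s.+1) A p (f (s - p)%N).

Definition fam_lin (A : nat -> V -> V) :=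
  (forall p u w, A p (u + w) = A p u + A p w) /\ (forall p, A p 0 = 0).

Lemma fam_lin_sum A : fam_lin A -> forall p I (l : seq I) (P : pred I) (f : I -> V),
  A p (\sum_(i <- l | P i) f i) = \sum_(i <- l | P i) A p (f i).
Proof. by case=> hD h0 p I l P f; apply: (big_morph _ (hD p) (h0 p)). Qed.

Lemma fam_lin_act a : fam_lin (gact V a).
Proof. by split=> *; rewrite ?gactD ?gact0. Qed.

End GmodBasics.

Lemma exchange_triangle (V : zmodType) (g : nat -> nat -> V) (s : nat) :
  \sum_(p < s.+1) \sum_(q < (s - p).+1) g p q =
  \sum_(q < s.+1) \sum_(p < (s - q).+1) g p q.
Proof.
pose R (h : nat -> nat -> V) := \sum_(p < s.+1) \sum_(q < s.+1 | (p + q <= s)%N) h p q.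
have E (h : nat -> nat -> V) : \sum_(p < s.+1) \sum_(q < (s - p).+1) h p q = R h.
  apply: eq_bigr => p _; rewrite (big_ord_widen s.+1 (h p)); last by lia.
  by apply: eq_bigl => q; have := ltn_ord p; have := ltn_ord q; lia.
rewrite E (E (fun q p => g p q)) /R (exchange_big_dep predT) //=.
by apply: eq_bigr => q _; apply: eq_bigl => p; rewrite addnC.
Qed.

Lemma cv_comm (F : fieldType) (V : gmod F) (A B : nat -> V -> V) f s :
  fam_lin A -> fam_lin B -> (forall p q u, A p (B q u) = B q (A p u)) ->
  cv A (cv B f) s = cv B (cv A f) s.
Proof.
move=> hA hB hAB; rewrite /cv.
under eq_bigr => p _ do rewrite (fam_lin_sum hA).
under [RHS]eq_bigr => p _ do rewrite (fam_lin_sum hB).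
rewrite (exchange_triangle (fun p q => A p (B q (f (s - p - q)%N)))).
apply: eq_bigr => q _; apply: eq_bigr => p _; rewrite hAB.
by congr (B _ (A _ (f _))); lia.
Qed.

Section YPower.
Variables (F : fieldType) (V : gmod F).
Implicit Types (u w m : V) (S T : V -> Prop) (a b : gb) (r s p q : nat).

Definition delta_seq m (s : nat) : V := if s == 0%N then m else 0.

(* [Yp m r s] is the coefficient of [u^s] in [y(u)^r m], where [y(u)] is the
   generating series of the [y_2 (x) t^p]. *)
Definition Yp m r : nat -> V := iter r (cv (gact V Y2)) (delta_seq m).

Arguments Yp : simpl never.

Lemma YpS m r s : Yp m r.+1 s = \sum_(p < s.+1) gact V Y2 p (Yp m r (s - p)%N).
Proof. by []. Qed.

Lemma Yp0 m s : Yp m 0 s = if s == 0%N then m else 0. Proof. by []. Qed.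

Lemma Yp_at0 m r : Yp m r 0 = iter r (gact V Y2 0%N) m.
Proof. by elim: r => //= r IH; rewrite [LHS]/cv big_ord1 /= -IH. Qed.

Lemma Y2Y2 r s u : gact V Y2 r (gact V Y2 s u) = gact V Y2 s (gact V Y2 r u).
Proof. exact: gact_comm. Qed.

Lemma Yp_comm (T : V -> V) m r s : T 0 = 0 -> (forall u w, T (u + w) = T u + T w) ->
  (forall p u, T (gact V Y2 p u) = gact V Y2 p (T u)) -> T (Yp m r s) = Yp (T m) r s.
Proof.
move=> T0 TD hT; elim: r s => [|r IH] s; first by rewrite !Yp0; case: eqP.
rewrite !YpS (big_morph _ TD T0); apply: eq_bigr => p _.
by rewrite hT IH.
Qed.

Lemma Yp_act a q m r s : even_swap a Y2 -> lie_table a Y2 = [::] ->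
  gact V a q (Yp m r s) = Yp (gact V a q m) r s.
Proof.
by move=> h1 h2; apply: Yp_comm => [|u w|p u]; [exact: gact0 | exact: gactD | exact: gact_comm].
Qed.

Lemma YpSr m r s : Yp m r.+1 s = \sum_(p < s.+1) Yp (gact V Y2 p m) r (s - p)%N.
Proof. by rewrite YpS; apply: eq_bigr => p _; rewrite Yp_act. Qed.

Lemma Yp_sub S m r s : is_submodule S -> S m -> S (Yp m r s).
Proof.
move=> hS hm; elim: r s => [|r IH] s; first by rewrite Yp0; case: eqP => // _; exact: subm0.
by rewrite YpS; apply: subm_sum => // p _; apply: subm_act.
Qed.

(** Leibniz rule: the commutators [D p] of [T] with the y_p commute with all y_q, so the r terms
    coming from y(u)^r agree. *)
Lemma Yp_der (T : V -> V) (D : nat -> V -> V) m r s :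
  T 0 = 0 -> (forall u w, T (u + w) = T u + T w) -> fam_lin D ->
  (forall p q u, D p (gact V Y2 q u) = gact V Y2 q (D p u)) ->
  (forall p u, T (gact V Y2 p u) = gact V Y2 p (T u) + D p u) ->
  T (Yp m r s) = Yp (T m) r s + (\sum_(p < s.+1) D p (Yp m r.-1 (s - p)%N)) *+ r.
Proof.
move=> T0 TD hD hDY hT; elim: r s => [|r IH] s.
  by rewrite !Yp0 mulr0n addr0; case: eqP.
rewrite !YpS (big_morph _ TD T0) /=.
under eq_bigr => p _ do rewrite hT IH gactD gactMn -addrA.
rewrite big_split /=; congr (_ + _).
rewrite big_split /= mulrSr; congr (_ + _).
case: r IH => [|r] IH; first by rewrite big1.
rewrite sumrMnl; congr (_ *+ _).
have := @cv_comm F V (gact V Y2) D (Yp m r) s (fam_lin_act V Y2) hD.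
rewrite /cv /= => ->; last by move=> p q u; rewrite hDY.
by [].
Qed.

(** Since the y_p commute, both sides are the coefficient of u^s in u d/du applied to y(u)^(r+1). *)
Lemma Yp_Euler m r s :
  Yp m r.+1 s *+ s = (\sum_(p < s.+1) gact V Y2 p (Yp m r (s - p)%N) *+ p) *+ r.+1.
Proof.
elim: r s => [|r IH] s.
  rewrite YpS mulr1n -sumrMnl; apply: eq_bigr => p _; rewrite Yp0.
  have [e|ne] := eqVneq (s - p)%N 0%N; last by rewrite gact0 !mul0rn.
  by congr (_ *+ _); have := ltn_ord p; lia.
rewrite [in LHS]YpS -sumrMnl.
have E (p : 'I_s.+1) : gact V Y2 p (Yp m r.+1 (s - p)%N) *+ s =
    gact V Y2 p (Yp m r.+1 (s - p)%N) *+ p + gact V Y2 p (Yp m r.+1 (s - p)%N *+ (s - p)).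
  by rewrite gactMn -mulrnDr; congr (_ *+ _); have := ltn_ord p; lia.
rewrite (eq_bigr _ (fun (p : 'I_s.+1) _ => E p)) big_split /= [RHS]mulrS; congr (_ + _).
under eq_bigr => p _ do rewrite IH gactMn.
rewrite sumrMnl; congr (_ *+ _).
pose D q u := gact V Y2 q u *+ q.
have hD : fam_lin D by split=> *; rewrite /D ?gactD ?mulrnDl // gact0 mul0rn.
have := @cv_comm F V (gact V Y2) D (Yp m r) s (fam_lin_act V Y2) hD.
rewrite /cv /D /= => -> // p q u.
by rewrite gactMn Y2Y2.
Qed.

End YPower.
Arguments Yp : simpl never.

(** * Garland's formula *)

Definition Gmin (xi : seq nat) (r : nat) : nat := (\sum_(x <- xi) minn r x)%N.

Section Garland.
Variables (F : fieldType) (char0 : forall k, k.+1%:R != 0 :> F) (V : gmod F).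
Implicit Types (u w m : V) (S T : V -> Prop) (a b : gb) (r s p q : nat).

Definition hwS (l1 : F) (l2 : nat) S m : Prop :=
  [/\ forall r, [/\ S (gact V Y1 r m), S (gact V X2 r m) & S (gact V X3 r m)],
      forall r, S (gact V H1 r m - (if r == 0%N then l1 else 0) *: m)
    & forall r, S (gact V H2 r m - (if r == 0%N then l2%:R else 0) *: m)].

(* The defining relations of [V(l1, xi)] modulo [S]; for a partition they amount to
   [deg_u (u y(u))^r m <= sum_j min(r, xi_j)]. *)
Definition cvS (l1 : F) (xi : seq nat) S m : Prop :=
  hwS l1 (sumn xi) S m /\ forall r s, (Gmin xi r < r + s)%N -> S (Yp m r s).

Lemma char0_neq0 k : (0 < k)%N -> k%:R != 0 :> F.
Proof. by case: k. Qed.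

Lemma submMnr S k u : is_submodule S -> (0 < k)%N -> S (u *+ k) -> S u.
Proof. by move=> hS k0; rewrite -scaler_nat; apply: submZr => //; apply: char0_neq0. Qed.

Lemma H2_Yp q m r s : gact V H2 q (Yp m r s) = Yp (gact V H2 q m) r s
  - (\sum_(p < s.+1) gact V Y2 (q + p)%N (Yp m r.-1 (s - p)%N)) *+ (2 * r).
Proof.
pose D p u := (-2)%:~R *: gact V Y2 (q + p)%N u.
rewrite (@Yp_der F V (gact V H2 q) D); first 1 last.
- exact: gact0.
- exact: gactD.
- by split=> *; rewrite /D ?gactD ?scalerDr // gact0 scaler0.
- by move=> p p' u; rewrite /D gactZ Y2Y2.
- by move=> p u; rewrite (@gact_even _ _ H2 Y2 Y2 (-2)).
congr (_ + _); rewrite /D -scaler_sumr -scaler_nat scalerA -[in RHS]scaler_nat -scaleNr.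
by congr (_ *: _); rewrite natrM !rmorphN; ring.
Qed.

Lemma sum_triangle_diag (W : zmodType) (f : nat -> W) s :
  \sum_(p < s.+1) \sum_(q < (s - p).+1) f (p + q)%N = \sum_(t < s.+1) f t *+ t.+1.
Proof.
elim: s => [|s IH]; first by rewrite !big_ord1.
rewrite big_ord_recr [RHS]big_ord_recr /= -IH subnn big_ord1 addn0.
have E (p : 'I_s.+1) : \sum_(q < (s.+1 - p).+1) f (p + q)%N =
   \sum_(q < (s - p).+1) f (p + q)%N + f s.+1.
  have hp : (p <= s)%N by rewrite -ltnS ltn_ord.
  by rewrite (subSn hp) big_ord_recr /=; congr (_ + f _); lia.
rewrite (eq_bigr _ (fun (p : 'I_s.+1) _ => E p)) big_split /= -addrA; congr (_ + _).
by rewrite sumr_const card_ord -mulrSr.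
Qed.

(** The two sums arise when x_2 t is moved through y(u)^(r+2): one is the inductive contribution of
    the remaining factors, the other comes from h_2 t^(p+1) acting on y(u)^(r+1). By Euler's
    identity they are r(s+1) and 2(s+1) times the same coefficient of y(u)^(r+1). *)
Lemma Yp_Garland_sum m r s :
  \sum_(p < s.+1) gact V Y2 p (Yp m r (s - p).+1) *+ (r.+1 * (s - p).+1) +
  \sum_(p < s.+1) (\sum_(q < (s - p).+1) gact V Y2 (1 + p + q)%N (Yp m r (s - p - q)%N))
      *+ (2 * r.+1) =
  Yp m r.+1 s.+1 *+ (r.+2 * s.+1).
Proof.
pose Z := \sum_(p < s.+2) gact V Y2 p (Yp m r (s.+1 - p)%N) *+ p.
have hZ : Z *+ r.+1 = Yp m r.+1 s.+1 *+ s.+1 by rewrite Yp_Euler.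
have E2 : \sum_(p < s.+1) (\sum_(q < (s - p).+1) gact V Y2 (1 + p + q)%N (Yp m r (s - p - q)%N))
      *+ (2 * r.+1) = Z *+ (2 * r.+1).
  rewrite sumrMnl; congr (_ *+ _).
  rewrite /Z [RHS]big_ord_recl mulr0n add0r.
  pose f t := gact V Y2 t.+1 (Yp m r (s - t)%N).
  rewrite -(@sum_triangle_diag _ f); apply: eq_bigr => p _; apply: eq_bigr => q _.
  by rewrite /f subnDA.
have E1 : \sum_(p < s.+1) gact V Y2 p (Yp m r (s - p).+1) *+ (s - p).+1 + Z
    = Yp m r.+1 s.+1 *+ s.+1.
  rewrite /Z [X in _ + X = _]big_ord_recr /= addrA -big_split /= [in RHS]YpS [in RHS]big_ord_recr /= mulrnDl.
  congr (_ + _); rewrite -sumrMnl; apply: eq_bigr => p _.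
  have hp : (p <= s)%N by rewrite -ltnS ltn_ord.
  by rewrite (subSn hp) -mulrnDr; congr (_ *+ _); lia.
rewrite E2; under eq_bigr => p _ do rewrite mulnC mulrnA.
rewrite sumrMnl mulnC mulrnA hZ.
move/eqP: E1; rewrite eq_sym -subr_eq => /eqP <-.
rewrite mulrnBl hZ -!mulrnA (_ : (r.+2 * s.+1 = s.+1 * r.+1 + s.+1)%N); last by lia.
rewrite muln2 -addnn !mulrnDr addrA subrK //.
Qed.

(** On such an [m], x_2 t acts modulo [S] by y(u)^r -> - r d/du y(u)^(r-1). *)
Lemma X2_Yp S m r s : is_submodule S -> (forall p, (0 < p)%N -> S (gact V H2 p m)) ->
  S (gact V X2 1%N m) ->
  S (gact V X2 1%N (Yp m r s) + Yp m r.-1 s.+1 *+ (r * s.+1)).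
Proof.
move=> hS hH hX; elim: r s => [|r IH] s.
  by rewrite mul0n mulr0n addr0 Yp0; case: eqP => // _; rewrite gact0; apply: subm0.
rewrite YpS gact_sum /=.
have E (p : 'I_s.+1) : gact V X2 1 (gact V Y2 p (Yp m r (s - p)%N)) =
   gact V Y2 p (gact V X2 1 (Yp m r (s - p)%N)) + gact V H2 (1 + p)%N (Yp m r (s - p)%N).
  by rewrite (@gact_even _ _ X2 Y2 H2 1) // scale1r.
rewrite (eq_bigr _ (fun (p : 'I_s.+1) _ => E p)) big_split /=.
case: r IH {E} => [|r] IH.
  rewrite [X in _ + X](_ : _ = 0) ?addr0; last by rewrite /= Yp0 mul0rn.
  apply: (submD hS); apply: (subm_sum hS) => p _.
    by apply: subm_act => //; have := IH (s - p)%N; rewrite mul0n mulr0n addr0.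
  by rewrite Yp0; case: eqP => // _; [apply: hH | rewrite gact0; apply: subm0].
rewrite -Yp_Garland_sum addrACA.
apply: (submD hS); rewrite -big_split /=; apply: (subm_sum hS) => p _.
  rewrite -gactMn -gactD; apply: subm_act => //; exact: IH.
by rewrite H2_Yp subrK; apply: Yp_sub => //; apply: hH.
Qed.

(** Starting from [Yp m R 0], which is y_2^R m, each x_2 t trades one factor y(u) for one degree in
    u; the integers picked up are nonzero in characteristic 0. *)
Lemma Garland S m : is_submodule S -> (forall p, (0 < p)%N -> S (gact V H2 p m)) ->
  S (gact V X2 1%N m) -> forall R s, (s <= R)%N ->
  exists2 c : F, c != 0 &
    S (iter s (gact V X2 1%N) (iter R (gact V Y2 0%N) m) - c *: Yp m (R - s) s).
Proof.
move=> hS hH hX R; elim=> [|s IH] hs.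
  by exists 1; rewrite ?oner_eq0 // subn0 scale1r Yp_at0 subrr; apply: subm0.
have [c c0 hc] := IH (ltnW hs).
exists (- (c * ((R - s) * s.+1)%:R)).
  by rewrite oppr_eq0 mulf_neq0 // char0_neq0 // muln_gt0 subn_gt0 hs.
rewrite iterS.
have h1 := subm_act hS X2 1 hc; rewrite gactB gactZ in h1.
have h2 := X2_Yp (R - s) s hS hH hX.
have := submD hS h1 (submZ hS c h2).
rewrite scalerDr addrA subrK scaleNr opprK -scaler_nat scalerA.
by rewrite -subn1 -subnDA addn1.
Qed.

Lemma Garland_iff S m r s : is_submodule S -> (forall p, (0 < p)%N -> S (gact V H2 p m)) ->
  S (gact V X2 1%N m) ->
  (S (iter s (gact V X2 1%N) (iter (r + s) (gact V Y2 0%N) m)) <-> S (Yp m r s)).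
Proof.
move=> hS hH hX; have [c c0] := Garland hS hH hX (leq_addl r s).
rewrite addnK => h; split=> h'.
  apply: (submZr hS c0); rewrite -[_ *: _]opprK; apply: (submN hS).
  by move: h; rewrite addrC; apply: submDr.
by apply: (submDr hS) h; rewrite -scaleNr; apply: submZ.
Qed.

Lemma Gmin_nil r : Gmin [::] r = 0%N. Proof. by rewrite /Gmin big_nil. Qed.
Lemma Gmin_cons x xi r : Gmin (x :: xi) r = (minn r x + Gmin xi r)%N.
Proof. by rewrite /Gmin big_cons. Qed.
Lemma Gmin_cat xi xi' r : Gmin (xi ++ xi') r = (Gmin xi r + Gmin xi' r)%N.
Proof. by rewrite /Gmin big_cat. Qed.
Lemma Gmin_perm xi xi' r : perm_eq xi xi' -> Gmin xi r = Gmin xi' r.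
Proof. by move=> h; rewrite /Gmin (perm_big _ h). Qed.

Lemma Gmin_le xi k r : (Gmin xi r <= k * r + sumn (drop k xi))%N.
Proof.
elim: xi k => [|x xi IH] k; first by rewrite Gmin_nil.
rewrite Gmin_cons; case: k => [|k] /=.
  by have := IH 0%N; rewrite drop0 mul0n !add0n => h; rewrite leq_add // geq_minr.
by rewrite mulSn -addnA leq_add // geq_minl.
Qed.

(** For a partition the bound [Gmin_le] is attained when k is the number of parts that are at least
    r. This turns the family of defining inequalities, indexed by k, into a single one that is
    symmetric in the parts. *)
Lemma Gmin_sorted xi r : sorted geq xi ->
  exists2 k, (k <= size xi)%N & Gmin xi r = (k * r + sumn (drop k xi))%N.
Proof.
elim: xi => [|x xi IH] hs; first by exists 0%N; rewrite ?Gmin_nil.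
have [k hk e] := IH (path_sorted hs).
have [hx|hx] := leqP r x.
  by exists k.+1 => //=; rewrite Gmin_cons e mulSn (minn_idPl hx) addnA.
exists 0%N => //; rewrite mul0n add0n drop0 Gmin_cons (minn_idPr (ltnW hx)) /=.
congr addn; rewrite /Gmin sumnE !big_seq; apply: eq_bigr => z hz.
have : (z <= x)%N.
  by have := order_path_min (rev_trans leq_trans) hs => /allP /(_ _ hz).
by move=> h; apply/minn_idPr; apply: leq_trans h (ltnW hx).
Qed.

Lemma cvrel_cvS l1 xi m : xi != [::] -> sorted geq xi -> cvrel (l1, xi) m ->
  cvS l1 xi (fun u => u = 0) m.
Proof.
move=> xi0 hs [] /= h1 h2 h3 h4 h5.
have hS : is_submodule (fun u : V => u = 0).
  by split=> [//|c u w -> ->|a r u ->]; rewrite ?scaler0 ?addr0 // gact0.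
have hH p : (0 < p)%N -> gact V H2 p m = 0.
  by move=> p0; rewrite h3; case: eqP p0 => [->//|_ _]; rewrite scale0r.
have hX : gact V X2 1%N m = 0 by case: (h1 1%N) => _ [].
split; first split.
- by move=> r; case: (h1 r) => ? [].
- by move=> r; rewrite h2 subrr.
- by move=> r; rewrite h3 subrr.
move=> r s hG.
have [r0|r0] := posnP r.
  move: hG; rewrite r0 add0n Yp0; by case: s.
apply/(Garland_iff r s hS hH hX).
have [k hk e] := Gmin_sorted r hs.
(* For k = 0 the inequality reads lambda_2 < r + s, and the relation at hand is y_2^(lambda_2+1) m =
   0; a positive k is the index k - 1 of the defining relations. *)
case: k hk e => [|k] hk e.
  rewrite e mul0n add0n drop0 in hG.
  have -> : iter (r + s) (gact V Y2 0%N) m = 0; last exact: (subm_iter hS).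
  by rewrite -(subnK hG) iterD iterS h4; apply: (subm_iter hS).
have s0 : (0 < s)%N by move: hG; rewrite e; case: s => //; lia.
apply: (h5 r s k) => //; move: hG; rewrite e mulSn; lia.
Qed.

Lemma cvS_cvrel l1 xi m : cvS l1 xi (fun u => u = 0) m -> cvrel (l1, xi) m.
Proof.
have hS : is_submodule (fun u : V => u = 0).
  by split=> [//|c u w -> ->|a r u ->]; rewrite ?scaler0 ?addr0 // gact0.
move=> [[h1 h2 h3] h4].
have h3' r : gact V H2 r m = (if r == 0%N then (sumn xi)%:R else 0) *: m.
  by apply/eqP; rewrite -subr_eq0 (h3 r).
have hH p : (0 < p)%N -> gact V H2 p m = 0.
  by move=> p0; rewrite h3'; case: eqP p0 => [->//|_ _]; rewrite scale0r.
have hX : gact V X2 1%N m = 0 by case: (h1 1%N).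
split=> //=.
- by move=> r; case: (h1 r).
- by move=> r; apply/eqP; rewrite -subr_eq0 (h2 r).
- have := h4 (sumn xi).+1 0%N; rewrite Yp_at0 addn0; apply.
  by rewrite ltnS; have := Gmin_le xi 0 (sumn xi).+1; rewrite mul0n add0n drop0.
- move=> r s k r0 s0 _ hs; apply/(Garland_iff r s hS hH hX); apply: h4.
  by apply: leq_ltn_trans (Gmin_le xi k.+1 r) _; rewrite mulSn -addnA ltn_add2l.
Qed.

Lemma zero_subm : is_submodule (fun u : V => u = 0).
Proof. by split=> [//|c u w -> ->|a r u ->]; rewrite ?scaler0 ?addr0 // gact0. Qed.

End Garland.

(** * Relations satisfied by the layers *)

Section Gains.
Variables (F : fieldType) (char0 : forall k, k.+1%:R != 0 :> F) (V : gmod F).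
Variables (S : V -> Prop) (hS : is_submodule S).
Implicit Types (u w m : V) (a b : gb) (r s p q : nat).

(** Currents that kill the generator when there are at most n + 1 parts. For n > 0 their brackets
    with y_2 t^n, x_1 t^n and y_3 t^n are again combinations of such currents, so the generators of
    the layers are killed as well. *)
Definition pos_op (n : nat) (a : gb) (r : nat) : bool :=
  match a with
  | Y2 | X1 | Y3 => (n < r)%N
  | X2 => true
  | _ => (0 < r)%N
  end.

Definition pos_killed n u := forall a r, pos_op n a r -> S (gact V a r u).

Definition tail_op (b : gb) := match b with Y2 | X1 | Y3 => true | _ => false end.

Lemma pos_killed_act n b u : (0 < n)%N -> tail_op b -> pos_killed n u ->
  pos_killed n (gact V b n u).
Proof.
move=> n0 hb hu a r har; rewrite gact_swap.
apply: (submD hS); first by apply/(submZ hS)/(subm_act hS)/hu.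
have hall : all (fun x : int * gb => pos_op n x.2 (r + n)) (lie_table a b).
  by case: a har; case: b hb => //= _ h; rewrite ?andbT; lia.
rewrite big_seq; apply: (subm_sum hS) => x hx; apply: (submZ hS); apply: hu.
by move/allP: hall => /(_ _ hx).
Qed.

Lemma pos_killed_iter n k u : (0 < n)%N -> pos_killed n u ->
  pos_killed n (iter k (gact V Y2 n) u).
Proof. by move=> n0 hu; elim: k => //= k; apply: pos_killed_act. Qed.

Lemma Yp1 m p : Yp m 1 p = gact V Y2 p m.
Proof.
rewrite YpS (bigD1 ord_max) //= subnn Yp0 eqxx big1 ?addr0 // => q hq.
rewrite Yp0; case: eqP => // e; last by rewrite gact0.
move: hq; rewrite -val_eqE /=; have := ltn_ord q; lia.
Qed.

Lemma pos_killed_cvS l1 xi n m : (size xi <= n.+1)%N -> cvS l1 xi S m -> pos_killed n m.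
Proof.
move=> hn [[h1 h2 h3] h4].
have hY p : (n < p)%N -> S (gact V Y2 p m).
  move=> hp; rewrite -Yp1; apply: h4.
  apply: (leq_ltn_trans (Gmin_le xi (size xi) 1)).
  by rewrite drop_size /=; lia.
have [hY1 hX2 hX3] : [/\ forall r, S (gact V Y1 r m), forall r, S (gact V X2 r m)
    & forall r, S (gact V X3 r m)] by split=> r; case: (h1 r).
case=> /= r hr.
- have := subm_act hS X3 0 (hY r hr).
  rewrite (@gact_even _ _ X3 Y2 X1 1) // scale1r addrC; apply: submDr => //.
  exact: subm_act.
- exact: hX2.
- exact: hX3.
- exact: hY1.
- exact: hY.
- have := subm_act hS Y1 0 (hY r hr).
  rewrite (@gact_even _ _ Y1 Y2 Y3 (-1)) // scaleN1r addrC => h.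
  rewrite -[gact _ _ _ _]opprK; apply: (submN hS).
  by move: h; apply: submDr => //; exact: subm_act.
- by have := h2 r; case: r hr => //= r _; rewrite scale0r subr0.
- by have := h3 r; case: r hr => //= r _; rewrite scale0r subr0.
Qed.

(** A single one of the linear bounds k r + s0 whose minimum is [Gmin], sharpened by [e]. Each
    operator that leads to a generator of a layer increases [e]: by 2 for y_2 t^n, by 1 for x_1 t^n
    and y_3 t^n. *)
Definition bnd (k s0 e : nat) m := forall r s, (k * r + s0 < r + s + e)%N -> S (Yp m r s).

Lemma cvS_bnd l1 xi k m : cvS l1 xi S m -> bnd k (sumn (drop k xi)) 0 m.
Proof.
by move=> [_ h] r s; rewrite addn0 => hrs; apply: h; apply: leq_ltn_trans (Gmin_le _ _ _) hrs.
Qed.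

(* Since [(n-1) y - u y'] has no [u^(n-1)]-term and its [u^n]-term is [- y_n u^n], Euler's
   identity expresses [y_n y^r] through [y^(r+1)] and [y_p y^r], [p <= n - 2]. *)
Lemma bnd_Y2 n k s0 e m : (k < n)%N -> (forall p, (n < p)%N -> S (gact V Y2 p m)) ->
  bnd k s0 e m -> bnd k s0 (e + 2) (gact V Y2 n m).
Proof.
move=> kn hp hb r s hrs; rewrite -Yp_act //.
pose t p := gact V Y2 p (Yp m r (s + n - p)%N).
have h1 : S (\sum_(p < (s + n).+1) t p).
  by rewrite /t -YpS; apply: hb; rewrite mulnS; lia.
have h2 : S (\sum_(p < (s + n).+1) t p *+ p).
  apply: (@submMnr _ char0 _ _ r.+1) => //; rewrite /t -Yp_Euler.
  by apply: (submMn hS); apply: hb; rewrite mulnS; lia.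
have h3 : S (\sum_(p < (s + n).+1) (t p *+ p - t p *+ n.-1)).
  by rewrite sumrB sumrMnl; apply: (submB hS) => //; apply: (submMn hS).
have hn : (n < (s + n).+1)%N by lia.
move: h3; rewrite (bigD1 (Ordinal hn)) //=.
move/(submDK hS); rewrite -mulrnBr ?leq_pred // (_ : n - n.-1 = 1)%N; last by lia.
rewrite mulr1n /t addnK; apply; apply: (subm_sum hS) => p hpn.
have {}hpn : p != n :> nat by apply: contra hpn => /eqP pn; apply/eqP/val_inj.
have [lt_np|le_pn] := ltnP n p.
  suff : S (gact V Y2 p (Yp m r (s + n - p)%N)).
    by move=> h; apply: (submB hS); apply: (submMn hS).
  by rewrite Yp_act //; apply: Yp_sub => //; apply: hp.
have [e1|ne1] := eqVneq (p : nat) n.-1; first by rewrite e1 subrr; apply: (subm0 hS).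
suff : S (gact V Y2 p (Yp m r (s + n - p)%N)).
  by move=> h; apply: (submB hS); apply: (submMn hS).
apply: (subm_act hS); apply: hb; lia.
Qed.

(** Applying a to the vanishing coefficient of u^(s+n) in y(u)^(r+1) m gives a multiple of the sum
    over p of b t^p times the coefficient of u^(s+n-p) in y(u)^r m. The terms p > n are killed and
    those with p < n fall under the old bound, so the term p = n vanishes too, one degree earlier
    than the old bound predicts. *)
Lemma bnd_odd n k s0 e m a b (c : int) : (k <= n)%N -> c%:~R != 0 :> F ->
  even_swap a Y2 -> lie_table a Y2 = [:: (c, b)] ->
  even_swap b Y2 -> lie_table b Y2 = [::] ->
  S (gact V a 0 m) -> (forall p, (n < p)%N -> S (gact V b p m)) ->
  bnd k s0 e m -> bnd k s0 e.+1 (gact V b n m).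
Proof.
move=> kn c0 ha1 ha2 hb1 hb2 ham hp hb r s hrs; rewrite -Yp_act //.
have h : S (gact V a 0 (Yp m r.+1 (s + n)%N)).
  by apply: (subm_act hS); apply: hb; rewrite mulnS; lia.
move: h; rewrite (@Yp_der F V (gact V a 0) (fun p u => c%:~R *: gact V b p u)); first 1 last.
- exact: gact0.
- exact: gactD.
- by split=> *; rewrite ?gactD ?scalerDr // gact0 scaler0.
- by move=> p p' u; rewrite gactZ (@gact_comm _ _ b Y2).
- by move=> p u; rewrite (@gact_even _ _ a Y2 b c).
rewrite addrC => /(submDK hS) h.
have {h} /(submMnr char0 hS) := h (Yp_sub _ _ hS ham); move/(_ isT).
rewrite -scaler_sumr => /(submZr hS c0) /=.
have hn : (n < (s + n).+1)%N by lia.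
rewrite (bigD1 (Ordinal hn)) //= addnK; move/(submDK hS); apply.
apply: (subm_sum hS) => p hpn.
have {}hpn : p != n :> nat by apply: contra hpn => /eqP pn; apply/eqP/val_inj.
have [lt_np|le_pn] := ltnP n p.
  by rewrite Yp_act //; apply: Yp_sub => //; apply: hp.
by apply: (subm_act hS); apply: hb; lia.
Qed.

Lemma bnd_Y2_iter n k s0 e j m : (0 < n)%N -> (k < n)%N -> pos_killed n m ->
  bnd k s0 e m -> bnd k s0 (e + 2 * j) (iter j (gact V Y2 n) m).
Proof.
move=> n0 kn hm hb; elim: j => [|j IH]; first by rewrite muln0 addn0.
rewrite iterS (_ : e + 2 * j.+1 = e + 2 * j + 2)%N; last by lia.
apply: bnd_Y2 => // p hp; exact: (pos_killed_iter _ n0 hm).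
Qed.

Lemma bnd_X1 n k s0 e m : (k <= n)%N -> S (gact V X3 0 m) -> pos_killed n m ->
  bnd k s0 e m -> bnd k s0 e.+1 (gact V X1 n m).
Proof.
move=> kn hX hm; apply: (@bnd_odd n k s0 e m X3 X1 1) => //; first by rewrite oner_eq0.
by move=> p hp; apply: hm.
Qed.

Lemma bnd_Y3 n k s0 e m : (k <= n)%N -> S (gact V Y1 0 m) -> pos_killed n m ->
  bnd k s0 e m -> bnd k s0 e.+1 (gact V Y3 n m).
Proof.
move=> kn hX hm; apply: (@bnd_odd n k s0 e m Y1 Y3 (-1)) => //.
  by rewrite rmorphN1 oppr_eq0 oner_eq0.
by move=> p hp; apply: hm.
Qed.

Lemma iterY_act a q n k m : even_swap a Y2 -> lie_table a Y2 = [::] ->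
  gact V a q (iter k (gact V Y2 n) m) = iter k (gact V Y2 n) (gact V a q m).
Proof. by move=> h1 h2; elim: k => //= k IH; rewrite gact_comm // IH. Qed.

Lemma iterY_der a b (c : int) q n k m : even_swap a Y2 -> lie_table a Y2 = [:: (c, b)] ->
  even_swap b Y2 -> lie_table b Y2 = [::] ->
  gact V a q (iter k (gact V Y2 n) m) = iter k (gact V Y2 n) (gact V a q m)
    + (c%:~R *: gact V b (q + n)%N (iter k.-1 (gact V Y2 n) m)) *+ k.
Proof.
move=> h1 h2 h3 h4; elim: k => [|k IH]; first by rewrite mulr0n addr0.
rewrite [in LHS]iterS (@gact_even _ _ a Y2 b c) // IH gactD -iterS -addrA; congr (_ + _).
rewrite gactMn gactZ; case: k {IH} => [|k] /=; first by rewrite mulr0n add0r.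
by rewrite -(@gact_comm _ _ b Y2) // -mulrSr.
Qed.

(** A monomial of y(u)^r that survives modulo [S] has all indices at most n and fewer than x of them
    equal to n, so its degree is below (n-1) r + x. The variable [e] counts the factors y_n already
    moved onto [m]. *)
Lemma Yp_low n x m : (0 < n)%N -> (forall p, (n < p)%N -> S (gact V Y2 p m)) ->
  S (iter x (gact V Y2 n) m) ->
  forall r e s, (n.-1 * r + x <= s + e)%N -> S (Yp (iter e (gact V Y2 n) m) r s).
Proof.
move=> n0 hp hx; elim=> [|r IH] e s.
  rewrite muln0 add0n Yp0; case: eqP => [->|_ _]; last exact: (subm0 hS).
  by rewrite add0n => h; rewrite -(subnK h) iterD; apply: (subm_iter hS).
move=> h; rewrite YpS; apply: (subm_sum hS) => p _.
have [lt_pn|le_np] := ltnP p n.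
  by apply: (subm_act hS); apply: IH; move: h; rewrite mulnS; lia.
rewrite Yp_act //; have [e1|ne] := eqVneq (p : nat) n.
  rewrite e1 -iterS; apply: IH; move: h; rewrite mulnS; have := ltn_ord p; lia.
apply: Yp_sub => //; rewrite iterY_act //; apply: (subm_iter hS); apply: hp.
by move: ne le_np; case: ltngtP.
Qed.

(** With all surviving indices at most n, the only monomial of degree n r in y(u)^r is y_n^r. *)
Lemma Yp_top n m r : (forall p, (n < p)%N -> S (gact V Y2 p m)) ->
  S (Yp m r (n * r) - iter r (gact V Y2 n) m).
Proof.
elim: r m => [|r IH] m hp; first by rewrite muln0 subrr; apply: (subm0 hS).
rewrite mulnS; have hn : (n < (n + n * r).+1)%N by lia.
rewrite YpSr (bigD1 (Ordinal hn)) //= addrAC addKn -iterS iterSr.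
apply: (submD hS).
  by apply: IH => p /hp h; rewrite Y2Y2; apply: (subm_act hS).
apply: (subm_sum hS) => p hpn.
have {}hpn : p != n :> nat by apply: contra hpn => /eqP pn; apply/eqP/val_inj.
have [lt_np|le_pn] := ltnP n p; first by apply: Yp_sub => //; apply: hp.
have hp' q : (n.+1 < q)%N -> S (gact V Y2 q (gact V Y2 p m)).
  by move=> hq; rewrite Y2Y2; apply: (subm_act hS); apply: hp; apply: ltnW.
have hx : S (iter 1 (gact V Y2 n.+1) (gact V Y2 p m)).
  by rewrite /= Y2Y2; apply: (subm_act hS); apply: hp.
(* With n + 1 in place of n and exponent 1, the lemma says that y(u)^r has degree at most n r; for p
   < n the required degree n + n r - p exceeds this. *)
have := @Yp_low n.+1 1 (gact V Y2 p m) isT hp' hx r 0 (n + n * r - p)%N; apply.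
by move: hpn le_pn; case: ltngtP => //=; lia.
Qed.

(** The minimum [Gmin] of the new partition is attained at some index i <= n. For i < n, replacing
    the parts a', x by c is exactly the sharpening by [e], as c + e = a' + x; for i = n the bound
    (n-1) r on the degree follows from y_n k lying in [S]. *)
Lemma cvS_piece n (xs : seq nat) (c a' x e : nat) k : (0 < n)%N -> size xs = n.-1 -> sorted geq (rcons xs c) ->
  (c + e = a' + x)%N -> pos_killed n k -> S (gact V Y2 n k) ->
  (forall i, (i < n)%N -> bnd i (sumn (drop i (xs ++ [:: a'; x]))) e k) ->
  forall r s, (Gmin (rcons xs c) r < r + s)%N -> S (Yp k r s).
Proof.
move=> n0 sx hs hce hk hyk hb r s; have [i] := Gmin_sorted r hs.
rewrite size_rcons sx prednK // leq_eqVlt => /orP[/eqP ->|hi] ->.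
  rewrite drop_oversize ?size_rcons ?sx ?prednK //= addn0 => h.
  have := @Yp_low n 1 k n0 _ hyk r 0 s; apply.
    by move=> p hp; apply: hk.
  by move: h; rewrite -[X in (X * _)%N](prednK n0) mulSn; lia.
move=> h; apply: (hb i hi); move: h.
have hi' : (i <= size xs)%N by rewrite sx; lia.
by rewrite -cats1 !drop_cat; move: hi'; rewrite leq_eqVlt => /orP[/eqP ->|->];
  rewrite ?ltnn ?subnn ?sumn_cat /=; lia.
Qed.

End Gains.

(** * The generators of the layers of the kernel *)

Section Step.
Variables (F : fieldType) (char0 : forall k, k.+1%:R != 0 :> F) (V : gmod F).
Variables (S : V -> Prop) (hS : is_submodule S).
Implicit Types (u w : V) (T : V -> Prop) (b : gb) (r s p : nat).

Definition cartan (h : gb) := match h with H1 | H2 => true | _ => false end.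

Lemma gact_cartan h b p r u : cartan h ->
  gact V h p (gact V b r u) = gact V b r (gact V h p u)
    + (lie_coef h b b)%:~R *: gact V b (p + r)%N u.
Proof.
case: h => // _; case: b; rewrite /lie_coef /= ?addr0;
  do ?[by rewrite gact_comm // scale0r addr0];
  exact: gact_even.
Qed.

Definition eigen h (c : F) u := S (gact V h 0 u - c *: u).

Lemma eigen_act h b c c' r u : cartan h -> c' = c + (lie_coef h b b)%:~R ->
  eigen h c u -> eigen h c' (gact V b r u).
Proof.
move=> hh ->; rewrite /eigen gact_cartan // scalerDl opprD addrACA subrr addr0 => h'.
by rewrite -gactZ -gactB; apply: (subm_act hS).
Qed.

Lemma eigen_iter h c c' r k u : cartan h -> c' = c + (lie_coef h Y2 Y2 * k%:Z)%:~R ->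
  eigen h c u -> eigen h c' (iter k (gact V Y2 r) u).
Proof.
move=> hh -> hu; elim: k => [|k IH]; first by rewrite mulr0 addr0.
apply: eigen_act hh _ IH; rewrite -addrA -rmorphD /=; congr (_ + _%:~R).
by rewrite -addn1 PoszD mulrDr mulr1.
Qed.

Lemma hwS_pos T n c1 l2 k : is_submodule T -> (forall u, S u -> T u) ->
  pos_killed S n k -> T (gact V X3 0 k) -> T (gact V Y1 0 k) ->
  eigen H1 c1 k -> eigen H2 l2%:R k -> hwS c1 l2 T k.
Proof.
move=> hT hST hk hX hY h1 h2; split=> r; first split.
- by case: r => // r; apply: hST; apply: hk.
- by apply: hST; apply: hk.
- by case: r => // r; apply: hST; apply: hk.
- by case: r => [|r]; apply: hST => //=; rewrite scale0r subr0; apply: hk.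
- by case: r => [|r]; apply: hST => //=; rewrite scale0r subr0; apply: hk.
Qed.

Variables (n : nat) (xs : seq nat) (a x : nat) (l1 : F) (m : V).
Hypotheses (n0 : (0 < n)%N) (sx : size xs = n.-1) (hsort : sorted geq (xs ++ [:: a; x])).
Hypotheses (x0 : (0 < x)%N) (hm : cvS l1 (xs ++ [:: a; x]) S m).

Let yn := gact V Y2 n.
Let cm := gact V X1 n m.
Let bm := gact V Y3 n m.
Definition step0 := iter x (gact V Y2 n) m.
Definition step1 := iter x.-1 (gact V Y2 n) (gact V X1 n m).
Definition step2 := iter x.-1 (gact V Y2 n) (gact V Y3 n m).
(** For x = 1 the exponent x - 2 is negative and truncation would leave y_3 t^n x_1 t^n m; the
    fourth generator has to be zero there. *)
Definition step3 := if x == 1%N then 0 else iter x.-2 (gact V Y2 n) (gact V Y3 n (gact V X1 n m)).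

Let size_xi : size (xs ++ [:: a; x]) = n.+1.
Proof. by rewrite size_cat sx /= addn2 prednK. Qed.

Let ax : (x <= a)%N.
Proof. by have [_ /=] := cat_sorted2 hsort; rewrite andbT. Qed.

Lemma sorted_rcons_low c : (c <= a)%N -> sorted geq (rcons xs c).
Proof.
move=> ca; move: hsort; case: (xs) => //= y ys; rewrite cat_path rcons_path /=.
by case/and3P=> -> h _; apply: leq_trans ca h.
Qed.

Let km : pos_killed S n m.
Proof. by apply: (pos_killed_cvS hS (xi := xs ++ [:: a; x])) hm; rewrite size_xi. Qed.

Let X3m : S (gact V X3 0 m). Proof. by case: hm => [[h _ _] _]; case: (h 0%N). Qed.
Let Y1m : S (gact V Y1 0 m). Proof. by case: hm => [[h _ _] _]; case: (h 0%N). Qed.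
Let kcm : pos_killed S n cm. Proof. exact: pos_killed_act. Qed.
Let kbm : pos_killed S n bm. Proof. exact: pos_killed_act. Qed.
Let kbcm : pos_killed S n (gact V Y3 n cm). Proof. exact: pos_killed_act. Qed.

Let char2 : (2%:R : F) != 0. Proof. exact: char0. Qed.

Lemma X1X1 u : gact V X1 n (gact V X1 n u) = 0.
Proof.
have := @gact_odd0 _ V X1 X1 n n u isT erefl => /eqP.
by rewrite -subr_eq0 opprK -mulr2n -scaler_nat scaler_eq0 (negPf char2) => /eqP.
Qed.

Lemma Y3Y3 u : gact V Y3 n (gact V Y3 n u) = 0.
Proof.
have := @gact_odd0 _ V Y3 Y3 n n u isT erefl => /eqP.
by rewrite -subr_eq0 opprK -mulr2n -scaler_nat scaler_eq0 (negPf char2) => /eqP.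
Qed.

Lemma X1Y3 u : gact V X1 n (gact V Y3 n u) = - gact V Y3 n (gact V X1 n u) + gact V Y2 (n + n) u.
Proof. by rewrite (@gact_odd _ _ X1 Y3 Y2 1) // scale1r. Qed.

Let iterS0 k u : S u -> S (iter k yn u). Proof. exact: subm_iter. Qed.

Let X3cm : S (gact V X3 0 cm).
Proof. by rewrite /cm gact_odd0 //; apply: (submN hS); apply: (subm_act hS). Qed.
Let Y1cm : S (gact V Y1 0 cm).
Proof.
rewrite /cm (@gact_odd _ _ Y1 X1 H1 1) // scale1r; apply: (submD hS).
  by apply: (submN hS); apply: (subm_act hS).
by apply: km; rewrite /= add0n.
Qed.
Let Y1bm : S (gact V Y1 0 bm).
Proof. by rewrite /bm gact_odd0 //; apply: (submN hS); apply: (subm_act hS). Qed.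
Let X3b u : pos_killed S n u -> S (gact V X3 0 u) -> S (gact V X3 0 (gact V Y3 n u)).
Proof.
move=> ku hu; rewrite gact_swap /ssign /= big_cons big_seq1 /= scaleN1r.
rewrite scale1r scaleN1r; apply: (submD hS); first by apply: (submN hS); apply: (subm_act hS).
by apply: (submB hS); apply: ku; rewrite /= add0n.
Qed.

Let X3_iter k u : gact V X3 0 (iter k yn u) =
  iter k yn (gact V X3 0 u) + iter k.-1 yn (gact V X1 n u) *+ k.
Proof.
by rewrite /yn (@iterY_der _ _ X3 X1 1) // scale1r add0n iterY_act.
Qed.

Let Y1_iter k u : gact V Y1 0 (iter k yn u) =
  iter k yn (gact V Y1 0 u) - iter k.-1 yn (gact V Y3 n u) *+ k.
Proof.
by rewrite /yn (@iterY_der _ _ Y1 Y3 (-1)) // scaleN1r add0n iterY_act // mulNrn.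
Qed.

Lemma X3_step0 : S (gact V X3 0 step0 - step1 *+ x).
Proof. by rewrite /step0 X3_iter /step1 addrK; apply: iterS0. Qed.

Lemma Y1_step0 : S (gact V Y1 0 step0 + step2 *+ x).
Proof. by rewrite /step0 Y1_iter /step2 subrK; apply: iterS0. Qed.

Lemma X3_step1 : S (gact V X3 0 step1).
Proof.
rewrite /step1 X3_iter; apply: (submD hS); first by apply: iterS0.
by rewrite X1X1; apply: (submMn hS); apply: iterS0; apply: (subm0 hS).
Qed.

Lemma Y1_step1 : S (gact V Y1 0 step1 + step3 *+ x.-1).
Proof.
rewrite /step1 Y1_iter /step3; case: eqP => [->|_].
  by rewrite !mulr0n subr0 addr0; apply: iterS0.
by rewrite subrK; apply: iterS0.
Qed.

Lemma X3_step2 : S (gact V X3 0 step2 + step3 *+ x.-1).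
Proof.
rewrite /step2 X3_iter /step3; case: eqP => [->|_].
  by rewrite !mulr0n !addr0; apply: iterS0; apply: X3b.
rewrite -addrA; apply: (submD hS); first by apply: iterS0; apply: X3b.
(* The anticommutator of x_1 t^n and y_3 t^n is y_2 t^(2n), which kills [m] since 2n > n; hence the
   two multiples of the fourth generator cancel. *)
rewrite -mulrnDl; apply: (submMn hS); rewrite X1Y3.
have iterD k u w : iter k yn (u + w) = iter k yn u + iter k yn w.
  by elim: k => //= k ->; rewrite /yn gactD.
by rewrite -iterD addrAC addNr add0r; apply: iterS0; apply: km; rewrite /=; lia.
Qed.

Lemma Y1_step2 : S (gact V Y1 0 step2).
Proof.
rewrite /step2 Y1_iter; apply: (submB hS); first by apply: iterS0.
by rewrite Y3Y3; apply: (submMn hS); apply: iterS0; apply: (subm0 hS).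
Qed.

Lemma X3_step3 : S (gact V X3 0 step3).
Proof.
rewrite /step3; case: eqP => _; first by rewrite gact0; apply: (subm0 hS).
rewrite X3_iter; apply: (submD hS); first by apply: iterS0; apply: X3b.
apply: (submMn hS); apply: iterS0; rewrite X1Y3 X1X1 gact0 oppr0 add0r.
by apply: kcm; rewrite /=; lia.
Qed.

Lemma Y1_step3 : S (gact V Y1 0 step3).
Proof.
rewrite /step3; case: eqP => _; first by rewrite gact0; apply: (subm0 hS).
rewrite Y1_iter; apply: (submB hS); last first.
  by rewrite Y3Y3; apply: (submMn hS); apply: iterS0; apply: (subm0 hS).
by apply: iterS0; rewrite gact_odd0 //; apply: (submN hS); apply: (subm_act hS).
Qed.

(** The bound with k = n gives degree at most (n-1)(x+1) + x < n(x+1) for y(u)^(x+1) m, whose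
    coefficient in degree n(x+1) is y_n^(x+1) m. Applying x_3 and y_1 to this relation yields the
    next three. *)
Let iter_top : S (iter x.+1 yn m).
Proof.
have h1 := @Yp_top F V S hS n m x.+1 (fun p hp => km (a := Y2) hp).
have h2 : S (Yp m x.+1 (n * x.+1)).
  have hb : bnd S n (sumn (drop n (xs ++ [:: a; x]))) 0 m by apply: cvS_bnd hm.
  move: hb; rewrite /bnd; apply.
  rewrite drop_cat sx (_ : (n < n.-1)%N = false); last by lia.
  by rewrite (_ : n - n.-1 = 1)%N /=; lia.
by rewrite -[X in S X](subKr (Yp m x.+1 (n * x.+1))); apply: (submB hS).
Qed.

Let cm_top : S (iter x yn cm).
Proof.
have := subm_act hS X3 0 iter_top; rewrite X3_iter addrC => /(submDK hS) h.
by apply: (submMnr char0 hS (ltn0Sn x)); apply: h; apply: iterS0.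
Qed.

Let bm_top : S (iter x yn bm).
Proof.
have := subm_act hS Y1 0 iter_top; rewrite Y1_iter addrC => /(submDK hS) h.
apply: (submMnr char0 hS (ltn0Sn x)); rewrite -[X in S X]opprK; apply: (submN hS).
by apply: h; apply: iterS0.
Qed.

Let bcm_top : S (iter x.-1 yn (gact V Y3 n cm)).
Proof.
have := subm_act hS Y1 0 cm_top; rewrite Y1_iter addrC => /(submDK hS) h.
apply: (submMnr char0 hS x0); rewrite -[X in S X]opprK; apply: (submN hS).
by apply: h; apply: iterS0.
Qed.

Let bnd_m i : (i < n)%N -> bnd S i (sumn (drop i (xs ++ [:: a; x]))) 0 m.
Proof. by move=> _; apply: cvS_bnd hm. Qed.

Lemma bnd_step0 i : (i < n)%N -> bnd S i (sumn (drop i (xs ++ [:: a; x]))) (2 * x) step0.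
Proof. by move=> hi; have := bnd_Y2_iter char0 hS (j := x) n0 hi km (bnd_m hi). Qed.

Let bnd_step1 i : (i < n)%N -> bnd S i (sumn (drop i (xs ++ [:: a; x]))) (1 + 2 * x.-1) step1.
Proof.
move=> hi; apply: (bnd_Y2_iter char0 hS (j := x.-1) n0 hi kcm).
by apply: (bnd_X1 char0 hS (ltnW hi) X3m km); apply: bnd_m.
Qed.

Let bnd_step2 i : (i < n)%N -> bnd S i (sumn (drop i (xs ++ [:: a; x]))) (1 + 2 * x.-1) step2.
Proof.
move=> hi; apply: (bnd_Y2_iter char0 hS (j := x.-1) n0 hi kbm).
by apply: (bnd_Y3 char0 hS (ltnW hi) Y1m km); apply: bnd_m.
Qed.

Let bnd_step3 i : (i < n)%N -> (1 < x)%N ->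
  bnd S i (sumn (drop i (xs ++ [:: a; x]))) (2 + 2 * x.-2) step3.
Proof.
move=> hi x1; rewrite /step3 (_ : (x == 1%N) = false); last by lia.
apply: (bnd_Y2_iter char0 hS (j := x.-2) n0 hi kbcm).
apply: (bnd_Y3 char0 hS (ltnW hi) Y1cm kcm).
by apply: (bnd_X1 char0 hS (ltnW hi) X3m km); apply: bnd_m.
Qed.

Let eH1 : eigen H1 l1 m. Proof. by case: hm => [[_ h _] _]; apply: (h 0%N). Qed.
Let eH2 : eigen H2 (sumn xs + (a + x))%:R m.
Proof. by case: hm => [[_ _ h] _]; have := h 0%N; rewrite sumn_cat /= addn0. Qed.

Lemma step0_tail b : tail_op b -> S (gact V b n step0).
Proof.
case: b => // _; rewrite /step0.
- by rewrite iterY_act.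
- by rewrite iterY_act.
Qed.

Lemma pos_killed_step0 : pos_killed S n step0.
Proof. exact: pos_killed_iter. Qed.

Lemma eigen_H1_step0 : eigen H1 (l1 - x%:R) step0.
Proof.
apply: (eigen_iter (c := l1)) => //; congr (_ + _).
by rewrite /lie_coef /= addr0 mulN1r rmorphN.
Qed.

Lemma eigen_H2_step0 : eigen H2 (sumn xs + (a - x))%:R step0.
Proof.
apply: (eigen_iter (c := (sumn xs + (a + x))%:R)) => //.
rewrite /lie_coef /= addr0.
rewrite (_ : sumn xs + (a + x) = sumn xs + (a - x) + x + x)%N; last by lia.
by rewrite !natrD mulNr rmorphN rmorphM /=; ring.
Qed.

Section Pieces.
Variable T : V -> Prop.
Hypotheses (hT : is_submodule T) (hST : forall u, S u -> T u).

Let lift_cvS c1 (xi : seq nat) k : hwS c1 (sumn xi) T k ->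
  (forall r s, (Gmin xi r < r + s)%N -> S (Yp k r s)) -> cvS c1 xi T k.
Proof. by move=> h1 h2; split=> // r s hrs; apply: hST; apply: h2. Qed.

Let TB u w : S (u - w) -> T w -> T u.
Proof. by move=> /hST h hw; rewrite -[u](subrK w); apply: (submD hT). Qed.
Let TD u w : S (u + w) -> T w -> T u.
Proof. by move=> /hST h hw; apply: (submDK hT h). Qed.

(** The order of the layers is dictated by x_3 and y_1, which send each generator to multiples of
    later ones. The new part is a + x minus the sharpening: 2x here, 1 + 2(x-1) for the second and
    third generators, 2 + 2(x-2) for the fourth. *)
Lemma cvS_step0 : T step1 -> T step2 -> cvS (l1 - x%:R) (rcons xs (a - x)%N) T step0.
Proof.
move=> h1 h2; apply: lift_cvS.
  apply: (@hwS_pos T n) => //; [exact: pos_killed_step0 | | | exact: eigen_H1_step0 | ].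
  - by apply: (TB X3_step0); apply: (submMn hT).
  - by apply: (TD Y1_step0); apply: (submMn hT).
  - by rewrite sumn_rcons; apply: eigen_H2_step0.
apply: (cvS_piece hS n0 sx (x := x) (a' := a) (e := (2 * x)%N)) => //.
- by apply: sorted_rcons_low; lia.
- lia.
- exact: pos_killed_iter.
- exact: bnd_step0.
Qed.

Let wt_odd :
  (sumn xs + (a - x).+1)%:R = (sumn xs + (a + x))%:R + (-1)%:~R + (-2 * x.-1%:Z)%:~R :> F.
Proof.
rewrite (_ : sumn xs + (a + x) = sumn xs + (a - x).+1 + 1 + x.-1 + x.-1)%N; last by lia.
by rewrite !natrD mulNr !rmorphN rmorphM /=; ring.
Qed.

Lemma cvS_step1 : T step3 -> cvS (l1 - x.-1%:R) (rcons xs (a - x)%N.+1) T step1.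
Proof.
move=> h3; apply: lift_cvS.
  apply: (@hwS_pos T n) => //.
  - exact: pos_killed_iter.
  - by apply: hST; apply: X3_step1.
  - by apply: (TD Y1_step1); apply: (submMn hT).
  - apply: (eigen_iter (c := l1)) => //; first by rewrite /lie_coef /= addr0 mulN1r rmorphN.
    by apply: (eigen_act (c := l1)) => //; rewrite /lie_coef /= addr0.
  apply: (eigen_iter (c := (sumn xs + (a + x))%:R - 1)) => //; last first.
    by apply: (eigen_act (c := (sumn xs + (a + x))%:R)) => //; rewrite /lie_coef /= addr0 rmorphN1.
  rewrite sumn_rcons /lie_coef /= addr0 wt_odd rmorphN1 //.
apply: (cvS_piece hS n0 sx (x := x) (a' := a) (e := (1 + 2 * x.-1)%N)) => //.
- by apply: sorted_rcons_low; lia.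
- lia.
- exact: pos_killed_iter.
- by rewrite /step1 -iterS prednK.
Qed.

Lemma cvS_step2 : T step3 -> cvS (l1 - x%:R) (rcons xs (a - x)%N.+1) T step2.
Proof.
move=> h3; apply: lift_cvS.
  apply: (@hwS_pos T n) => //.
  - exact: pos_killed_iter.
  - by apply: (TD X3_step2); apply: (submMn hT).
  - by apply: hST; apply: Y1_step2.
  - apply: (eigen_iter (c := l1 - 1)) => //.
      rewrite -[X in X%:R](prednK x0) /lie_coef /= addr0 mulN1r rmorphN /=.
      by rewrite -addn1 natrD; ring.
    by apply: (eigen_act (c := l1)) => //; rewrite /lie_coef /= addr0 rmorphN1.
  apply: (eigen_iter (c := (sumn xs + (a + x))%:R - 1)) => //; last first.
    by apply: (eigen_act (c := (sumn xs + (a + x))%:R)) => //; rewrite /lie_coef /= addr0 rmorphN1.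
  rewrite sumn_rcons /lie_coef /= addr0 wt_odd rmorphN1 //.
apply: (cvS_piece hS n0 sx (x := x) (a' := a) (e := (1 + 2 * x.-1)%N)) => //.
- by apply: sorted_rcons_low; lia.
- lia.
- exact: pos_killed_iter.
- by rewrite /step2 -iterS prednK.
Qed.

(* The top coefficients of [y(u)^r m] are multiples of [step0]; [min(r, -)] summed over
   [a.+1, x.-1] differs from that over [a, x] exactly when [x <= r <= a]. *)
Lemma cvS_plus xi : T step0 -> perm_eq xi (xs ++ [:: a.+1; x.-1]) -> cvS l1 xi T m.
Proof.
move=> h0 hp; case: hm => [[h1 h2 h3] h4].
split.
  rewrite (perm_sumn hp).
  have -> : sumn (xs ++ [:: a.+1; x.-1]) = sumn (xs ++ [:: a; x]) by rewrite !sumn_cat /=; lia.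
  by split=> r; [case: (h1 r) => *; split; apply: hST | apply: hST | apply: hST].
move=> r s; rewrite (Gmin_perm _ hp) Gmin_cat 2!Gmin_cons Gmin_nil => hG.
have [hG'|hG'] := ltnP (Gmin (xs ++ [:: a; x]) r) (r + s).
  by apply: hST; apply: h4.
have hxr : (x <= r)%N /\ (r <= a)%N.
  by move: hG'; rewrite Gmin_cat 2!Gmin_cons Gmin_nil; lia.
have eG : Gmin xs r = (r * n.-1)%N.
  rewrite -sx /Gmin (eq_big_seq (fun _ => r)); last first.
    move=> z hz; apply/minn_idPl; apply: leq_trans hxr.2 _.
    move: hsort; rewrite sorted_pairwise; last by move=> ? ? ? /[swap]; apply: leq_trans.
    by rewrite pairwise_cat => /and3P[/allrelP /(_ z a hz)]; rewrite inE eqxx => /(_ isT).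
  by rewrite big_const_seq count_predT iter_addn_0.
have := @Yp_low F V T hT n x m n0 (fun p hp => hST (km (a := Y2) hp)) h0 r 0 s; apply.
move: hG; rewrite eG mulnC; lia.
Qed.

End Pieces.

Lemma cvS_step3 : (1 < x)%N -> cvS (l1 - x.-1%:R) (rcons xs (a - x)%N.+2) S step3.
Proof.
move=> x1; have ex : (x == 1%N) = false by lia.
split.
  apply: (@hwS_pos S n) => //.
  - by rewrite /step3 ex; apply: pos_killed_iter.
  - exact: X3_step3.
  - exact: Y1_step3.
  - rewrite /step3 ex; apply: (eigen_iter (c := l1 - 1)) => //.
      rewrite -[X in X.-1](prednK x0) -[X in X%:R](prednK _ : _ = x.-1); last by lia.
      rewrite /= -addn1 natrD /lie_coef /= addr0 mulN1r rmorphN /=; ring.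
    apply: (eigen_act (c := l1)) => //.
    by apply: (eigen_act (c := l1)) => //; rewrite /lie_coef /= addr0.
  rewrite /step3 ex; apply: (eigen_iter (c := (sumn xs + (a + x))%:R - 1 - 1)) => //; last first.
    apply: (eigen_act (c := (sumn xs + (a + x))%:R - 1)) => //.
    by apply: (eigen_act (c := (sumn xs + (a + x))%:R)) => //; rewrite /lie_coef /= addr0 rmorphN1.
  rewrite sumn_rcons /lie_coef /= addr0.
  rewrite (_ : sumn xs + (a + x) = sumn xs + (a - x).+2 + 2 + x.-2 + x.-2)%N; last by lia.
  by rewrite !natrD mulNr !rmorphN rmorphM /=; ring.
apply: (cvS_piece hS n0 sx (x := x) (a' := a) (e := (2 + 2 * x.-2)%N)) => //.
- by apply: sorted_rcons_low; lia.
- lia.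
- by rewrite /step3 ex; apply: pos_killed_iter.
- by rewrite /step3 ex -iterS (_ : x.-2.+1 = x.-1)%N //; lia.
- by move=> i hi; apply: bnd_step3.
Qed.

(** The relation that removes the surplus sublayer when a = x. The bound with k = n - 1 gives y_2
    t^(n-1) step0 = 0; applying x_3 gives x y_2 t^(n-1) step1 + x_1 t^(n-1) step0 = 0, and y_1 turns
    this into the claim modulo step2 and step3. The term h_1 t^(n-1) vanishes because n > 1. *)
Lemma Y3_pred_step1 T : is_submodule T -> (forall u, S u -> T u) -> a = x -> (1 < n)%N ->
  T step2 -> T step3 -> T (gact V Y3 n.-1 step1).
Proof.
move=> hT hST eax n1 h2 h3.
have hy : S (gact V Y2 n.-1 step0).
  have hb : bnd S n.-1 (sumn (drop n.-1 (xs ++ [:: a; x]))) (2 * x) step0 by apply: bnd_step0; lia.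
  rewrite -Yp1; move: hb; rewrite /bnd; apply.
  by rewrite drop_size_cat // eax /=; lia.
have e1 : T (gact V Y2 n.-1 step1 *+ x + gact V X1 n.-1 step0).
  have := subm_act hS X3 0 hy; rewrite (@gact_even _ _ X3 Y2 X1 1) // scale1r add0n => h.
  have := submB hS h (subm_act hS Y2 n.-1 X3_step0).
  by rewrite gactB gactMn opprB addrC addrA subrK => /hST.
have k0 : pos_killed S n step0 by apply: pos_killed_iter.
have e2 : T (gact V Y1 0 (gact V X1 n.-1 step0)).
  rewrite (@gact_odd _ _ Y1 X1 H1 1) // scale1r add0n; apply: (submD hT); last first.
    by apply: hST; apply: k0; rewrite /=; lia.
  apply: (submN hT); apply: (subm_act hT); apply: (submDK hT (hST _ Y1_step0)).
  exact: (submMn hT).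
have e3 : T (gact V Y1 0 (gact V Y2 n.-1 step1)).
  have := subm_act hT Y1 0 e1; rewrite gactD gactMn => /(submDK hT) /(_ e2).
  exact: submMnr.
move: e3; rewrite (@gact_even _ _ Y1 Y2 Y3 (-1)) // scaleN1r add0n addrC => /(submDK hT) h.
rewrite -[X in T X]opprK; apply: (submN hT); apply: h; apply: (subm_act hT).
by apply: (submDK hT (hST _ Y1_step1)); apply: (submMn hT).
Qed.

End Step.

(** * Dimension modulo a subspace *)

Section ModDim.
Variables (F : fieldType) (V : lmodType F).
Implicit Types (A B C : V -> Prop) (L : seq V) (u w : V) (c : nat -> F).

Definition subsp B := B 0 /\ forall (k : F) u w, B u -> B w -> B (k *: u + w).

Lemma subspD B u w : subsp B -> B u -> B w -> B (u + w).
Proof. by move=> [_ h] hu hw; rewrite -[u]scale1r; apply: h. Qed.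
Lemma subspZ B k u : subsp B -> B u -> B (k *: u).
Proof. by move=> [h0 h] hu; rewrite -[_ *: _]addr0; apply: h. Qed.
Lemma subspN B u : subsp B -> B u -> B (- u).
Proof. by move=> hB hu; rewrite -scaleN1r; apply: subspZ. Qed.
Lemma subspB B u w : subsp B -> B u -> B w -> B (u - w).
Proof. by move=> hB hu hw; apply: subspD => //; apply: subspN. Qed.
Lemma subsp_sum B I (l : seq I) (P : pred I) (f : I -> V) : subsp B ->
  (forall i, P i -> B (f i)) -> B (\sum_(i <- l | P i) f i).
Proof. by move=> hB h; apply: big_ind => //; [case: hB | move=> u w; apply: subspD]. Qed.
Lemma subsp_subl B u w : subsp B -> B (u - w) -> B w -> B u.
Proof. by move=> hB h hw; rewrite -[u](subrK w); apply: subspD. Qed.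
Lemma subsp_subr B u w : subsp B -> B (u - w) -> B u -> B w.
Proof. by move=> hB h hw; rewrite -[w](subKr u); apply: subspB. Qed.

Definition lcomb c L : V := \sum_(0 <= i < size L) c i *: L`_i.

Lemma lcombD c d L : lcomb (fun i => c i + d i) L = lcomb c L + lcomb d L.
Proof. by rewrite /lcomb -big_split; apply: eq_bigr => i _; rewrite scalerDl. Qed.

Lemma lcombZ k c L : lcomb (fun i => k * c i) L = k *: lcomb c L.
Proof. by rewrite /lcomb scaler_sumr; apply: eq_bigr => i _; rewrite scalerA. Qed.

Lemma lcomb_cat c L1 L2 :
  lcomb c (L1 ++ L2) = lcomb c L1 + lcomb (fun i => c (size L1 + i)%N) L2.
Proof.
rewrite /lcomb size_cat (@big_cat_nat _ _ _ (size L1)) ?leq_addr //=; congr (_ + _).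
  by rewrite !big_nat; apply: eq_bigr => i /andP[_ hi]; rewrite nth_cat hi.
rewrite -{1}[size L1]add0n big_addn addKn; apply: eq_bigr => i _.
by rewrite nth_cat ltnNge leq_addl /= addnK addnC.
Qed.

Lemma lcomb_ord c L N : size L = N -> lcomb c L = \sum_(i < N) c i *: L`_i.
Proof. by move=> <-; rewrite /lcomb big_mkord. Qed.

Lemma subsp_lcomb B c L : subsp B -> (forall w, w \in L -> B w) -> B (lcomb c L).
Proof.
move=> hB hL; rewrite /lcomb big_nat; apply: subsp_sum => // i /andP[_ hi].
by apply: subspZ => //; apply: hL; apply: mem_nth.
Qed.

Definition spanP B L u := exists c, B (u - lcomb c L).

Lemma spanP_subsp B L : subsp B -> subsp (spanP B L).
Proof.
move=> hB; split.
  exists (fun=> 0); rewrite sub0r /lcomb big1 ?oppr0; first by case: hB.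
  by move=> i _; rewrite scale0r.
move=> k u w [c hc] [d hd]; exists (fun i => k * c i + d i).
rewrite lcombD lcombZ opprD addrACA -scalerBr.
by apply: subspD => //; apply: subspZ.
Qed.

Lemma spanP_incl B L u : subsp B -> B u -> spanP B L u.
Proof.
by move=> hB hu; exists (fun=> 0); rewrite /lcomb big1 ?subr0 // => i _; rewrite scale0r.
Qed.

Lemma spanP_mem B L u : subsp B -> u \in L -> spanP B L u.
Proof.
move=> hB hu; exists (fun i => (i == index u L)%:R).
rewrite (lcomb_ord _ (erefl _)); move: (hu); rewrite -index_mem => hi.
rewrite (bigD1 (Ordinal hi)) //= eqxx scale1r nth_index // big1; last first.
  by move=> j; rewrite -val_eqE /= => /negPf ->; rewrite scale0r.
by rewrite addr0 subrr; case: hB.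
Qed.

Lemma spanP_min B T L u : subsp T -> (forall v, B v -> T v) -> (forall w, w \in L -> T w) ->
  spanP B L u -> T u.
Proof. by move=> hT hBT hL [c /hBT h]; apply: (subsp_subl hT h); apply: subsp_lcomb. Qed.

Definition free_mod B L := forall c, B (lcomb c L) -> forall i, (i < size L)%N -> c i = 0.

(** The dimension of A/B is bounded above by a spanning list and below, in [indep_ge], by a free
    one, as [V] carries no finite-dimensional structure beforehand. *)
Definition dim_le A B (N : nat) := exists L,
  [/\ size L = N, forall w, w \in L -> A w & forall u, A u -> spanP B L u].

Definition indep_ge A B (N : nat) := exists L,
  [/\ size L = N, forall w, w \in L -> A w & free_mod B L].

(** Expressing N independent vectors through the N vectors of [L] gives a square matrix with trivial
    left kernel, hence invertible; so a relation among the vectors of [L] would be one among the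
    independent ones. *)
Lemma span_free A B L N : subsp B -> size L = N -> (forall u, A u -> spanP B L u) ->
  indep_ge A B N -> free_mod B L.
Proof.
move=> hB sL hL [M [sM hM fM]].
have /fin_all_exists [X hX] (i : 'I_N) : exists x : nat -> F, B (M`_i - lcomb x L).
  by apply: hL; apply: hM; apply: mem_nth; rewrite sM.
pose Y := \matrix_(i < N, j < N) X i j.
have key (v : 'rV_N) : B (\sum_(i < N) v 0 i *: M`_i - \sum_(j < N) (v *m Y) 0 j *: L`_j).
  have -> : \sum_(j < N) (v *m Y) 0 j *: L`_j = \sum_(i < N) v 0 i *: lcomb (X i) L.
    rewrite (eq_bigr (fun j : 'I_N => \sum_(i < N) v 0 i *: (X i j *: L`_j))).
      rewrite exchange_big; apply: eq_bigr => i _.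
      by rewrite -scaler_sumr (lcomb_ord _ sL).
    move=> j _; rewrite mxE scaler_suml; apply: eq_bigr => i _.
    by rewrite mxE scalerA.
  rewrite -sumrB; apply: subsp_sum => // i _; rewrite -scalerBr.
  exact: subspZ.
have fM' (v : 'rV_N) : B (\sum_(i < N) v 0 i *: M`_i) -> v = 0.
  move=> h; apply/rowP => i; rewrite mxE.
  pose c k := oapp (v 0) 0 (insub k : option 'I_N).
  have E (k : 'I_N) : c k = v 0 k by rewrite /c valK.
  rewrite -E; apply: fM; last by rewrite sM.
  by rewrite (lcomb_ord _ sM); under eq_bigr => k _ do rewrite E.
have uY : Y \in unitmx.
  rewrite -row_free_unit -kermx_eq0; apply/eqP/row_matrixP => i; rewrite row0.
  apply: fM'; apply: (subsp_subl hB (key _)).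
  have -> : row i (kermx Y) *m Y = 0 by rewrite -row_mul mulmx_ker row0.
  by rewrite big1; [case: hB | move=> j _; rewrite mxE scale0r].
move=> c hc i; rewrite sL => hi.
pose v : 'rV_N := (\row_(j < N) c j) *m invmx Y.
have hv : v *m Y = \row_(j < N) c j by rewrite mulmxKV.
have v0 : v = 0.
  apply: fM'; apply: (subsp_subl hB (key _)); rewrite hv.
  by under eq_bigr => j _ do rewrite mxE; rewrite -(lcomb_ord _ sL).
by have := congr1 (fun z : 'rV_N => z 0 (Ordinal hi)) hv; rewrite v0 mul0mx !mxE.
Qed.

Lemma dim_le_weak A A' B N : (forall u, A' u -> A u) -> (forall u, A u -> A' u) ->
  dim_le A B N -> dim_le A' B N.
Proof.
by move=> h h' [L [sL hL sp]]; exists L; split=> // [w /hL /h'|u /h /sp].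
Qed.

Lemma dim_le_trans A B C N1 N2 : subsp B -> subsp C -> (forall u, B u -> A u) ->
  dim_le A B N1 -> dim_le B C N2 -> dim_le A C (N1 + N2).
Proof.
move=> hB hC hBA [L1 [s1 m1 h1]] [L2 [s2 m2 h2]]; exists (L1 ++ L2); split.
- by rewrite size_cat s1 s2.
- by move=> w; rewrite mem_cat => /orP[/m1 //|/m2 /hBA].
move=> u /h1 hu; have hT := spanP_subsp (L1 ++ L2) hC.
apply: (spanP_min hT) hu.
  move=> v /h2; apply: (spanP_min hT); first by move=> ? ?; apply: spanP_incl.
  by move=> w hw; apply: spanP_mem => //; rewrite mem_cat hw orbT.
by move=> w hw; apply: spanP_mem => //; rewrite mem_cat hw.
Qed.

(** Upper bounds on two layers whose sum is attained are both attained: the concatenated spanning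
    lists are free by [span_free], and so is each half modulo its own subspace. *)
Lemma indep_split A B C N1 N2 : subsp B -> subsp C -> (forall u, B u -> A u) ->
  dim_le A B N1 -> dim_le B C N2 -> indep_ge A C (N1 + N2) ->
  indep_ge A B N1 /\ indep_ge B C N2.
Proof.
move=> hB hC hBA [L1 [s1 m1 h1]] [L2 [s2 m2 h2]] hind.
have hsp u : A u -> spanP C (L1 ++ L2) u.
  move=> /h1 hu; have hT := spanP_subsp (L1 ++ L2) hC.
  apply: (spanP_min hT) hu.
    move=> v /h2; apply: (spanP_min hT); first by move=> ? ?; apply: spanP_incl.
    by move=> w hw; apply: spanP_mem => //; rewrite mem_cat hw orbT.
  by move=> w hw; apply: spanP_mem => //; rewrite mem_cat hw.
have sL : size (L1 ++ L2) = (N1 + N2)%N by rewrite size_cat s1 s2.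
have fr := span_free hC sL hsp hind.
split.
  exists L1; split=> // c /h2 [d hd] i hi.
  (* The combination [c] of [L1] lies in B, hence equals a combination [d] of [L2] modulo C; the
     difference is a relation among the whole list. *)
  pose e k := if (k < size L1)%N then c k else - d (k - size L1)%N.
  have -> : c i = e i by rewrite /e hi.
  apply: fr; last by rewrite size_cat ltn_addr.
  rewrite lcomb_cat.
  have -> : lcomb e L1 = lcomb c L1.
    by rewrite /lcomb !big_nat; apply: eq_bigr => k /andP[_ hk]; rewrite /e hk.
  have -> // : lcomb (fun k => e (size L1 + k)%N) L2 = - lcomb d L2.
  rewrite -scaleN1r -lcombZ /lcomb; apply: eq_bigr => k _.
  by rewrite /e ltnNge leq_addr /= addKn mulN1r.
exists L2; split=> // c hc i hi.
pose e k := if (k < size L1)%N then 0 else c (k - size L1)%N.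
have -> : c i = e (size L1 + i)%N by rewrite /e ltnNge leq_addr /= addKn.
apply: fr; last by rewrite size_cat ltn_add2l.
rewrite lcomb_cat.
have -> : lcomb e L1 = 0.
  by rewrite /lcomb big_nat big1 // => k /andP[_ hk]; rewrite /e hk scale0r.
have -> : lcomb (fun k => e (size L1 + k)%N) L2 = lcomb c L2; last by rewrite add0r.
by rewrite /lcomb; apply: eq_bigr => k _; rewrite /e ltnNge leq_addr /= addKn.
Qed.

(* Padding with zero vectors. *)

Lemma indep_ge_weak A A' B N : (forall u, A u -> A' u) -> indep_ge A B N -> indep_ge A' B N.
Proof. by move=> h [L [sL mL fL]]; exists L; split=> // w /mL /h. Qed.

End ModDim.

(** * The upper bound *)

(** A zero part counts as a factor 1, since it changes neither the weight nor [Gmin]. *)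
Definition Ddim (xi : seq nat) : nat := (\prod_(x <- xi | 0 < x) (4 * x))%N.

Lemma Ddim_perm xi xi' : perm_eq xi xi' -> Ddim xi = Ddim xi'.
Proof. by move=> h; rewrite /Ddim (perm_big _ h). Qed.

Lemma Ddim_cons x xi : Ddim (x :: xi) = ((if 0 < x then 4 * x else 1) * Ddim xi)%N.
Proof. by rewrite /Ddim big_cons; case: ifP; rewrite ?mul1n. Qed.

Lemma Ddim_nil : Ddim [::] = 1%N. Proof. by rewrite /Ddim big_nil. Qed.

Lemma Ddim_rcons xi x : Ddim (rcons xi x) = (Ddim xi * (if 0 < x then 4 * x else 1))%N.
Proof. by rewrite (Ddim_perm (xi' := x :: xi)) ?perm_rcons // Ddim_cons mulnC. Qed.

Lemma Ddim_cat xi xi' : Ddim (xi ++ xi') = (Ddim xi * Ddim xi')%N.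
Proof. by rewrite /Ddim big_cat. Qed.

(** * One part, and two equal parts *)

Section BaseCases.
Variables (F : fieldType) (char0 : forall k, k.+1%:R != 0 :> F) (V : gmod F).
Variables (S : V -> Prop) (hS : is_submodule S).
Implicit Types (u w m : V) (T : V -> Prop) (L : seq V) (a b : gb) (r s p : nat).

Lemma subm_subsp T : is_submodule T -> subsp T. Proof. by case. Qed.

Definition level_pos m := forall a r, (0 < r)%N -> S (gact V a r m).

Lemma level_pos_gen m : level_pos m -> forall u, genS S m u -> level_pos u.
Proof.
move=> hm u; apply: genS_min => //; last by move=> v hv a r _; apply: (subm_act hS).
split=> [a r _|c v w hv hw a r hr|b s v hv a r hr].
- by rewrite gact0; apply: (subm0 hS).
- by rewrite gact_lin; apply: (submZD hS); [apply: hv | apply: hw].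
rewrite gact_swap; apply: (submD hS); first by apply: (submZ hS); apply: (subm_act hS); apply: hv.
by apply: (subm_sum hS) => p _; apply: (submZ hS); apply: hv; rewrite addn_gt0 hr.
Qed.

(* The four odd root vectors generate the Lie superalgebra. *)
Lemma genS_level0 m T : level_pos m -> subsp T -> (forall u, S u -> T u) -> T m ->
  (forall b u, godd b -> T u -> T (gact V b 0 u)) -> forall u, genS S m u -> T u.
Proof.
move=> hm hT hST Tm hb u hu.
suff [] : genS S m u /\ T u by [].
move: u hu; apply: genS_min; [|by move=> v hv; split; [apply: genS_incl | apply: hST]|by split].
split=> [|c v w [g1 t1] [g2 t2]|a r v [g t]].
- by split; [apply: (subm0 (genS_sub _ _)) | case: hT].
- by split; [apply: (submZD (genS_sub _ _)) | case: hT => _; apply].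
split; first exact: (subm_act (genS_sub _ _)).
case: r => [|r]; last by apply: hST; apply: (level_pos_gen hm).
have E (x y z : V) : y = - x + z -> z = x + y by move=> ->; rewrite addrA subrr add0r.
have hb2 b c w : godd b -> godd c -> T w -> T (gact V b 0 (gact V c 0 w)).
  by move=> h1 h2 tw; apply: (hb) => //; apply: (hb).
have hH1 w : T w -> T (gact V H1 0 w).
  move=> tw; have := @gact_odd _ V X1 Y1 H1 1 0 0 w isT erefl.
  by rewrite scale1r => /E ->; apply: subspD => //; exact: hb2.
case: a => //=; do ?[exact: (hb)]; last 1 first.
- have e := gact_swap X3 Y3 0 0 v.
  rewrite /ssign /= big_cons big_seq1 /= scaleN1r scale1r scaleN1r in e.
  have -> : gact V H2 0 v = gact V H1 0 v -
      (gact V X3 0 (gact V Y3 0 v) + gact V Y3 0 (gact V X3 0 v)).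
    by rewrite e addrAC addNr add0r subKr.
  by apply: subspB => //; [exact: hH1 | apply: subspD => //; exact: hb2].
- have := @gact_odd _ V X3 Y1 X2 1 0 0 v isT erefl.
  by rewrite scale1r => /E ->; apply: subspD => //; exact: hb2.
- have := @gact_odd _ V X1 Y3 Y2 1 0 0 v isT erefl.
  by rewrite scale1r => /E ->; apply: subspD => //; exact: hb2.
- exact: hH1.
Qed.

Lemma gact_subsp T a r : subsp T -> subsp (fun u => T (gact V a r u)).
Proof. by move=> [h0 h]; split=> [|k u w hu hw]; rewrite ?gact0 // gact_lin; apply: h. Qed.

Lemma spanP_act T L a r : subsp T -> (forall u, S u -> T u) ->
  (forall w, w \in L -> T (gact V a r w)) -> forall u, spanP S L u -> T (gact V a r u).
Proof.
move=> hT hST hL u; apply: (spanP_min (T := fun u => T (gact V a r u))) => //.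
  exact: gact_subsp.
by move=> v hv; apply: hST; apply: (subm_act hS).
Qed.

Section OnePart.
Variables (l1 : F) (a : nat) (m : V).
Hypotheses (a0 : (0 < a)%N) (hm : cvS l1 [:: a] S m).

Let y := gact V Y2 0.
Let cm := gact V X1 0 m.
Let bm := gact V Y3 0 m.
Let bcm := gact V Y3 0 cm.

(** Four strings for y_2 of lengths a + 1, a, a, a - 1, in all 4a vectors. The span modulo [S] is
    shown to be stable under the odd root vectors of degree 0. *)
Let L := mkseq (fun j => iter j y m) a.+1 ++ mkseq (fun j => iter j y cm) a ++
         mkseq (fun j => iter j y bm) a ++ mkseq (fun j => iter j y bcm) a.-1.
Let T := spanP S L.

Let hS' : subsp S := subm_subsp hS.
Let hT : subsp T. Proof. exact: spanP_subsp. Qed.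
Let hST u : S u -> T u. Proof. exact: spanP_incl. Qed.

Let km : pos_killed S 0 m.
Proof. exact: (pos_killed_cvS hS (xi := [:: a]) _ hm). Qed.

Let lm : level_pos m.
Proof. by case=> r hr; apply: km. Qed.

Let X3m : S (gact V X3 0 m). Proof. by case: hm => [[h _ _] _]; case: (h 0%N). Qed.
Let Y1m : S (gact V Y1 0 m). Proof. by case: hm => [[h _ _] _]; case: (h 0%N). Qed.
Let eH1 : eigen S H1 l1 m. Proof. by case: hm => [[_ h _] _]; apply: (h 0%N). Qed.
Let eH2 : eigen S H2 (sumn [:: a])%:R m.
Proof. by case: hm => [[_ _ h] _]; apply: (h 0%N). Qed.

Let top_m : S (iter a.+1 y m).
Proof.
case: hm => _ /(_ a.+1 0%N); rewrite Yp_at0; apply.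
by rewrite Gmin_cons Gmin_nil; lia.
Qed.

Let X3_iter k u : gact V X3 0 (iter k y u) =
  iter k y (gact V X3 0 u) + iter k.-1 y (gact V X1 0 u) *+ k.
Proof. by rewrite /y (@iterY_der _ _ X3 X1 1) // scale1r add0n iterY_act. Qed.

Let Y1_iter k u : gact V Y1 0 (iter k y u) =
  iter k y (gact V Y1 0 u) - iter k.-1 y (gact V Y3 0 u) *+ k.
Proof.
by rewrite /y (@iterY_der _ _ Y1 Y3 (-1)) // scaleN1r add0n iterY_act // mulNrn.
Qed.

Let iterS0 k u : S u -> S (iter k y u). Proof. exact: subm_iter. Qed.

Let top_cm : S (iter a y cm).
Proof.
have := subm_act hS X3 0 top_m; rewrite X3_iter addrC => /(submDK hS) h.
by apply: (submMnr char0 hS (ltn0Sn a)); apply: h; apply: iterS0.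
Qed.

Let top_bm : S (iter a y bm).
Proof.
have := subm_act hS Y1 0 top_m; rewrite Y1_iter addrC => /(submDK hS) h.
apply: (submMnr char0 hS (ltn0Sn a)); rewrite -[X in S X]opprK; apply: (submN hS).
by apply: h; apply: iterS0.
Qed.

Let Y1cm : S (gact V Y1 0 cm - l1 *: m).
Proof.
rewrite /cm (@gact_odd _ _ Y1 X1 H1 1) // scale1r -addrA; apply: (submD hS) => //.
by apply: (submN hS); apply: (subm_act hS).
Qed.

Let L_m j : (j <= a)%N -> T (iter j y m).
Proof.
move=> hj; apply: spanP_mem => //; rewrite mem_cat; apply/orP; left.
by apply/mapP; exists j => //; rewrite mem_iota.
Qed.

Let L_cm j : (j < a)%N -> T (iter j y cm).
Proof.
move=> hj; apply: spanP_mem => //; rewrite !mem_cat; apply/orP; right; apply/orP; left.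
by apply/mapP; exists j => //; rewrite mem_iota.
Qed.

Let L_bm j : (j < a)%N -> T (iter j y bm).
Proof.
move=> hj; apply: spanP_mem => //; rewrite !mem_cat; apply/orP; right; apply/orP; right.
by apply/orP; left; apply/mapP; exists j => //; rewrite mem_iota.
Qed.

Let L_bcm j : (j < a.-1)%N -> T (iter j y bcm).
Proof.
move=> hj; apply: spanP_mem => //; rewrite !mem_cat; apply/orP; right; apply/orP; right.
by apply/orP; right; apply/mapP; exists j => //; rewrite mem_iota.
Qed.

(* Applying [y_1] to [y_2^a x_1 m = 0] expresses [y_2^(a-1) y_3 x_1 m] through [y_2^a m]. *)
Let top_bcm : T (iter a.-1 y bcm).
Proof.
have h1 : S (iter a y (gact V Y1 0 cm - l1 *: m)) by apply: iterS0.
have := subm_act hS Y1 0 top_cm; rewrite Y1_iter => h2.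
have iterB k u w : iter k y (u - w) = iter k y u - iter k y w.
  by elim: k => //= k ->; rewrite /y gactB.
have iterZ k (c : F) u : iter k y (c *: u) = c *: iter k y u.
  by elim: k => //= k ->; rewrite /y gactZ.
rewrite iterB iterZ in h1.
have h3 := hST (submB hS h1 h2).
have h4 : T (l1 *: iter a y m) by apply: subspZ => //; apply: L_m.
have := subspD hT h3 h4.
rewrite opprB addrAC subrK addrC subrK.
by rewrite -scaler_nat => /(subspZ a%:R^-1 hT); rewrite scalerA mulVf ?scale1r // char0_neq0.
Qed.

Let Ty u : T u -> T (y u).
Proof.
apply: spanP_act => // w; rewrite !mem_cat => /or4P[] /mapP[j]; rewrite mem_iota add0n => /andP[_ hj] ->;
  rewrite /= -/y -iterS.
- have [hj'|hj'] := ltnP j a; first exact: L_m.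
  by apply: hST; rewrite (_ : j = a) //; lia.
- have [hj'|hj'] := ltnP j.+1 a; first exact: L_cm.
  by apply: hST; rewrite (_ : j.+1 = a) //; lia.
- have [hj'|hj'] := ltnP j.+1 a; first exact: L_bm.
  by apply: hST; rewrite (_ : j.+1 = a) //; lia.
- have [hj'|hj'] := ltnP j.+1 a.-1; first exact: L_bcm.
  by rewrite (_ : j.+1 = a.-1) //; lia.
Qed.

Let Ty_iter j u : T u -> T (iter j y u).
Proof. by move=> hu; elim: j => //= j; apply: Ty. Qed.

Let Tm : T m. Proof. exact: (L_m (leq0n a)). Qed.
Let Tcm : T cm. Proof. exact: (L_cm a0). Qed.
Let Tbm : T bm. Proof. exact: (L_bm a0). Qed.
Let Tbcm : T bcm.
Proof.
have [h|h] := ltnP 0 a.-1; first exact: (L_bcm h).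
by have := top_bcm; rewrite (_ : a.-1 = 0%N) //; lia.
Qed.

Let base_word w : w \in L -> exists j, exists2 v, v \in [:: m; cm; bm; bcm] & w = iter j y v.
Proof.
rewrite !mem_cat => /or4P[] /mapP[j _ ->]; exists j;
  [exists m | exists cm | exists bm | exists bcm]; rewrite ?inE ?eqxx ?orbT //.
Qed.

Let TX1 u : T u -> T (gact V X1 0 u).
Proof.
apply: spanP_act => // w /base_word [j [v hv ->]]; rewrite iterY_act //; apply: Ty_iter.
move: hv; rewrite !inE => /or4P[] /eqP -> //.
- by rewrite X1X1 //; case: hT.
- rewrite X1Y3; apply: subspD => //; first exact: subspN.
  exact: Ty.
- rewrite X1Y3 X1X1 // gact0 oppr0 add0r; exact: Ty.
Qed.

Let TY3 u : T u -> T (gact V Y3 0 u).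
Proof.
apply: spanP_act => // w /base_word [j [v hv ->]]; rewrite iterY_act //; apply: Ty_iter.
by move: hv; rewrite !inE => /or4P[] /eqP -> //; rewrite Y3Y3 //; case: hT.
Qed.

Let X3b u : T (gact V X3 0 u) -> T (gact V H1 0 u) -> T (gact V H2 0 u) ->
  T (gact V X3 0 (gact V Y3 0 u)).
Proof.
move=> h1 h2 h3; rewrite gact_swap /ssign /= big_cons big_seq1 /= scaleN1r.
rewrite scale1r scaleN1r; apply: subspD => //; first by apply: subspN => //; apply: TY3.
exact: subspB.
Qed.

Let T_eigen h c u : eigen S h c u -> T u -> T (gact V h 0 u).
Proof. by move=> /hST e hu; apply: (subsp_subl hT e); apply: subspZ. Qed.

Let TX3 u : T u -> T (gact V X3 0 u).
Proof.
apply: spanP_act => // w /base_word [j [v hv ->]]; rewrite X3_iter.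
have hTv : T v by move: hv; rewrite !inE => /or4P[] /eqP ->.
apply: subspD => //; last first.
  by rewrite -scaler_nat; apply: subspZ => //; apply: Ty_iter; apply: TX1.
apply: Ty_iter.
have h3c : S (gact V X3 0 cm).
  by rewrite /cm gact_odd0 //; apply: (submN hS); apply: (subm_act hS).
move: hv; rewrite !inE => /or4P[] /eqP ->; try exact: hST.
- by apply: X3b; [exact: hST | apply: T_eigen eH1 _ | apply: T_eigen eH2 _].
- apply: X3b; first exact: hST.
    by apply: (T_eigen (c := l1)) => //; apply: (eigen_act hS (c := l1)) => //; rewrite /lie_coef /= addr0.
  apply: (T_eigen (c := (sumn [:: a])%:R - 1)) => //.
  by apply: (eigen_act hS (c := (sumn [:: a])%:R)).
Qed.

Let TY1 u : T u -> T (gact V Y1 0 u).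
Proof.
apply: spanP_act => // w /base_word [j [v hv ->]]; rewrite Y1_iter.
have hTv : T v by move: hv; rewrite !inE => /or4P[] /eqP ->.
apply: subspB => //; last first.
  by rewrite -scaler_nat; apply: subspZ => //; apply: Ty_iter; apply: TY3.
apply: Ty_iter.
have h1c : T (gact V Y1 0 cm).
  by apply: (subsp_subl hT (hST Y1cm)); apply: subspZ.
move: hv; rewrite !inE => /or4P[] /eqP -> //; first exact: hST.
- by rewrite /bm gact_odd0 //; apply: subspN => //; apply: hST; apply: (subm_act hS).
- by rewrite /bcm gact_odd0 //; apply: subspN => //; apply: TY3.
Qed.

Lemma dim_le_one_part : dim_le (genS S m) S (4 * a).
Proof.
exists L; split.
- by rewrite !size_cat !size_mkseq; lia.
- move=> w /base_word [j [v hv ->]]; apply: (subm_iter (genS_sub _ _)).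
  have hg := genS_sub S m.
  move: hv; rewrite !inE => /or4P[] /eqP -> //; do ?exact: (subm_act hg).
  by do 2!apply: (subm_act hg).
- apply: (genS_level0 lm) => // b u; case: b => // _ hu; [exact: TX1 | exact: TX3 | exact: TY1 | exact: TY3].
Qed.

End OnePart.

Section Sixteen.
Variables (eps : F) (k : V).
Hypotheses (lk : level_pos k) (hX2 : S (gact V X2 0 k)) (hY2 : S (gact V Y2 0 k)).
Hypotheses (hH1 : eigen S H1 eps k) (hH2 : eigen S H2 0 k).

Let hS' : subsp S := subm_subsp hS.
Let d := gact V Y1 0.
Let b := gact V Y3 0.
Let LP := [:: k; d k; b k; d (b k)].
Let P := spanP S LP.
Let hP : subsp P. Proof. exact: spanP_subsp. Qed.
Let hSP u : S u -> P u. Proof. exact: spanP_incl. Qed.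
Let Pk : P k. Proof. by apply: spanP_mem => //; rewrite inE eqxx. Qed.
Let Pdk : P (d k). Proof. by apply: spanP_mem => //; rewrite !inE eqxx orbT. Qed.
Let Pbk : P (b k). Proof. by apply: spanP_mem => //; rewrite !inE eqxx !orbT. Qed.
Let Pdbk : P (d (b k)). Proof. by apply: spanP_mem => //; rewrite !inE eqxx !orbT. Qed.

Let sq0 a u : godd a -> lie_table a a = [::] -> gact V a 0 (gact V a 0 u) = 0.
Proof.
move=> ha ht; have := @gact_odd0 _ V a a 0 0 u; rewrite /even_swap ha ht => /(_ isT erefl) /eqP.
rewrite -subr_eq0 opprK -mulr2n -scaler_nat scaler_eq0.
by rewrite (negPf (char0 1)) => /eqP.
Qed.

Let bd u : b (d u) = - d (b u). Proof. by rewrite /b gact_odd0. Qed.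

Let P_Y1 u : P u -> P (d u).
Proof.
apply: spanP_act => // w; rewrite !inE => /or4P[] /eqP -> //; rewrite /d sq0 //; by case: hP.
Qed.

Let P_Y3 u : P u -> P (b u).
Proof.
apply: spanP_act => // w; rewrite !inE => /or4P[] /eqP -> //.
- by rewrite -/b bd; apply: subspN.
- by rewrite /b sq0 //; case: hP.
- by rewrite -/b bd /b sq0 // /d gact0 oppr0; case: hP.
Qed.

Let P_X2 u : P u -> P (gact V X2 0 u).
Proof.
have h1 : P (gact V X2 0 (b k)).
  rewrite /b (@gact_even _ _ X2 Y3 Y1 1) // scale1r; apply: subspD => //.
  by apply: hSP; apply: (subm_act hS).
apply: spanP_act => // w; rewrite !inE => /or4P[] /eqP -> //; first exact: hSP.
- by rewrite /d (@gact_comm _ _ X2 Y1) //; apply: hSP; apply: (subm_act hS).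
- by rewrite /d (@gact_comm _ _ X2 Y1) //; apply: P_Y1.
Qed.

Let P_Y2 u : P u -> P (gact V Y2 0 u).
Proof.
have h1 : S (gact V Y2 0 (b k)).
  by rewrite /b (@gact_comm _ _ Y2 Y3) //; apply: (subm_act hS).
apply: spanP_act => // w; rewrite !inE => /or4P[] /eqP ->; do ?exact: hSP.
- rewrite /d (@gact_even _ _ Y2 Y1 Y3 1) // scale1r; apply: subspD => //.
  by apply: hSP; apply: (subm_act hS).
- rewrite /d (@gact_even _ _ Y2 Y1 Y3 1) // scale1r; apply: subspD => //.
    by apply: hSP; apply: (subm_act hS).
  by rewrite /b sq0 //; case: hP.
Qed.

Let P_eigen h c u : eigen S h c u -> P u -> P (gact V h 0 u).
Proof. by move=> /hSP e hu; apply: (subsp_subl hP e); apply: subspZ. Qed.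

Let P_H h c : cartan h -> eigen S h c k -> forall u, P u -> P (gact V h 0 u).
Proof.
move=> ch e; apply: spanP_act => // w.
have e1 a c' u : eigen S h c' u -> eigen S h (c' + (lie_coef h a a)%:~R) (gact V a 0 u).
  by move=> ?; apply: (eigen_act hS (c := c')).
rewrite !inE => /or4P[] /eqP ->.
- exact: P_eigen e _.
- exact: P_eigen (e1 _ _ _ e) _.
- exact: P_eigen (e1 _ _ _ e) _.
- exact: P_eigen (e1 _ _ _ (e1 _ _ _ e)) _.
Qed.

Let x := gact V X3 0.
Let c := gact V X1 0.
Let L := LP ++ map x LP ++ map c LP ++ map (fun u => c (x u)) LP.
Let T := spanP S L.
Let hT : subsp T. Proof. exact: spanP_subsp. Qed.
Let hST u : S u -> T u. Proof. exact: spanP_incl. Qed.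

Let PT u : P u -> T u.
Proof.
by apply: spanP_min => // w hw; apply: spanP_mem => //; rewrite mem_cat hw.
Qed.
Let PxT u : P u -> T (x u).
Proof.
by apply: spanP_act => // w hw; apply: spanP_mem => //; rewrite !mem_cat (map_f x hw) !orbT.
Qed.
Let PcT u : P u -> T (c u).
Proof.
by apply: spanP_act => // w hw; apply: spanP_mem => //; rewrite !mem_cat (map_f c hw) !orbT.
Qed.
Let PcxT u : P u -> T (c (x u)).
Proof.
apply: (spanP_min (T := fun u => T (c (x u)))).
- by split=> [|z v w hv hw]; rewrite /c /x ?gact0 ?gact_lin; case: hT => // _; apply.
- by move=> v hv; apply: hST; do 2!apply: (subm_act hS).
move=> w hw; apply: spanP_mem => //.
by rewrite !mem_cat (map_f (fun u => c (x u)) hw) !orbT.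
Qed.

Let T_ind a : (forall u, P u -> T (gact V a 0 u)) -> (forall u, P u -> T (gact V a 0 (x u))) ->
  (forall u, P u -> T (gact V a 0 (c u))) -> (forall u, P u -> T (gact V a 0 (c (x u)))) ->
  forall u, T u -> T (gact V a 0 u).
Proof.
move=> h1 h2 h3 h4; apply: spanP_act => // w.
have hLP v : v \in LP -> P v by move=> hv; apply: spanP_mem.
rewrite !mem_cat => /or4P[/hLP|/mapP[v /hLP hv ->]|/mapP[v /hLP hv ->]|/mapP[v /hLP hv ->]].
- exact: h1.
- exact: h2.
- exact: h3.
- exact: h4.
Qed.

Let xc u : x (c u) = - c (x u). Proof. by rewrite /x gact_odd0. Qed.

(** Modulo [S] the even part acts on [k] by scalars, so the module is spanned by the 2^4 ordered
    products of odd root vectors applied to [k]. The span [P] of the four products of y_1 and y_3 is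
    stable under the even part and under y_1, y_3; then x_3 and x_1 are put in front. *)
Lemma dim_le_sixteen : dim_le (genS S k) S 16.
Proof.
exists L; split=> //.
  have hg := genS_sub S k.
  have hLP v : v \in LP -> genS S k v.
    by rewrite !inE => /or4P[] /eqP -> //; do ?exact: (subm_act hg); do 2!apply: (subm_act hg).
  move=> w; rewrite !mem_cat => /or4P[/hLP //|/mapP[v /hLP hv ->]|/mapP[v /hLP hv ->]|/mapP[v /hLP hv ->]];
    by do ?apply: (subm_act hg).
apply: (genS_level0 lk) => //; first exact: PT.
have hH1' := @P_H H1 _ isT hH1; have hH2' := @P_H H2 _ isT hH2.
case=> //= u _; apply: T_ind => {}u hu.
- exact: PcT.
- exact: PcxT.
- by rewrite /c sq0 //; case: hT.
- by rewrite /c sq0 //; case: hT.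
- exact: PxT.
- by rewrite /x sq0 //; case: hT.
- by rewrite -/x xc; apply: subspN => //; apply: PcxT.
- by rewrite -/x xc /x sq0 // /c gact0 oppr0; case: hT.
- by apply: PT; apply: P_Y1.
- rewrite /x (@gact_odd _ _ Y1 X3 X2 1) // scale1r; apply: subspD => //.
    by apply: subspN => //; apply: PxT; apply: P_Y1.
  by apply: PT; apply: P_X2.
- rewrite /c (@gact_odd _ _ Y1 X1 H1 1) // scale1r; apply: subspD => //.
    by apply: subspN => //; apply: PcT; apply: P_Y1.
  by apply: PT; apply: hH1'.
- rewrite /c (@gact_odd _ _ Y1 X1 H1 1) // scale1r; apply: subspD => //.
    rewrite /x (@gact_odd _ _ Y1 X3 X2 1) // scale1r gactD gactN opprD opprK.
    apply: subspB => //; first by apply: PcxT; apply: P_Y1.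
    by apply: PcT; apply: P_X2.
  rewrite /x (@gact_even _ _ H1 X3 X3 1) // scale1r; apply: subspD => //; last exact: PxT.
  by apply: PxT; apply: hH1'.
- by apply: PT; apply: P_Y3.
- rewrite /x gact_swap /ssign /= big_cons big_seq1 /= scaleN1r scale1r scaleN1r.
  apply: subspD => //; first by apply: subspN => //; apply: PxT; apply: P_Y3.
  by apply: PT; apply: subspB => //; [apply: hH1' | apply: hH2'].
- rewrite /c (@gact_odd _ _ Y3 X1 Y2 1) // scale1r; apply: subspD => //.
    by apply: subspN => //; apply: PcT; apply: P_Y3.
  by apply: PT; apply: P_Y2.
- rewrite /c (@gact_odd _ _ Y3 X1 Y2 1) // scale1r; apply: subspD => //.
    rewrite /x (gact_swap Y3 X3) /ssign /= big_cons big_seq1 /= scaleN1r scale1r scaleN1r.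
    rewrite gactD gactN opprD opprK; apply: subspB => //; first by apply: PcxT; apply: P_Y3.
    by apply: PcT; apply: subspB => //; [apply: hH1' | apply: hH2'].
  rewrite /x (@gact_even _ _ Y2 X3 X1 (-1)) // scaleN1r; apply: subspB => //; last exact: PcT.
  by apply: PxT; apply: P_Y2.
Qed.

End Sixteen.

End BaseCases.

(** Quantifying over all submodules [S] lets the induction hypothesis apply to a layer inside the
    module it came from. *)
Definition UB (F : fieldType) (xi : seq nat) : Prop :=
  forall (V : gmod F) (S : V -> Prop) (m : V) (l : F), is_submodule S -> cvS l xi S m ->
    dim_le (genS S m) S (Ddim xi).

Lemma genS_le (F : fieldType) (V : gmod F) (S : V -> Prop) w T :
  is_submodule T -> (forall v, S v -> T v) -> T w -> forall u, genS S w u -> T u.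
Proof. by move=> hT h hw u; apply: genS_min. Qed.

(** * The chain of submodules below the first generator *)

Section Filtration.
Variables (F : fieldType) (char0 : forall k, k.+1%:R != 0 :> F) (V : gmod F).
Variables (S : V -> Prop) (hS : is_submodule S).
Variables (n : nat) (xs : seq nat) (a x : nat) (l1 : F) (m : V).
Hypotheses (n0 : (0 < n)%N) (sx : size xs = n.-1) (hsort : sorted geq (xs ++ [:: a; x])).
Hypotheses (x0 : (0 < x)%N) (hm : cvS l1 (xs ++ [:: a; x]) S m).

Definition fil3 := genS S (step3 n x m).
Definition fil2 := genS fil3 (step2 n x m).
Definition fil1 := genS fil2 (step1 n x m).
Definition fil0 := genS S (step0 n x m).

Lemma fil3_sub : is_submodule fil3. Proof. exact: genS_sub. Qed.
Lemma fil2_sub : is_submodule fil2. Proof. exact: genS_sub. Qed.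
Lemma fil1_sub : is_submodule fil1. Proof. exact: genS_sub. Qed.
Lemma fil0_sub : is_submodule fil0. Proof. exact: genS_sub. Qed.
Lemma S_fil3 u : S u -> fil3 u. Proof. exact: genS_incl. Qed.
Lemma fil3_2 u : fil3 u -> fil2 u. Proof. exact: genS_incl. Qed.
Lemma fil2_1 u : fil2 u -> fil1 u. Proof. exact: genS_incl. Qed.
Lemma S_fil2 u : S u -> fil2 u. Proof. by move/S_fil3/fil3_2. Qed.
Lemma S_fil1 u : S u -> fil1 u. Proof. by move/S_fil2/fil2_1. Qed.
Lemma S_fil0 u : S u -> fil0 u. Proof. exact: genS_incl. Qed.

Lemma fil0_gen u : fil0 u -> genS S m u.
Proof.
apply: genS_le; [exact: genS_sub | exact: genS_incl | apply: (subm_iter (genS_sub _ _)) => //].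
Qed.

(** The first generator produces the others: x_3 and y_1 map it to x and -x times the second and
    third, and y_1 maps the second to -(x-1) times the fourth. *)
Lemma fil1_0 u : fil1 u -> fil0 u.
Proof.
have hT := fil0_sub; have hST := S_fil0.
have hg0 : fil0 (step0 n x m) by move=> ? ? ?.
have t1 : fil0 (step1 n x m).
  apply: (submMnr char0 hT x0).
  have h := hST _ (X3_step0 hS n hm); have h' := subm_act hT X3 0 hg0.
  by rewrite -[X in fil0 X](subKr (gact V X3 0 (step0 n x m))); apply: (submB hT).
have t2 : fil0 (step2 n x m).
  apply: (submMnr char0 hT x0).
  have h := hST _ (Y1_step0 hS n hm); have h' := subm_act hT Y1 0 hg0.
  by move: h; rewrite addrC => /(submDK hT); apply.
have t3 : fil0 (step3 n x m).
  have [x1|x1] := leqP x 1.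
    by rewrite /step3 (_ : (x == 1%N)) ?eqn_leq ?x1 ?x0 //; apply: (subm0 hT).
  apply: (submMnr char0 hT (k := x.-1)); first by lia.
  have h := hST _ (Y1_step1 hS n0 sx hm); have h' := subm_act hT Y1 0 t1.
  by move: h; rewrite addrC => /(submDK hT); apply.
apply: genS_le => //; apply: genS_le => //; exact: genS_le.
Qed.

Lemma cvS_fil_plus xi : perm_eq xi (xs ++ [:: a.+1; x.-1]) -> cvS l1 xi fil0 m.
Proof.
move=> h; apply: (cvS_plus char0 hS n0 sx hsort x0 hm fil0_sub S_fil0) => //.
Qed.

Lemma cvS_fil0 : cvS (l1 - x%:R) (rcons xs (a - x)%N) fil1 (step0 n x m).
Proof.
apply: (cvS_step0 char0 hS n0 sx hsort x0 hm fil1_sub S_fil1) => //.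
by apply: fil2_1.
Qed.

Lemma cvS_fil1 : cvS (l1 - x.-1%:R) (rcons xs (a - x)%N.+1) fil2 (step1 n x m).
Proof.
apply: (cvS_step1 char0 hS n0 sx hsort x0 hm fil2_sub S_fil2).
by apply: fil3_2.
Qed.

Lemma cvS_fil2 : cvS (l1 - x%:R) (rcons xs (a - x)%N.+1) fil3 (step2 n x m).
Proof.
exact: (cvS_step2 char0 hS n0 sx hsort x0 hm fil3_sub S_fil3).
Qed.

Lemma cvS_fil3 : (1 < x)%N -> cvS (l1 - x.-1%:R) (rcons xs (a - x)%N.+2) S (step3 n x m).
Proof. exact: (cvS_step3 char0 hS n0 sx hsort x0 hm). Qed.

Lemma fil3_x1 : x = 1%N -> forall u, fil3 u -> S u.
Proof.
move=> x1; apply: genS_le => //; rewrite /step3 x1 eqxx; exact: (subm0 hS).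
Qed.

Lemma genS_fil1_step0 u : genS fil1 (step0 n x m) u <-> fil0 u.
Proof.
split; apply: genS_le => //; try exact: genS_sub; first exact: fil1_0.
by move=> v /S_fil1; apply: genS_incl.
Qed.

Lemma genS_fil0_m u : genS fil0 m u <-> genS S m u.
Proof.
split; apply: genS_le => //; try exact: genS_sub; first exact: fil0_gen.
by move=> v /S_fil0; apply: genS_incl.
Qed.

(** The first layer would have the partition (0), which [good] excludes. Instead, all currents of
    positive degree kill the generator, y_2 kills it by the bound with k = 0, and its h_2-weight is
    0, so the bound by 16 applies. *)
Lemma dim_le_fil0_two : n = 1%N -> a = x -> dim_le fil0 S 16.
Proof.
move=> n1 eax; have xs0 : xs = [::] by apply/nilP; rewrite /nilp sx n1.
have lk : level_pos S (step0 n x m).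
  move=> b r r0; have hk := pos_killed_step0 hS n0 sx hm.
  have [r1|r1] := ltnP 1 r; first by apply: hk; rewrite n1; case: b => //=.
  have er : r = n by lia.
  have := step0_tail char0 hS n0 sx hsort x0 hm (b := b).
  case: b; rewrite ?er; do ?[by move=> h; exact: h]; by move=> _; apply: hk.
have hX2 : S (gact V X2 0 (step0 n x m)).
  by apply: (pos_killed_step0 hS n0 sx hm); rewrite n1.
have hY2 : S (gact V Y2 0 (step0 n x m)).
  rewrite -Yp1; have hb := bnd_step0 char0 hS n0 sx hm (i := 0) n0.
  by move: hb; rewrite /bnd; apply; rewrite xs0 eax /=; lia.
have h1 := eigen_H1_step0 hS n hm.
have h2 := eigen_H2_step0 char0 hS n0 sx hsort x0 hm.
rewrite xs0 /= eax subnn in h2.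
exact: (dim_le_sixteen char0 hS lk hX2 hY2 h1 h2).
Qed.

Section Equal.
Hypotheses (eax : a = x) (x1 : (1 < x)%N) (n1 : (1 < n)%N).
Variables (ys : seq nat) (e : nat).
Hypotheses (exs : xs = rcons ys e) (e0 : (1 < e)%N).

Let m' := step1 n x m.
Let l' := l1 - x.-1%:R.

Let n0' : (0 < n.-1)%N. Proof. lia. Qed.
Let sys : size ys = n.-1.-1. Proof. by move: sx; rewrite exs size_rcons; lia. Qed.
Let hsort' : sorted geq (ys ++ [:: e; 1%N]).
Proof.
move: hsort; rewrite exs -cats1 -catA => h.
have : sorted geq (ys ++ [:: e]) by move: h; rewrite catA => /cat_sorted2[].
by case: (ys) => [|z zs] //=; rewrite ?andbT ?(ltnW e0) // !cat_path /= !andbT (ltnW e0) andbT.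
Qed.
Let hm' : cvS l' (ys ++ [:: e; 1%N]) fil2 m'.
Proof. by have := cvS_fil1; rewrite eax subnn exs -cats1 -cats1 -catA. Qed.

(** Since a - x + 1 = 1, the second layer has parts ys, e, 1, and the construction is repeated
    modulo [fil2] with n - 1 and exponent 1. There the third generator already lies in [fil2] and
    the fourth is zero, so only these two submodules are new. *)
Definition filb := genS fil2 (step1 n.-1 1 (step1 n x m)).
Definition fila := genS filb (step0 n.-1 1 (step1 n x m)).

Lemma filb_sub : is_submodule filb. Proof. exact: genS_sub. Qed.
Lemma fila_sub : is_submodule fila. Proof. exact: genS_sub. Qed.
Lemma fil2_b u : fil2 u -> filb u. Proof. exact: genS_incl. Qed.
Lemma filb_a u : filb u -> fila u. Proof. exact: genS_incl. Qed.
Lemma fil2_a u : fil2 u -> fila u. Proof. by move/fil2_b/filb_a. Qed.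

Lemma fila_1 u : fila u -> fil1 u.
Proof.
have h1 := fil1_sub; have hg : fil1 (step1 n x m) by [].
apply: genS_le => //; last exact: (subm_act h1).
apply: genS_le => //; last exact: (subm_act h1).
exact: fil2_1.
Qed.

Lemma fil2_step2' : fil2 (step2 n.-1 1 (step1 n x m)).
Proof.
apply: (Y3_pred_step1 char0 hS n0 sx hsort x0 hm fil2_sub S_fil2 eax n1) => //.
by apply: fil3_2.
Qed.

Lemma cvS_fila_plus xi : perm_eq xi (ys ++ [:: e.+1; 0%N]) -> cvS l' xi fila m'.
Proof.
move=> h; apply: (cvS_plus char0 fil2_sub n0' sys hsort' isT hm' fila_sub fil2_a) => //.
Qed.

Lemma cvS_fila : cvS (l1 - x%:R) (rcons ys e.-1) filb (step0 n.-1 1 m').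
Proof.
have -> : l1 - x%:R = l' - 1%:R.
  by rewrite /l' -[X in X%:R](prednK x0) -addn1 natrD opprD addrA.
rewrite -subn1; apply: (cvS_step0 char0 fil2_sub n0' sys hsort' isT hm' filb_sub fil2_b) => //.
by apply: fil2_b; exact: fil2_step2'.
Qed.

Lemma cvS_filb : cvS l' (rcons ys e) fil2 (step1 n.-1 1 m').
Proof.
have := cvS_step1 char0 fil2_sub n0' sys hsort' isT hm' fil2_sub (fun _ h => h).
rewrite subr0 subn1 prednK; last by lia.
by apply; rewrite /step3; apply: (subm0 fil2_sub).
Qed.

Lemma genS_fila_step1 u : genS fila (step1 n x m) u <-> fil1 u.
Proof.
split; apply: genS_le => //; try exact: genS_sub; first exact: fila_1.
by move=> v /fil2_a; apply: genS_incl.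
Qed.

End Equal.

End Filtration.

(** * Dimension identities *)

(** For x > 1 this is 4(a x - (a+1)(x-1)) = (a-x) + 2(a-x+1) + (a-x+2). For x = 1 the zero part
    contributes a factor 1 and the fourth layer is absent. *)
Lemma Ddim_split_lt q a x : (0 < x)%N -> (x < a)%N -> Ddim (q ++ [:: a; x]) =
  (Ddim (q ++ [:: a.+1; x.-1]) + (Ddim (rcons q (a - x)%N) + (Ddim (rcons q (a - x)%N.+1) +
    (Ddim (rcons q (a - x)%N.+1) + (if x == 1%N then 0%N else Ddim (rcons q (a - x)%N.+2))))))%N.
Proof.
case: x => // c _ lt_xa.
rewrite !Ddim_cat !Ddim_rcons !Ddim_cons !Ddim_nil /= subn_gt0 lt_xa.
have -> : (0 < a)%N by lia.
rewrite eqSS; case: eqP lt_xa => [->|hc] h; rewrite ?muln1 ?addn0.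
  have [k ek] : exists k, a = k.+2 by exists (a - 2)%N; lia.
  by rewrite ek subSS subn0 /=; ring.
have -> : (0 < c)%N by lia.
have [k ->] : exists k, a = (c + 2 + k)%N by exists (a - (c + 2))%N; lia.
rewrite (_ : c + 2 + k - c.+1 = k.+1)%N; [ring | lia].
Qed.

Lemma Ddim_split_eq ys e a : (1 < e)%N -> (1 < a)%N -> Ddim (rcons ys e ++ [:: a; a]) =
  (Ddim (rcons ys e ++ [:: a.+1; a.-1]) + (Ddim (rcons (rcons ys e) (a - a)%N) +
    (Ddim (ys ++ [:: e.+1; 0%N]) + (Ddim (rcons ys e.-1) + (Ddim (rcons ys e) +
    (Ddim (rcons (rcons ys e) (a - a)%N.+1) + Ddim (rcons (rcons ys e) (a - a)%N.+2)))))))%N.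
Proof.
case: a => [|[|c]] // he _.
rewrite !Ddim_cat !Ddim_rcons !Ddim_cons !Ddim_nil /= subnn /=.
have -> : (0 < e)%N by lia.
have -> : (0 < e.-1)%N by lia.
have [k ->] : exists k, e = k.+2 by exists (e - 2)%N; lia.
rewrite /=; ring.
Qed.

Lemma Ddim_split_two a : (1 < a)%N -> Ddim [:: a; a] = (Ddim [:: a.+1; a.-1] + 16)%N.
Proof. by case: a => [|[|c]] // _; rewrite !Ddim_cons !Ddim_nil /=; ring. Qed.

(** * Induction on partitions *)

Section UpperBound.
Variables (F : fieldType) (char0 : forall k, k.+1%:R != 0 :> F).

Lemma UB_perm xi xi' : perm_eq xi xi' -> UB F xi -> UB F xi'.
Proof.
move=> h ub V S m l hS [h1 h2]; rewrite -(Ddim_perm h); apply: (ub V S m l) => //.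
split; first by rewrite (perm_sumn h).
by move=> r s; rewrite (Gmin_perm _ h); apply: h2.
Qed.

Lemma UB_zero xi : UB F xi -> UB F (rcons xi 0%N).
Proof.
move=> ub V S m l hS [h1 h2]; rewrite Ddim_rcons muln1; apply: (ub V S m l) => //.
split; first by move: h1; rewrite sumn_rcons addn0.
move=> r s h; apply: h2; rewrite -cats1 Gmin_cat Gmin_cons Gmin_nil minn0 !addn0 //.
Qed.

(** A class of partitions closed under every move of the induction. It avoids two equal parts 1, not
    covered by the dimension identities, and the zero partition, where lambda_1 is not forced to
    vanish. *)
Definition good (xi : seq nat) := (count (fun z => z < 2) xi <= 1)%N && has (fun z => 0 < z)%N xi.

Lemma geq_trans : transitive geq.
Proof. by move=> y x z /= h1 h2; apply: leq_trans h2 h1. Qed.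

Lemma geq_total : total geq.
Proof. by move=> x y; apply: leq_total. Qed.

Lemma good_perm xi xi' : perm_eq xi xi' -> good xi = good xi'.
Proof. by move=> h; rewrite /good (permP h) (perm_has _ h). Qed.

Lemma good_rcons xs c : all (fun z => 1 < z)%N xs -> (xs != [::]) || (0 < c)%N -> good (rcons xs c).
Proof.
move=> hx hc; rewrite /good -cats1 count_cat has_cat /= !addn0 orbF.
have -> : count (fun z => z < 2)%N xs = 0%N.
  apply/eqP; rewrite -leqn0 leqNgt -has_count -all_predC; apply: sub_all hx => z /=.
  by rewrite -leqNgt.
case: xs hx hc => [|z zs] /=; first by move=> _ ->; case: (_ < 2)%N.
by case/andP=> h _ _; rewrite (ltnW h) andbT; case: (_ < 2)%N.
Qed.

Section Inner.
Variable N : nat.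
Hypothesis IH : forall xi, (size xi <= N)%N -> good xi -> UB F xi.

(** The layers of the kernel have fewer parts than xi, up to a trailing zero, and fall under [IH];
    the quotient V(xi^+) has the same number of parts but a smaller last one. Hence the inner
    induction on the last part [c]. *)
Lemma UB_rcons c xs : size xs = N -> sorted geq (rcons xs c) -> all (fun z => 1 < z)%N xs ->
  (xs != [::]) || (0 < c)%N -> UB F (rcons xs c).
Proof.
elim: c xs => [|c IHc] xs sN hs hall hne.
  apply: UB_zero; apply: IH; first by rewrite sN.
  move: hne; rewrite orbF; case/lastP: xs sN hs hall => [//|q b] _ _.
  rewrite all_rcons => /andP[hb hq] _; apply: good_rcons => //.
  by rewrite (ltnW hb) orbT.
case/lastP: xs sN hs hall hne => [|q a] sN hs hall hne.
  by move=> V S m l hS hm; rewrite Ddim_cons Ddim_nil muln1; apply: (dim_le_one_part char0 hS (l1 := l)).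
rewrite -cats1 cat_rcons; rewrite -cats1 cat_rcons in hs.
have [hq ha] : all (fun z => 1 < z)%N q /\ (1 < a)%N by move: hall; rewrite all_rcons => /andP[].
have ca : (c.+1 <= a)%N by have [_ /=] := cat_sorted2 hs; rewrite andbT.
set x := c.+1 in hs ca *; have x0 : (0 < x)%N by [].
move=> V S m l hS hm.
pose n := (size q).+1; have n0 : (0 < n)%N by []; have sx : size q = n.-1 by [].
have sqN : size (rcons q 0%N) = N by rewrite -sN !size_rcons.
have plus : UB F (q ++ [:: a.+1; c]).
  apply: (@UB_perm (rcons (sort geq (rcons q a.+1)) c)).
    by rewrite -cat_rcons -cats1 perm_cat2r perm_sort.
  apply: IHc; first by rewrite size_sort size_rcons -sN size_rcons.
  - have hle : all (fun z => c <= z)%N (sort geq (rcons q a.+1)).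
      have ca' : (c < a)%N by exact: ca.
      rewrite all_sort all_rcons /= (ltnW (leqW ca')) /=.
      have : all (fun z => a <= z)%N q.
        move: hs; rewrite sorted_pairwise; last exact: geq_trans.
        rewrite pairwise_cat => /and3P[/allrelP h _ _]; apply/allP => z hz.
        by apply: (h z a hz); rewrite inE eqxx.
      by apply: sub_all => z; apply: leq_trans; apply: ltnW.
    have := sort_sorted geq_total (rcons q a.+1).
    case: (sort _ _) hle => //= z zs; rewrite rcons_path => hle ->.
    have hle' : all (fun y => c <= y)%N (z :: zs) := hle.
    exact: (allP hle' _ (mem_last z zs)).
  - by rewrite all_sort all_rcons hq andbT ltnS ltnW.
  - by rewrite -size_eq0 size_sort size_rcons.
have sub c' : (q != [::]) || (0 < c')%N -> UB F (rcons q c').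
  move=> h; apply: IH; first by rewrite -sqN !size_rcons.
  exact: good_rcons.
have hK0 : is_submodule (fil0 S n x m) by exact: fil0_sub.
have hK1 : is_submodule (fil1 S n x m) by exact: fil1_sub.
have hK2 : is_submodule (fil2 S n x m) by exact: fil2_sub.
have hK3 : is_submodule (fil3 S n x m) by exact: fil3_sub.
have dplus : dim_le (genS S m) (fil0 S n x m) (Ddim (q ++ [:: a.+1; c])).
  have h := plus V _ m l hK0 (cvS_fil_plus char0 hS n0 sx hs x0 hm (perm_refl _)).
  by apply: dim_le_weak h => u /genS_fil0_m.
have d2 : dim_le (fil2 S n x m) (fil3 S n x m) (Ddim (rcons q (a - x)%N.+1)).
  by apply: (sub _ _ V _ _ _ hK3 (cvS_fil2 char0 hS n0 sx hs x0 hm)); rewrite orbT.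
have d3 : dim_le (fil3 S n x m) S (if x == 1%N then 0%N else Ddim (rcons q (a - x)%N.+2)).
  case: eqP => x1; last first.
    have x2 : (1 < x)%N by move: x0 x1; case: (x) => [|[|]].
    by apply: (sub _ _ V _ _ _ hS (cvS_fil3 char0 hS n0 sx hs x0 hm x2)); rewrite orbT.
  exists [::]; split=> // u /(fil3_x1 hS x1); apply: spanP_incl; exact: subm_subsp.
have s0 := subm_subsp hK0; have s1 := subm_subsp hK1.
have s2 := subm_subsp hK2; have s3 := subm_subsp hK3; have sS := subm_subsp hS.
have d23 := dim_le_trans s3 sS (@fil3_2 F V S n x m) d2 d3.
have i10 := fil1_0 char0 hS n0 sx hs x0 hm.
have D0 (h : (q != [::]) || (0 < a - x)%N) :
    dim_le (fil0 S n x m) (fil1 S n x m) (Ddim (rcons q (a - x)%N)).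
  have h' := sub _ h V _ _ _ hK1 (cvS_fil0 char0 hS n0 sx hs x0 hm).
  by apply: dim_le_weak h' => u /(genS_fil1_step0 char0 hS n0 sx hs x0 hm).
have fin d (dK0 : dim_le (fil0 S n x m) S d) :
    (Ddim (q ++ [:: a.+1; c]) + d)%N = Ddim (q ++ [:: a; x]) ->
    dim_le (genS S m) S (Ddim (q ++ [:: a; x])).
  by move=> <-; apply: (dim_le_trans s0 sS _ dplus dK0); apply: fil0_gen.
move: (ca); rewrite leq_eqVlt => /orP[/eqP eax|lt_xa]; last first.
  have d1 : dim_le (fil1 S n x m) (fil2 S n x m) (Ddim (rcons q (a - x)%N.+1)).
    by apply: (sub _ _ V _ _ _ hK2 (cvS_fil1 char0 hS n0 sx hs x0 hm)); rewrite orbT.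
  have d0 := D0 ltac:(rewrite subn_gt0 lt_xa orbT //).
  have d123 := dim_le_trans s2 sS (@fil2_1 F V S n x m) d1 d23.
  have d0123 := dim_le_trans s1 sS i10 d0 d123.
  apply: (fin _ d0123).
  by rewrite (Ddim_split_lt q x0 lt_xa).
(* From here a = x, so the first layer has the part 0. If no other part exists, [sub] does not apply
   to it and the bound by 16 is used. *)
case/lastP: q => [|ys e] in sN hs hall hne hq hm plus sub n n0 sx sqN hK0 hK1 hK2 hK3
    dplus d2 d3 s0 s1 s2 s3 d23 i10 D0 fin *.
  have d16 := dim_le_fil0_two char0 hS n0 sx hs x0 hm (erefl _) (esym eax).
  by apply: (fin _ d16); rewrite /= eax (Ddim_split_two ha) -eax.
have n1 : (1 < n)%N by rewrite /n size_rcons.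
have x1 : (1 < x)%N by rewrite eax.
have he : (1 < e)%N by move: hq; rewrite all_rcons => /andP[].
have eax' : a = x by [].
have plus' : UB F (ys ++ [:: e.+1; 0%N]).
  rewrite -cat_rcons cats1; apply: UB_zero; apply: IH; first by rewrite -sqN !size_rcons.
  by apply: good_rcons; [move: hq; rewrite all_rcons => /andP[] | rewrite orbT].
have sub' c' : (0 < c')%N -> UB F (rcons ys c').
  move=> h; apply: IH; first by rewrite -sqN !size_rcons.
  by apply: good_rcons; [move: hq; rewrite all_rcons => /andP[] | rewrite h orbT].
have hKb : is_submodule (filb S n x m) by exact: filb_sub.
have hKa : is_submodule (fila S n x m) by exact: fila_sub.
have sa := subm_subsp hKa; have sb := subm_subsp hKb.
have d1a : dim_le (fil1 S n x m) (fila S n x m) (Ddim (ys ++ [:: e.+1; 0%N])).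
  have h := plus' V _ _ _ hKa (cvS_fila_plus char0 hS n0 sx hs x0 hm eax' x1 n1 (erefl _) he (perm_refl _)).
  by apply: dim_le_weak h => u /genS_fila_step1.
have dab : dim_le (fila S n x m) (filb S n x m) (Ddim (rcons ys e.-1)).
  apply: (sub' _ _ V _ _ _ hKb (cvS_fila char0 hS n0 sx hs x0 hm eax' x1 n1 (erefl _) he)); lia.
have db2 : dim_le (filb S n x m) (fil2 S n x m) (Ddim (rcons ys e)).
  apply: (sub' _ _ V _ _ _ hK2 (cvS_filb char0 hS n0 sx hs x0 hm eax' x1 n1 (erefl _) he)); lia.
have d0 := D0 ltac:(by rewrite -size_eq0 size_rcons).
have db := dim_le_trans s2 sS (@fil2_b F V S n x m) db2 d23.
have da := dim_le_trans sb sS (@filb_a F V S n x m) dab db.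
have d1 := dim_le_trans sa sS (@fila_1 F V S n x m) d1a da.
have dd := dim_le_trans s1 sS i10 d0 d1.
apply: (fin _ dd).
have hx1 : (x == 1%N) = false by move: x1; case: (x) => [|[]].
by rewrite hx1 eax (Ddim_split_eq ys he ha) -eax.
Qed.

End Inner.

Theorem upper_bound xi : good xi -> UB F xi.
Proof.
move: (leqnn (size xi)); move: {2}(size xi) => N.
elim: N xi => [|N IH] xi; first by rewrite leqn0 size_eq0 => /eqP ->.
rewrite leq_eqVlt => /orP[/eqP sN|]; last exact: IH.
move=> hg; apply: (@UB_perm (sort geq xi)); first by rewrite perm_sort.
have hg' : good (sort geq xi) by rewrite (good_perm (xi' := xi)) // perm_sort.
have hs := sort_sorted geq_total xi.
have : size (sort geq xi) = N.+1 by rewrite size_sort.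
move: (sort geq xi) hs hg' => s; case/lastP: s => [//|xs c] hs hg' /eqP.
rewrite size_rcons eqSS => /eqP sxs.
have hall : all (fun z => 1 < z)%N xs.
  apply/allP => z hz; rewrite ltnNge; apply/negP => z1.
  have hc : (c <= z)%N.
    move: hs; rewrite sorted_pairwise; last exact: geq_trans.
    by rewrite pairwise_rcons => /andP[/allP /(_ z hz)].
  have : (count (fun z => z < 2) (rcons xs c) <= 1)%N by case/andP: hg'.
  rewrite -cats1 count_cat /= (leq_ltn_trans hc) // addn1 ltnS leqn0 => /eqP h0.
  have : has (fun z => z < 2)%N xs by apply/hasP; exists z.
  by rewrite has_count h0.
apply: (UB_rcons IH) => //.
case/andP: hg' => _; rewrite -cats1 has_cat /= orbF.
by case: (xs).
Qed.

End UpperBound.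

(** * The modules of dimension 4a *)

Section EvalModule.
Variables (F : fieldType) (char0 : forall k, k.+1%:R != 0 :> F).
Variables (l : F) (a : nat).
Hypothesis a0 : (0 < a)%N.

Definition quad := ({poly F} * {poly F} * {poly F} * {poly F})%type.
Implicit Types (f g : {poly F}) (u w : quad) (b : gb).

(** Chosen so that h_1 acts on the highest weight vector by be a = l. No later step divides by [be]
    or [1 - be], so l is arbitrary. *)
Definition be : F := l / a%:R.
Definition bp : {poly F} := be%:P.
Definition ap : {poly F} := 1 - bp.
Definition np : {poly F} := (a%:R : F)%:P.

(* Dehomogenised form (p = 1) of the module of quadruples of binary forms in (p, q) of degrees
   a, a-1, a-1, a-2: [dp (d)] is [d/dp] on forms of degree d, so that the sl(2)-action is
   x_2 = p d/dq, y_2 = q d/dp. *)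
Definition dp (d : {poly F}) f : {poly F} := d * f - 'X * f^`().

Definition eact b u : quad :=
  let: (fA, fB, fC, fD) := u in
  match b with
  | X1 => (- (ap * 'X * fC), dp np fA + ap * 'X * fD, 0, dp (np - 1) fC)
  | X2 => (fA^`(), fB^`(), fC^`(), fD^`())
  | X3 => (ap * fC, fA^`() - ap * fD, 0, fC^`())
  | Y1 => (bp * fB, 0, fA^`() + bp * fD, - fB^`())
  | Y2 => ('X * dp np fA, 'X * dp (np - 1) fB, 'X * dp (np - 1) fC, 'X * dp (np - 1 - 1) fD)
  | Y3 => (bp * 'X * fB, 0, bp * 'X * fD - dp np fA, dp (np - 1) fB)
  | H1 => (bp * np * fA - 'X * fA^`(), bp * np * fB - 'X * fB^`(),
           (bp * np - 1) * fC - 'X * fC^`(), (bp * np - 1) * fD - 'X * fD^`())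
  | H2 => (np * fA - 'X * fA^`() *+ 2, (np - 1) * fB - 'X * fB^`() *+ 2,
           (np - 1) * fC - 'X * fC^`() *+ 2, (np - 1 - 1) * fD - 'X * fD^`() *+ 2)
  end.

(** The parity operator: [gmod] records no parity of vectors, so the signs in a tensor product
    action are supplied by such involutions. *)
Definition esg u : quad := let: (fA, fB, fC, fD) := u in (fA, - fB, - fC, fD).

Lemma quad_scale (c : F) fA fB fC fD :
  c *: (fA, fB, fC, fD) = (c%:P * fA, c%:P * fB, c%:P * fC, c%:P * fD) :> quad.
Proof. by rewrite !mul_polyC. Qed.

Let derE := (derivD, derivB, derivN, derivM, derivC, derivX, derivMn).

Let dbp : bp^`() = 0. Proof. exact: derivC. Qed.
Let dnp : np^`() = 0. Proof. exact: derivC. Qed.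

Lemma eact_lin b (c : F) u w : eact b (c *: u + w) = c *: eact b u + eact b w.
Proof.
case: u => [[[uA uB] uC] uD]; case: w => [[[wA wB] wC] wD].
rewrite quad_scale; case: b; rewrite /eact quad_scale /dp /ap; congr (_, _, _, _); rewrite /= ?derE ?dbp ?dnp.
all: ring.
Qed.

Lemma eact_br b c u : eact b (eact c u) - ssign F b c *: eact c (eact b u)
  = \sum_(p <- lie_table b c) p.1%:~R *: eact p.2 u.
Proof.
case: u => [[[uA uB] uC] uD].
have e1 : (1%:~R : F)%:P = 1 by [].
have e2 : ((-1)%:~R : F)%:P = -1 by rewrite !rmorphN1.
have e3 : (2%:~R : F)%:P = 2%:R by rewrite -[in LHS]pmulrn polyC_natr.
have e4 : ((-2)%:~R : F)%:P = - 2%:R by rewrite (mulrNz 1 2) polyCN e3.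
case: b; case: c; rewrite /= ?big_cons ?big_nil ?addr0 /ssign /=.
all: rewrite ?quad_scale ?e1 ?e2 ?e3 ?e4 /dp /ap ?rmorphN1 ?polyC1.
all: congr (_, _, _, _).
all: rewrite /= ?derE ?dbp ?dnp /=.
all: ring.
Qed.

Lemma esg_act b u : esg (eact b u) = (if godd b then -1 else 1) *: eact b (esg u).
Proof.
case: u => [[[uA uB] uC] uD]; case: b; rewrite /= quad_scale ?rmorphN1 ?polyC1 /dp /ap;
  congr (_, _, _, _); rewrite ?derE /=; ring.
Qed.

End EvalModule.

Section EvalBasis.
Variables (F : fieldType) (char0 : forall k, k.+1%:R != 0 :> F).
Variables (l : F) (a : nat).
Hypothesis a0 : (0 < a)%N.
Local Notation quad := (quad F).
Local Notation be := (be l a).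
Local Notation bp := (bp l a).
Local Notation ap := (ap l a).
Local Notation np := (np F a).
Local Notation eact := (eact l a).
Implicit Types (f g : {poly F}) (u w : quad) (b : gb).

Lemma quad_add (uA uB uC uD wA wB wC wD : {poly F}) :
  (uA, uB, uC, uD) + (wA, wB, wC, wD) = (uA + wA, uB + wB, uC + wC, uD + wD) :> quad.
Proof. by []. Qed.

Definition vanish_from (n : nat) f := forall j, (n <= j)%N -> f`_j = 0.

Lemma vanish0 n : vanish_from n 0. Proof. by move=> j _; rewrite coef0. Qed.
Lemma vanishD n f g : vanish_from n f -> vanish_from n g -> vanish_from n (f + g).
Proof. by move=> hf hg j hj; rewrite coefD hf // hg // addr0. Qed.
Lemma vanishN n f : vanish_from n f -> vanish_from n (- f).
Proof. by move=> hf j hj; rewrite coefN hf // oppr0. Qed.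
Lemma vanishC n (c : F) f : vanish_from n f -> vanish_from n (c%:P * f).
Proof. by move=> hf j hj; rewrite coefCM hf // mulr0. Qed.
Lemma vanish_der n f : vanish_from n.+1 f -> vanish_from n f^`().
Proof. by move=> hf j hj; rewrite coef_deriv hf // mul0rn. Qed.
Lemma vanishX n f : vanish_from n f -> vanish_from n.+1 ('X * f).
Proof. by move=> hf [|j] hj //; rewrite coefXM /= hf. Qed.
Lemma vanishW n m f : (n <= m)%N -> vanish_from n f -> vanish_from m f.
Proof. by move=> nm hf j hj; apply: hf; apply: leq_trans hj. Qed.

Lemma coef_dp (k : F) f j : (dp k%:P f)`_j = (k - j%:R) * f`_j.
Proof.
rewrite /dp coefB coefCM coefXM; case: j => [|j] /=; first by rewrite !subr0.
by rewrite coef_deriv mulrBl mulr_natl.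
Qed.

Lemma vanish_dp n f : vanish_from n.+1 f -> vanish_from n (dp (n%:R)%:P f).
Proof.
move=> hf j; rewrite leq_eqVlt coef_dp => /orP[/eqP ->|hj]; first by rewrite subrr mul0r.
by rewrite hf // mulr0.
Qed.

Lemma vanish_Xder n f : vanish_from n f -> vanish_from n ('X * f^`()).
Proof.
by move=> hf [|j] hj; rewrite coefXM //= coef_deriv hf // mul0rn.
Qed.

Let ap_C : ap = (1 - be)%:P. Proof. by rewrite polyCB. Qed.
Let np1_C : np - 1 = (a.-1%:R)%:P.
Proof. by rewrite /np -[in LHS](prednK a0) -addn1 natrD polyCD addrK. Qed.
Let bn_C : bp * np = (be * a%:R)%:P. Proof. by rewrite polyCM. Qed.
Let bn1_C : bp * np - 1 = (be * a%:R - 1)%:P. Proof. by rewrite polyCB polyCM. Qed.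

(** The degree bounds cut out the finite-dimensional part of all quadruples; it is stable because
    [dp] in degree d kills the top monomial of degree d. *)
Definition esz u := let: (fA, fB, fC, fD) := u in
  [/\ vanish_from a.+1 fA, vanish_from a fB, vanish_from a fC & vanish_from a.-1 fD].

Lemma esz_act b u : esz u -> esz (eact b u).
Proof.
case: u => [[[fA fB] fC] fD] [hA hB hC hD].
have hB' : vanish_from a.-1.+1 fB by rewrite prednK.
have hC' : vanish_from a.-1.+1 fC by rewrite prednK.
have XB f : vanish_from a.-1 f -> vanish_from a ('X * f).
  by move/vanishX; rewrite prednK.
(* For a = 1 the degree a - 2 is negative, and the fourth component is zero. *)
have XdpD : vanish_from a.-1 ('X * dp (np - 1 - 1) fD).
  case: (a.-1) (np1_C) hD => [|k] e hD.
    suff -> : fD = 0 by rewrite /dp deriv0 !mulr0 subr0 mulr0; apply: vanish0.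
    by apply/polyP => j; rewrite coef0 hD.
  rewrite e -[X in X%:R]addn1 natrD polyCD polyC1 addrK.
  by apply: vanishX; apply: vanish_dp.
have eC (c : F) f : c%:P * 'X * f = c%:P * ('X * f) by rewrite mulrA.
case: b; rewrite /esz /= ?bn1_C ?bn_C ?ap_C ?eC ?np1_C /bp.
- split.
  + by apply: vanishN; apply: vanishC; apply: vanishX.
  + by apply: vanishD; [apply: vanish_dp | apply: vanishC; apply: XB].
  + exact: vanish0.
  + exact: vanish_dp.
- split.
  + by apply: vanish_der; apply: vanishW hA.
  + by apply: vanish_der; apply: vanishW hB.
  + by apply: vanish_der; apply: vanishW hC.
  + by apply: vanish_der; apply: vanishW hD.
- split.
  + by apply: vanishC; apply: vanishW hC.
  + apply: vanishD; first exact: vanish_der.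
    by apply: vanishN; apply: vanishC; apply: vanishW hD; apply: leq_pred.
  + exact: vanish0.
  + exact: vanish_der.
- split.
  + by apply: vanishC; apply: vanishW hB.
  + exact: vanish0.
  + apply: vanishD; first exact: vanish_der.
    by apply: vanishC; apply: vanishW hD; apply: leq_pred.
  + by apply: vanishN; apply: vanish_der.
- split.
  + by apply: vanishX; apply: vanish_dp.
  + by apply: XB; apply: vanish_dp.
  + by apply: XB; apply: vanish_dp.
  + by rewrite -np1_C.
- split.
  + by apply: vanishC; apply: vanishX.
  + exact: vanish0.
  + apply: vanishD; first by apply: vanishC; apply: XB.
    by apply: vanishN; apply: vanish_dp.
  + exact: vanish_dp.
- by split; (apply: vanishD; [apply: vanishC | apply: vanishN; apply: vanish_Xder]).
- rewrite -polyCB; split; (apply: vanishD; [exact: vanishC | rewrite mulr2n; apply: vanishN];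
    by apply: vanishD; apply: vanish_Xder).
Qed.

Definition eidx : finType := ('I_a.+1 + 'I_a + 'I_a + 'I_a.-1)%type.

Lemma card_eidx : #|eidx| = (4 * a)%N.
Proof. by rewrite !card_sum !card_ord; lia. Qed.

Definition eb (i : eidx) : quad :=
  match i with
  | inl (inl (inl j)) => ('X^j, 0, 0, 0)
  | inl (inl (inr j)) => (0, 'X^j, 0, 0)
  | inl (inr j) => (0, 0, 'X^j, 0)
  | inr j => (0, 0, 0, 'X^j)
  end.

Definition eco (i : eidx) u : F :=
  let: (fA, fB, fC, fD) := u in
  match i with
  | inl (inl (inl j)) => fA`_j
  | inl (inl (inr j)) => fB`_j
  | inl (inr j) => fC`_j
  | inr j => fD`_j
  end.

Definition ebsg (i : eidx) : F :=
  match i with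
  | inl (inl (inl j)) => 1 | inl (inl (inr j)) => -1 | inl (inr j) => -1 | inr j => 1
  end.

Lemma eco_lin i (c : F) u w : eco i (c *: u + w) = c * eco i u + eco i w.
Proof.
case: u => [[[uA uB] uC] uD]; case: w => [[[wA wB] wC] wD].
by case: i => [[[j|j]|j]|j] /=; rewrite coefD coefZ.
Qed.

Lemma eco_esg i u : eco i (esg u) = ebsg i * eco i u.
Proof.
case: u => [[[uA uB] uC] uD].
by case: i => [[[j|j]|j]|j] /=; rewrite ?coefN ?mul1r ?mulN1r.
Qed.

Lemma ebsg2 i : ebsg i * ebsg i = 1.
Proof. by case: i => [[[j|j]|j]|j] /=; rewrite ?mulrNN mul1r. Qed.

Lemma esz_eb i : esz (eb i).
Proof.
have h n (j : nat) : (j < n)%N -> vanish_from n 'X^j.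
  by move=> jn k nk; rewrite coefXn; case: eqP => // e; move: nk jn; rewrite e; lia.
by case: i => [[[j|j]|j]|j] /=; split; do ?exact: vanish0; apply: h.
Qed.

Lemma eco_eb i j : eco i (eb j) = (i == j)%:R.
Proof.
by case: i => [[[i|i]|i]|i]; case: j => [[[j|j]|j]|j] //=; rewrite ?coef0 ?coefXn.
Qed.

Lemma poly_vanish n f : vanish_from n f -> f = \sum_(j < n) f`_j *: 'X^j.
Proof.
move=> hf; rewrite -(poly_def n (fun j => f`_j)); apply/polyP => j.
by rewrite coef_poly; case: ltnP => // /hf.
Qed.

Lemma esz_decomp u : esz u -> u = \sum_i eco i u *: eb i.
Proof.
case: u => [[[fA fB] fC] fD] [hA hB hC hD].
rewrite !big_sumType /=.
have e1 : \sum_(j < a.+1) fA`_j *: (('X^j, 0, 0, 0) : quad) = (fA, 0, 0, 0).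
  rewrite {2}(poly_vanish hA); elim/big_rec2: _ => // j u1 u2 _ ->.
  by rewrite quad_scale !mulr0 mul_polyC quad_add !addr0.
have e2 : \sum_(j < a) fB`_j *: ((0, 'X^j, 0, 0) : quad) = (0, fB, 0, 0).
  rewrite {2}(poly_vanish hB); elim/big_rec2: _ => // j u1 u2 _ ->.
  by rewrite quad_scale !mulr0 mul_polyC quad_add !addr0.
have e3 : \sum_(j < a) fC`_j *: ((0, 0, 'X^j, 0) : quad) = (0, 0, fC, 0).
  rewrite {2}(poly_vanish hC); elim/big_rec2: _ => // j u1 u2 _ ->.
  by rewrite quad_scale !mulr0 mul_polyC quad_add !addr0.
have e4 : \sum_(j < a.-1) fD`_j *: ((0, 0, 0, 'X^j) : quad) = (0, 0, 0, fD).
  rewrite {2}(poly_vanish hD); elim/big_rec2: _ => // j u1 u2 _ ->.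
  by rewrite quad_scale !mulr0 mul_polyC quad_add !addr0.
by rewrite e1 e2 e3 e4 !quad_add !addr0 !add0r.
Qed.

Definition ew : quad := (1, 0, 0, 0).

Lemma esz_ew : esz ew.
Proof. by have := esz_eb (inl (inl (inl ord0))); rewrite /= expr0. Qed.

Lemma dpXn (k : F) j : dp k%:P 'X^j = (k - j%:R) *: 'X^j.
Proof.
apply/polyP => i; rewrite coef_dp coefZ coefXn.
by case: eqP => [->|]; rewrite ?mulr0.
Qed.

Lemma eact_Y2_A j : eact Y2 ('X^j, 0, 0, 0) = (a%:R - j%:R) *: (('X^(j.+1), 0, 0, 0) : quad).
Proof.
rewrite /= dpXn /dp deriv0 !mulr0 subr0 !mulr0 quad_scale !mulr0 mul_polyC.
by rewrite -scalerAr -exprS.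
Qed.

Lemma eact_Y2_B j : eact Y2 (0, 'X^j, 0, 0) = (a.-1%:R - j%:R) *: ((0, 'X^(j.+1), 0, 0) : quad).
Proof.
rewrite /= np1_C dpXn /dp deriv0 !mulr0 subr0 !mulr0 quad_scale !mulr0 mul_polyC.
by rewrite -scalerAr -exprS.
Qed.

Lemma eact_Y2_C j : eact Y2 (0, 0, 'X^j, 0) = (a.-1%:R - j%:R) *: ((0, 0, 'X^(j.+1), 0) : quad).
Proof.
rewrite /= np1_C dpXn /dp deriv0 !mulr0 subr0 !mulr0 quad_scale !mulr0 mul_polyC.
by rewrite -scalerAr -exprS.
Qed.

Lemma eact_Y2_D j : (1 < a)%N ->
  eact Y2 (0, 0, 0, 'X^j) = (a.-2%:R - j%:R) *: ((0, 0, 0, 'X^(j.+1)) : quad).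
Proof.
move=> a1; have e : np - 1 - 1 = (a.-2%:R)%:P.
  have e' : (a.-1%:R : F) = a.-2%:R + 1 by rewrite natr1; congr (_%:R); lia.
  by rewrite np1_C e' polyCD polyC1 addrK.
rewrite /= e dpXn /dp deriv0 !mulr0 subr0 !mulr0 quad_scale !mulr0 mul_polyC.
by rewrite -scalerAr -exprS.
Qed.

(** y_2 moves along each of the four strings of monomials with nonzero coefficients. The strings B
    and C start at multiples of x_1 and y_3 applied to the highest weight vector, the string D at
    x_1 applied to the start of C, corrected by an A-vector. *)
Lemma eact_cyclic (Pd : quad -> Prop) :
  (forall c u w, Pd u -> Pd w -> Pd (c *: u + w)) ->
  (forall b u, esz u -> Pd u -> Pd (eact b u)) -> Pd ew -> forall i, Pd (eb i).
Proof.
move=> hlin hact h0.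
have P0 : Pd 0 by rewrite -[0](addNr ew) -scaleN1r; apply: hlin.
have PZ c u : Pd u -> Pd (c *: u) by move=> hu; rewrite -[_ *: _]addr0; apply: hlin.
have PZr c u : c != 0 -> Pd (c *: u) -> Pd u.
  by move=> c0 /(PZ c^-1); rewrite scalerA mulVf // scale1r.
have nz (p q : nat) : (q < p)%N -> (p%:R - q%:R : F) != 0.
  by move=> pq; rewrite -natrB ?(ltnW pq) // (char0_neq0 char0) // subn_gt0.
have hA j : (j <= a)%N -> Pd ('X^j, 0, 0, 0).
  elim: j => [|j IH] hj; first by rewrite expr0.
  apply: (PZr (a%:R - j%:R)); first exact: nz.
  rewrite -eact_Y2_A; apply: hact; last by apply: IH; apply: ltnW.
  by have := esz_eb (inl (inl (inl (Ordinal (ltnW hj : (j < a.+1)%N))))).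
have hB j : (j < a)%N -> Pd (0, 'X^j, 0, 0).
  elim: j => [|j IH] hj.
    apply: (PZr a%:R); first exact: char0_neq0.
    have := hact X1 _ esz_ew h0; congr Pd.
    rewrite /= -[1]/('X^0) dpXn /dp deriv0 !mulr0 subrr subr0 addr0 oppr0 quad_scale !mulr0 mul_polyC.
    done.
  apply: (PZr (a.-1%:R - j%:R)); first by apply: nz; lia.
  rewrite -eact_Y2_B; apply: hact; last by apply: IH; apply: ltnW.
  by have := esz_eb (inl (inl (inr (Ordinal (ltnW hj : (j < a)%N))))).
have hC j : (j < a)%N -> Pd (0, 0, 'X^j, 0).
  elim: j => [|j IH] hj.
    apply: (PZr (- a%:R)); first by rewrite oppr_eq0; exact: char0_neq0.
    have := hact Y3 _ esz_ew h0; congr Pd.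
    rewrite /= -[1]/('X^0) dpXn /dp deriv0 !mulr0 subr0 quad_scale !mulr0 mul_polyC.
    by rewrite subrr sub0r scaleNr.
  apply: (PZr (a.-1%:R - j%:R)); first by apply: nz; lia.
  rewrite -eact_Y2_C; apply: hact; last by apply: IH; apply: ltnW.
  by have := esz_eb (inl (inr (Ordinal (ltnW hj : (j < a)%N)))).
have hD j : (j < a.-1)%N -> Pd (0, 0, 0, 'X^j).
  elim: j => [|j IH] hj.
    apply: (PZr a.-1%:R); first exact: char0_neq0.
    have h1 : esz (0, 0, 'X^0, 0) by have := esz_eb (inl (inr (Ordinal a0))).
    have h2 := hact X1 _ h1 (hC 0%N a0).
    (* This cancels the A-component that x_1 produces, leaving a - 1 times the first D-vector. *)
    have h3 : Pd ((1 - be) *: (('X^1, 0, 0, 0) : quad)) by apply: PZ; apply: hA.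
    have := hlin 1 _ _ h2 h3; congr Pd.
    rewrite scale1r /= np1_C dpXn /dp deriv0 !mulr0 subr0 !quad_scale quad_add !mulr0 !addr0 mul_polyC.
    by rewrite ap_C expr0 mulr1 expr1 -!mul_polyC ?subr0 addNr.
  apply: (PZr (a.-2%:R - j%:R)); first by apply: nz; lia.
  rewrite -eact_Y2_D; last by lia.
  apply: hact; last by apply: IH; apply: ltnW.
  by have := esz_eb (inr (Ordinal (ltnW hj : (j < a.-1)%N))).
case=> [[[j|j]|j]|j]; [apply: hA | exact: hB | exact: hC | exact: hD].
by rewrite -ltnS.
Qed.

Lemma eact_Y2_top : iter a.+1 (eact Y2) ew = 0.
Proof.
have h j : exists c, iter j (eact Y2) ew = c *: (('X^j, 0, 0, 0) : quad).
  elim: j => [|j [c e]]; first by exists 1; rewrite scale1r expr0.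
  exists (c * (a%:R - j%:R)); rewrite iterS e.
  have := eact_lin l a Y2 c ('X^j, 0, 0, 0) 0.
  rewrite addr0 eact_Y2_A scalerA => ->.
  by rewrite [eact Y2 0](_ : _ = 0) ?addr0 //= /dp deriv0 !mulr0 subr0 !mulr0.
have [c e] := h a; rewrite iterS e.
have := eact_lin l a Y2 c ('X^a, 0, 0, 0) 0.
rewrite addr0 eact_Y2_A subrr scale0r scaler0 add0r => ->.
by rewrite /= /dp deriv0 !mulr0 subr0 !mulr0.
Qed.

End EvalBasis.

(** * Fusion products *)

Section Pact.
Variables (F : fieldType) (V : gmod F).

Definition pact b (f : {poly F}) (u : V) : V := \sum_(r < size f) f`_r *: gact V b r u.

Lemma pact_wide b (f : {poly F}) u n : (size f <= n)%N ->
  pact b f u = \sum_(r < n) f`_r *: gact V b r u.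
Proof.
move=> hn; rewrite /pact (big_ord_widen n (fun r => f`_r *: gact V b r u) hn).
rewrite big_mkcond /=; apply: eq_bigr => r _; case: ltnP => // hr.
by rewrite nth_default // scale0r.
Qed.

Lemma pact_lin b (c : F) f g u : pact b (c *: f + g) u = c *: pact b f u + pact b g u.
Proof.
pose n := maxn (size (c *: f + g)) (maxn (size f) (size g)).
rewrite (@pact_wide b (c *: f + g) u n) ?(@pact_wide b f u n) ?(@pact_wide b g u n);
  rewrite /n; do ?lia.
rewrite scaler_sumr -big_split; apply: eq_bigr => r _ /=.
by rewrite coefD coefZ scalerDl scalerA.
Qed.

Lemma pact_Xn b r u : pact b 'X^r u = gact V b r u.
Proof.
rewrite /pact size_polyXn big_ord_recr /= coefXn eqxx scale1r big1 ?add0r // => i _.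
by rewrite coefXn; case: eqP => [e|_]; [have := ltn_ord i; lia | rewrite scale0r].
Qed.

End Pact.

(** The properties carried along while tensoring evaluation modules at the points [zs]. [f_kill]
    separates the points when cyclicity is proved. [f_rel] is an ungraded form of the relations: as
    P has constant term 1, only its leading term survives in the associated graded module. One P has
    to serve all r <= R for the induction over the factors. *)
Record fusion (F : fieldType) (l : F) (xi : seq nat) (zs : seq F) := Fusion {
  fV : vectType F;
  f_act : gb -> nat -> fV -> fV;
  f_lin : forall a r (k : F) (u w : fV), f_act a r (k *: u + w) = k *: f_act a r u + f_act a r w;
  f_br : forall a b r s (u : fV),
      f_act a r (f_act b s u) - ssign F a b *: f_act b s (f_act a r u)
      = gactM f_act (sbr F a b) (r + s) u;
  f_sg : fV -> fV;
  f_sg_lin : forall (k : F) (u w : fV), f_sg (k *: u + w) = k *: f_sg u + f_sg w;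
  f_sgK : forall u, f_sg (f_sg u) = u;
  f_sg_act : forall b r u, f_sg (f_act b r u) = (if godd b then -1 else 1) *: f_act b r (f_sg u);
  f_t : fV;
  f_nplus : forall r, [/\ f_act Y1 r f_t = 0, f_act X2 r f_t = 0 & f_act X3 r f_t = 0];
  f_cartan : forall h r, cartan h -> exists c, f_act h r f_t = c *: f_t;
  f_H1 : f_act H1 0 f_t = l *: f_t;
  f_H2 : f_act H2 0 f_t = (sumn xi)%:R *: f_t;
  f_cyc : forall P : fV -> Prop, subsp P -> (forall b r u, P u -> P (f_act b r u)) -> P f_t ->
      forall u, P u;
  f_kill : forall b f (u : GMod f_lin f_br), pact b ((\prod_(z <- zs) ('X - z%:P)) * f) u = 0;
  f_dim : dim fV = Ddim xi;
  f_rel : forall R, exists P : {poly F}, P`_0 = 1 /\ forall r, (r <= R)%N ->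
      forall s, (Gmin xi R < r + s)%N ->
      \sum_(j < s.+1) P`_j *: Yp (f_t : GMod f_lin f_br) r (s - j)%N = 0
}.

Lemma fusion_nil (F : fieldType) : fusion (0 : F) [::] [::].
Proof.
pose act (b : gb) (r : nat) (u : 'rV[F]_1) : 'rV[F]_1 := 0.
have hlin a r (k : F) (u w : 'rV[F]_1) : act a r (k *: u + w) = k *: act a r u + act a r w.
  by rewrite /act scaler0 addr0.
have hbr a b r s (u : 'rV[F]_1) : act a r (act b s u) - ssign F a b *: act b s (act a r u)
    = gactM act (sbr F a b) (r + s) u.
  by rewrite /act scaler0 subr0 /gactM big1 // => c _; rewrite scaler0.
apply: (@Fusion F 0 [::] [::] _ act hlin hbr id _ _ _ (const_mx 1)) => //.
- by move=> b r u; rewrite /act scaler0.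
- by move=> h r _; exists 0; rewrite scale0r.
- by rewrite scale0r.
- by rewrite scale0r.
- move=> P hP _ h1 u; rewrite (_ : u = u 0 0 *: const_mx 1); first exact: subspZ.
  by apply/rowP => i; rewrite !mxE ord1 mulr1.
- by move=> b f u; rewrite /pact big1 // => r _; rewrite scaler0.
- by rewrite dim_matrix Ddim_nil.
move=> R; exists 1; split; first by rewrite coef1.
move=> r _ s; rewrite Gmin_nil => hrs; rewrite big1 // => j _.
rewrite coef1; case: eqP => [->|_]; last by rewrite scale0r.
rewrite subn0 scale1r; case: r hrs => [|r] hrs; first by rewrite Yp0; case: eqP hrs => // ->.
by rewrite YpS big1.
Qed.

(** * Tensoring with an evaluation module at a new point *)

Section Tensor.
Variables (F : fieldType) (char0 : forall k, k.+1%:R != 0 :> F).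
Variables (l : F) (xi : seq nat) (zs : seq F) (fu : fusion l xi zs).
Variables (l' : F) (a : nat) (a0 : (0 < a)%N) (z : F) (hz : z \notin zs).

Local Notation T := (fV fu).
Let M : gmod F := GMod (@f_lin F l xi zs fu) (@f_br F l xi zs fu).
Let act : gb -> nat -> T -> T := @f_act F l xi zs fu.
Let sg : T -> T := @f_sg F l xi zs fu.
Local Notation I := (eidx a).
Local Notation ea := (eact l' a).

Let actM b r u : act b r u = gact M b r u. Proof. by []. Qed.

Definition sgp (b : gb) (v : T) : T := if godd b then sg v else v.

Let sg0 : sg 0 = 0.
Proof. by have := @f_sg_lin F l xi zs fu (-1) 0 0; rewrite scaler0 addr0 scaleN1r addNr. Qed.
Let sgD u w : sg (u + w) = sg u + sg w.
Proof. by have := @f_sg_lin F l xi zs fu 1 u w; rewrite !scale1r. Qed.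
Let sgZ c u : sg (c *: u) = c *: sg u.
Proof. by have := @f_sg_lin F l xi zs fu c u 0; rewrite -/sg sg0 !addr0. Qed.
Let sgpD b u w : sgp b (u + w) = sgp b u + sgp b w.
Proof. by rewrite /sgp; case: ifP. Qed.
Let sgpZ b c u : sgp b (c *: u) = c *: sgp b u.
Proof. by rewrite /sgp; case: ifP. Qed.
Let sgp0 b : sgp b 0 = 0.
Proof. by rewrite /sgp; case: ifP. Qed.
Let sgK u : sg (sg u) = u. Proof. exact: (@f_sgK F l xi zs fu). Qed.
Let sg_act b r u : sg (act b r u) = (if godd b then -1 else 1) *: act b r (sg u).
Proof. exact: (@f_sg_act F l xi zs fu). Qed.
Let sgpK b u : sgp b (sgp b u) = u.
Proof. by rewrite /sgp; case: (godd b) => //; apply: (@f_sgK F l xi zs fu). Qed.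
Let sgp_sum b (J : finType) (f : J -> T) : sgp b (\sum_j f j) = \sum_j sgp b (f j).
Proof. exact: (big_morph _ (sgpD b) (sgp0 b)). Qed.

Let ssign2 b c : ssign F b c * ssign F b c = 1.
Proof. by rewrite /ssign; case: ifP; rewrite ?mulrNN mul1r. Qed.

Let sgp_act b c r u : sgp b (act c r u) = ssign F b c *: act c r (sgp b u).
Proof.
rewrite /sgp /ssign; case: (godd b) => /=; last by rewrite scale1r.
exact: (@f_sg_act F l xi zs fu).
Qed.

Let B b (i j : I) : F := eco i (ea b (eb F j)).

Let eco_sum (i : I) (f : I -> quad F) : eco i (\sum_j f j) = \sum_j eco i (f j).
Proof.
apply: big_morph; last by case: i => [[[j|j]|j]|j] /=; rewrite coef0.
by move=> u w; have := eco_lin i 1 u w; rewrite scale1r mul1r.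
Qed.

Let ecoZ (i : I) (c : F) u : eco i (c *: u) = c * eco i u.
Proof.
have := eco_lin i c u 0; rewrite addr0 => ->.
by rewrite (_ : eco i 0 = 0) ?addr0 //; case: i => [[[j|j]|j]|j] /=; rewrite coef0.
Qed.

Let ea0 b : ea b 0 = 0.
Proof. by have := eact_lin l' a b (-1) 0 0; rewrite scaler0 addr0 scaleN1r addNr. Qed.

Let eaD b u w : ea b (u + w) = ea b u + ea b w.
Proof. by have := eact_lin l' a b 1 u w; rewrite !scale1r. Qed.

Let eaZ b (c : F) u : ea b (c *: u) = c *: ea b u.
Proof. by have := eact_lin l' a b c u 0; rewrite ea0 !addr0. Qed.

Let Bsum b (i : I) u : esz a u -> eco i (ea b u) = \sum_j B b i j * eco j u.
Proof.
move=> hu; rewrite {1}(esz_decomp hu) (big_morph _ (eaD b) (ea0 b)) eco_sum.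
by apply: eq_bigr => j _; rewrite eaZ ecoZ mulrC.
Qed.

Let Bbr b c (i k : I) : \sum_j B b i j * B c j k - ssign F b c * \sum_j B c i j * B b j k
  = \sum_(p <- lie_table b c) p.1%:~R * B p.2 i k.
Proof.
have := eact_br l' a b c (eb F k) => /(congr1 (eco i)).
have hz' d := esz_act l' a0 d (esz_eb F a0 k).
rewrite -scaleNr addrC eco_lin mulNr (Bsum _ _ (hz' _)) (Bsum _ _ (hz' _)) addrC => ->.
elim: (lie_table b c) => [|p L IH]; first by rewrite !big_nil; case: i => [[[j|j]|j]|j] /=; rewrite coef0.
by rewrite !big_cons eco_lin IH.
Qed.

Let Bsg b (i j : I) : ebsg F i * B b i j = (if godd b then -1 else 1) * (ebsg F j * B b i j).
Proof.
have := esg_act l' a b (eb F j) => /(congr1 (eco i)); rewrite eco_esg ecoZ => ->.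
have -> : esg (eb F j) = ebsg F j *: eb F j.
  by case: j => [[[j|j]|j]|j] /=; rewrite quad_scale ?polyC1 ?rmorphN1 ?mulN1r ?mul1r ?oppr0.
by rewrite eaZ ecoZ.
Qed.

(** The tensor product, as families of vectors indexed by the basis [eb] of the second factor. *)
Definition tT : vectType F := {ffun I -> T}.

Definition tact (b : gb) (r : nat) (f : tT) : tT :=
  [ffun i => act b r (f i) + \sum_j (z ^+ r * B b i j) *: sgp b (f j)].

Lemma tact_lin b r (k : F) (u w : tT) : tact b r (k *: u + w) = k *: tact b r u + tact b r w.
Proof.
apply/ffunP => i; rewrite !ffunE scalerDr addrACA -(@f_lin F l xi zs fu) scaler_sumr -big_split.
congr (act b r _ + _).
apply: eq_bigr => j _; rewrite !ffunE sgpD sgpZ scalerDr !scalerA.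
by congr (_ *: _ + _); rewrite mulrC.
Qed.

Lemma tact_br b c r s (u : tT) :
  tact b r (tact c s u) - ssign F b c *: tact c s (tact b r u) = gactM tact (sbr F b c) (r + s) u.
Proof.
have sumE (W : lmodType F) (D : finType) (L : seq (int * gb)) (h : int * gb -> {ffun D -> W}) i :
    (\sum_(p <- L) h p) i = \sum_(p <- L) h p i.
  by elim/big_rec2: _ => [|p y1 y2 _ <-]; rewrite !ffunE.
rewrite gactM_table; apply/ffunP => i; rewrite sumE.
have E d e p q : (tact d p (tact e q u)) i = act d p (act e q (u i))
    + \sum_j (z ^+ q * B e i j) *: act d p (sgp e (u j))
    + (\sum_j (z ^+ p * B d i j) *: sgp d (act e q (u j))
    + \sum_k (z ^+ (p + q) * \sum_j B d i j * B e j k) *: sgp d (sgp e (u k))).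
  rewrite !ffunE; congr (_ + _).
    rewrite actM gactD gact_sum; congr (_ + _); apply: eq_bigr => j _.
    by rewrite gactZ.
  under eq_bigr => j _ do rewrite !ffunE sgpD scalerDr.
  rewrite big_split /=; congr (_ + _).
  under eq_bigr => j _ do rewrite sgp_sum scaler_sumr.
  rewrite exchange_big /=; apply: eq_bigr => k _.
  rewrite mulr_sumr scaler_suml; apply: eq_bigr => j _.
  by rewrite sgpZ scalerA; congr (_ *: _); rewrite exprD; ring.
have sgpC (v : T) : sgp b (sgp c v) = sgp c (sgp b v).
  by rewrite /sgp; case: (godd b); case: (godd c).
have ffunBZ (f g : tT) (k : F) : (f - k *: g) i = f i - k *: g i by rewrite !ffunE.
rewrite ffunBZ !E !scalerDr.
have sC : ssign F c b = ssign F b c by rewrite /ssign andbC.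
have -> : ssign F b c *: \sum_j (z ^+ r * B b i j) *: act c s (sgp b (u j)) =
    \sum_j (z ^+ r * B b i j) *: sgp b (act c s (u j)).
  rewrite scaler_sumr; apply: eq_bigr => j _.
  by rewrite sgp_act !scalerA mulrC.
have -> : ssign F b c *: \sum_j (z ^+ s * B c i j) *: sgp c (act b r (u j)) =
    \sum_j (z ^+ s * B c i j) *: act b r (sgp c (u j)).
  rewrite scaler_sumr; apply: eq_bigr => j _.
  rewrite sgp_act sC !scalerA; congr (_ *: _).
  by rewrite -[RHS]mul1r -(ssign2 b c); ring.
(* P and R are the mixed terms, one operator on each factor; after the Koszul signs are moved they
   occur identically on both sides and cancel. *)
have rearr (A1 P R Q A2 Q' : T) : A1 + P + (R + Q) - (A2 + R + (P + Q')) = (A1 - A2) + (Q - Q').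
  have -> : A1 + P + (R + Q) = (A1 + Q) + (P + R) by rewrite [R + Q]addrC addrACA.
  have -> : A2 + R + (P + Q') = (A2 + Q') + (P + R) by rewrite [P + Q']addrC addrACA [P + R]addrC.
  by rewrite opprD addrACA subrr addr0 opprD addrACA.
rewrite rearr.
have -> : act b r (act c s (u i)) - ssign F b c *: act c s (act b r (u i)) =
    \sum_(p <- lie_table b c) p.1%:~R *: act p.2 (r + s) (u i).
  by rewrite (@f_br F l xi zs fu) gactM_table.
have -> : \sum_k (z ^+ (r + s) * \sum_j B b i j * B c j k) *: sgp b (sgp c (u k)) -
    ssign F b c *: (\sum_k (z ^+ (s + r) * \sum_j B c i j * B b j k) *: sgp c (sgp b (u k))) =
    \sum_k (z ^+ (r + s) * \sum_(p <- lie_table b c) p.1%:~R * B p.2 i k) *: sgp b (sgp c (u k)).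
  rewrite scaler_sumr -sumrB; apply: eq_bigr => k _.
  by rewrite -sgpC scalerA -scalerBl -Bbr addnC; congr (_ *: _); ring.
under [X in _ + X]eq_bigr => k _ do rewrite mulr_sumr scaler_suml.
rewrite [X in _ + X]exchange_big -big_split /= big_seq [RHS]big_seq; apply: eq_bigr => p hp.
rewrite !ffunE scalerDr; congr (_ + _); rewrite scaler_sumr; apply: eq_bigr => k _.
rewrite scalerA mulrCA; congr (_ *: _).
(* Brackets add parities, so the sign operator of a bracket is the product of those of b and c. *)
have : all (fun p : int * gb => godd p.2 == (godd b (+) godd c)) (lie_table b c).
  by case: (b); case: (c).
move/allP => /(_ p hp) /eqP; rewrite /sgp => ->.
by case: (godd b); case: (godd c) => //=; rewrite sgK.
Qed.

Definition tens (v : T) (u : quad F) : tT := [ffun i => eco i u *: v].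

Let M' : gmod F := GMod tact_lin tact_br.

Lemma tact_tens b r v u : esz a u ->
  tact b r (tens v u) = tens (act b r v) u + z ^+ r *: tens (sgp b v) (ea b u).
Proof.
move=> hu; apply/ffunP => i; rewrite !ffunE actM gactZ; congr (_ + _).
rewrite (Bsum b i hu) scaler_suml scaler_sumr; apply: eq_bigr => j _.
by rewrite !ffunE sgpZ !scalerA mulrA.
Qed.

Definition tsg (f : tT) : tT := [ffun i => ebsg F i *: sg (f i)].

Lemma tens_lin v (c : F) u w : tens v (c *: u + w) = c *: tens v u + tens v w.
Proof. by apply/ffunP => i; rewrite !ffunE eco_lin scalerDl scalerA. Qed.

Lemma tens_linl u (c : F) v w : tens (c *: v + w) u = c *: tens v u + tens w u.
Proof. by apply/ffunP => i; rewrite !ffunE scalerDr !scalerA mulrC. Qed.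

Lemma tens0 u : tens 0 u = 0.
Proof. by apply/ffunP => i; rewrite !ffunE scaler0. Qed.

Lemma tensr0 v : tens v 0 = 0.
Proof.
have := tens_lin v (-1) 0 0; rewrite scaler0 addr0 scaleN1r addNr //.
Qed.

Lemma tensZr v c u : tens v (c *: u) = c *: tens v u.
Proof. by have := tens_lin v c u 0; rewrite tensr0 !addr0. Qed.

Lemma tensZl v c u : tens (c *: v) u = c *: tens v u.
Proof. by have := tens_linl u c v 0; rewrite tens0 !addr0. Qed.

Let tsumE (D : finType) (h : D -> tT) (i : I) : (\sum_r h r : tT) i = \sum_r h r i.
Proof. by elim/big_rec2: _ => [|j y1 y2 _ <-]; rewrite !ffunE. Qed.

Lemma tens_decomp (f : tT) : f = \sum_i tens (f i) (eb F i).
Proof.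
apply/ffunP => i; rewrite tsumE (bigD1 i) //= big1.
  by rewrite !ffunE eco_eb eqxx scale1r addr0.
by move=> j /negPf hj; rewrite ffunE eco_eb eq_sym hj scale0r.
Qed.

Lemma tpact b f (w : tT) (i : I) :
  pact (V := M') b f w i = pact (V := M) b f (w i) + \sum_j (f.[z] * B b i j) *: sgp b (w j).
Proof.
rewrite /pact tsumE (eq_bigr (fun r : 'I_(size f) => f`_r *: act b r (w i) +
    \sum_j (f`_r * z ^+ r * B b i j) *: sgp b (w j))); last first.
  move=> r _; rewrite !ffunE scalerDr scaler_sumr; congr (_ + _).
  by apply: eq_bigr => j _; rewrite scalerA mulrA.
rewrite big_split /=; congr (_ + _); rewrite exchange_big /=; apply: eq_bigr => j _.
by rewrite -scaler_suml -mulr_suml -horner_coef.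
Qed.

Lemma tpact_tens b f v u : esz a u ->
  pact (V := M') b f (tens v u) = tens (pact (V := M) b f v) u + f.[z] *: tens (sgp b v) (ea b u).
Proof.
move=> hu; apply/ffunP => i; rewrite tpact !ffunE; congr (_ + _).
  by rewrite /pact scaler_sumr; apply: eq_bigr => r _; rewrite gactZ !scalerA mulrC.
rewrite (Bsum b i hu) scaler_suml scaler_sumr; apply: eq_bigr => j _.
by rewrite !ffunE sgpZ !scalerA mulrA.
Qed.

Definition tt : tT := tens (@f_t F l xi zs fu) (ew F).

Let g := \prod_(z <- zs) ('X - z%:P) : {poly F}.

Let gz : g.[z] != 0.
Proof.
rewrite /g horner_prod prodf_seq_neq0; apply/allP => y hy /=.
by rewrite hornerXsubC subr_eq0; apply: contraNneq hz => ->.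
Qed.

Let kill b (c : F) v : pact (V := M) b (c *: g) v = 0.
Proof. by have := @f_kill F l xi zs fu b c%:P v; rewrite -/g mulrC mul_polyC. Qed.

(** Chinese remainder argument. With [g] the product of t - y over the old points, g(z) is nonzero:
    a polynomial congruent to t^r modulo [g] and vanishing at z acts on the first factor alone, and
    g / g(z) acts on the second alone. *)
Lemma tcyc (P : tT -> Prop) : subsp P -> (forall b r u, P u -> P (tact b r u)) -> P tt ->
  forall u, P u.
Proof.
move=> hP hact h0.
have hpact b f u : P u -> P (pact (V := M') b f u).
  by move=> hu; apply: subsp_sum => // r _; apply: subspZ => //; apply: hact.
have sz := esz_ew F a0.
have h1 v : P (tens v (ew F)).
  apply: (@f_cyc F l xi zs fu (fun v => P (tens v (ew F)))) => //.
    split; first by rewrite tens0; case: hP.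
    by move=> c u w hu hw; rewrite tens_linl; case: hP => _; apply.
  move=> b r u hu.
  pose f : {poly F} := (- (z ^+ r / g.[z])) *: g + 'X^r.
  have := hpact b f _ hu; rewrite (tpact_tens _ _ _ sz).
  have -> : f.[z] = 0 by rewrite /f hornerD hornerZ hornerXn mulNr divfK ?addNr.
  rewrite scale0r addr0 /f -[X in X + _]scale1r pact_lin pact_Xn.
  by rewrite scale1r kill add0r.
have h2 (i : I) : forall v, P (tens v (eb F i)).
  apply: (eact_cyclic char0 a0 (l := l') (Pd := fun u => forall v, P (tens v u))) => //.
    by move=> c u w hu hw v; rewrite tens_lin; case: hP => _; apply.
  move=> b u su hu v.
  have := hpact b (g.[z]^-1 *: g) _ (hu (sgp b v)); rewrite (tpact_tens _ _ _ su).
  by rewrite kill tens0 add0r hornerZ mulVf // scale1r sgpK.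
by move=> u; rewrite (tens_decomp u); apply: subsp_sum.
Qed.

Lemma tkill b f u : pact (V := M') b ((\prod_(y <- z :: zs) ('X - y%:P)) * f) u = 0.
Proof.
apply/ffunP => i; rewrite tpact big_cons [RHS]ffunE.
have -> : ('X - z%:P) * g * f = g * (('X - z%:P) * f) by rewrite -mulrA mulrCA.
rewrite (@f_kill F l xi zs fu b (('X - z%:P) * f) (u i)) add0r.
rewrite big1 // => j _; rewrite !hornerM hornerXsubC subrr mul0r mulr0 mul0r.
exact: scale0r.
Qed.

Lemma tsg_lin (k : F) (u w : tT) : tsg (k *: u + w) = k *: tsg u + tsg w.
Proof.
apply/ffunP => i; rewrite !ffunE sgD sgZ scalerDr !scalerA.
by rewrite [ebsg F i * k]mulrC.
Qed.

Lemma tsgK u : tsg (tsg u) = u.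
Proof. by apply/ffunP => i; rewrite !ffunE sgZ scalerA ebsg2 scale1r sgK. Qed.

Lemma tsg_act b r u : tsg (tact b r u) = (if godd b then -1 else 1) *: tact b r (tsg u).
Proof.
apply/ffunP => i; rewrite !ffunE sgD !scalerDr; congr (_ + _).
  by rewrite sg_act scalerA [act b r (_ *: _)]actM gactZ scalerA mulrC.
rewrite (big_morph sg sgD sg0) !scaler_sumr; apply: eq_bigr => j _.
rewrite sgZ !ffunE sgpZ !scalerA.
have -> : sgp b (sg (u j)) = sg (sgp b (u j)) by rewrite /sgp; case: (godd b).
congr (_ *: _); rewrite mulrCA Bsg.
move: (if godd b then -1 else 1) => e; ring.
Qed.

Let sz : esz a (ew F) := esz_ew F a0.

Lemma tnplus r : [/\ tact Y1 r tt = 0, tact X2 r tt = 0 & tact X3 r tt = 0].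
Proof.
have [h1 h2 h3] := @f_nplus F l xi zs fu r.
have d1 : (1 : {poly F})^`() = 0 by rewrite -[1]/(1%:P) derivC.
split; rewrite /tt tact_tens // /act ?h1 ?h2 ?h3 tens0 add0r [ea _ _](_ : _ = 0) ?tensr0 ?scaler0 //=;
  by rewrite ?d1 ?deriv0 ?mulr0 ?oppr0 ?addr0 ?subr0.
Qed.

Let eaH1 : ea H1 (ew F) = l' *: ew F.
Proof.
have d1 : (1 : {poly F})^`() = 0 by rewrite -[1]/(1%:P) derivC.
rewrite /= d1 deriv0 !mulr0 subr0 quad_scale !mulr0 mulr1 -polyCM /be divfK ?(char0_neq0 char0) //.
by rewrite !subr0 mulr1.
Qed.

Let eaH2 : ea H2 (ew F) = a%:R *: ew F.
Proof.
have d1 : (1 : {poly F})^`() = 0 by rewrite -[1]/(1%:P) derivC.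
by rewrite /= d1 deriv0 !mulr0 mul0rn !subr0 quad_scale !mulr0 !mulr1.
Qed.

Lemma tcartan h r : cartan h -> exists c, tact h r tt = c *: tt.
Proof.
move=> hh; have [c hc] := @f_cartan F l xi zs fu h r hh.
have [d hd] : exists d, ea h (ew F) = d *: ew F.
  by case: h hh {hc} => // _; [exists l' | exists a%:R].
exists (c + z ^+ r * d); rewrite /tt tact_tens // /act hc hd.
have -> : sgp h (@f_t F l xi zs fu) = @f_t F l xi zs fu by case: h hh {hc hd}.
by rewrite tensZl tensZr scalerA -scalerDl.
Qed.

Lemma tH1 : tact H1 0 tt = (l + l') *: tt.
Proof.
rewrite /tt tact_tens // /act (@f_H1 F l xi zs fu) eaH1 tensZl tensZr expr0 scale1r.
by rewrite -scalerDl.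
Qed.

Lemma tH2 : tact H2 0 tt = (sumn (a :: xi))%:R *: tt.
Proof.
rewrite /tt tact_tens // /act (@f_H2 F l xi zs fu) eaH2 tensZl tensZr expr0 scale1r.
by rewrite -scalerDl natrD addrC.
Qed.

Let scal (c : nat -> F) (p : nat) (u : M') : M' := c p *: u.
Let scal_lin c : fam_lin (scal c).
Proof. by split=> *; rewrite /scal ?scalerDr ?scaler0. Qed.

(** Operators on power series in u with coefficients in the tensor product: [Yo], [geo], [pm P] and
    [m1] multiply by y(u), 1/(1 - z u), P(u) and 1 - z u. *)
Let Yo : (nat -> M') -> nat -> M' := cv (gact M' Y2).
Let geo : (nat -> M') -> nat -> M' := cv (scal (fun p => z ^+ p)).
Let pm (P : {poly F}) : (nat -> M') -> nat -> M' := cv (scal (fun p => P`_p)).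
Let m1 (g : nat -> M') (s : nat) : M' := g s - (if s is s'.+1 then z *: g s' else 0).

Let Yo_geo f : Yo (geo f) = geo (Yo f).
Proof.
apply: functional_extensionality => s; apply: cv_comm; [exact: fam_lin_act | exact: scal_lin |].
by move=> p q u; rewrite /scal gactZ.
Qed.

Let pm_geo P f : pm P (geo f) = geo (pm P f).
Proof.
apply: functional_extensionality => s; apply: cv_comm; do ?exact: scal_lin.
by move=> p q u; rewrite /scal !scalerA mulrC.
Qed.

Let cvD (A : nat -> M' -> M') (f h : nat -> M') : fam_lin A ->
  cv A (fun s => f s + h s) = fun s => cv A f s + cv A h s.
Proof.
move=> [hA _]; apply: functional_extensionality => s.
by rewrite /cv -big_split; apply: eq_bigr => p _; rewrite hA.
Qed.

Let m1_geo f : m1 (geo f) = f.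
Proof.
apply: functional_extensionality => s; rewrite /m1 {1}/geo /cv big_ord_recl /scal expr0 scale1r subn0.
case: s => [|s]; first by rewrite big_ord0 addr0 subr0.
rewrite /geo /cv scaler_sumr -addrA -sumrB big1 ?addr0 // => p _.
by rewrite /scal scalerA -exprS subrr.
Qed.

Let m1D f h : m1 (fun s => f s + h s) = fun s => m1 f s + m1 h s.
Proof.
apply: functional_extensionality => -[|s]; rewrite /m1 ?subr0 //.
by rewrite scalerDr opprD addrACA.
Qed.

Let pm_m1 P f : pm ((1 - z *: 'X) * P) f = m1 (pm P f).
Proof.
apply: functional_extensionality => s; rewrite /m1 /pm /cv.
have E j : ((1 - z *: 'X) * P)`_j = P`_j - (if j is j'.+1 then z * P`_j' else 0).
  by rewrite mulrBl mul1r -scalerAl coefB coefZ coefXM; case: j => [|j] //=; rewrite mulr0.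
rewrite (eq_bigr (fun p : 'I_s.+1 => scal (fun p => P`_p) p (f (s - p)%N) -
   scal (fun p => if p is p'.+1 then z * P`_p' else 0) p (f (s - p)%N))); last first.
  by move=> p _; rewrite /scal E scalerBl.
rewrite sumrB; congr (_ - _); case: s => [|s].
  by rewrite big_ord1 /scal scale0r.
rewrite big_ord_recl /scal scale0r add0r scaler_sumr; apply: eq_bigr => p _.
by rewrite scalerA.
Qed.

Let e_ (i : nat) : quad F := iter i (ea Y2) (ew F).
Let sz_e i : esz a (e_ i).
Proof. by elim: i => //= i; apply: esz_act. Qed.

Let Z r rho i : nat -> M' :=
  iter r Yo (fun s => tens (Yp (@f_t F l xi zs fu : M) rho s) (e_ i)).

Let iter_geo r f : iter r Yo (geo f) = geo (iter r Yo f).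
Proof. by elim: r => //= r ->; rewrite Yo_geo. Qed.

Let iter_YoD r f h : iter r Yo (fun s => f s + h s) = fun s => iter r Yo f s + iter r Yo h s.
Proof. by elim: r => //= r ->; rewrite /Yo cvD //; exact: fam_lin_act. Qed.

Let tens_sum u (J : finType) (f : J -> T) : tens (\sum_j f j) u = \sum_j tens (f j) u.
Proof.
apply: (big_morph (fun v => tens v u)); last exact: tens0.
by move=> v w; have := tens_linl u 1 v w; rewrite !scale1r.
Qed.

(** On the tensor product y(u) acts as y(u) on the first factor plus 1/(1 - z u) times y_2 on the
    second. *)
Let Z_rec r rho i : Z r.+1 rho i = fun s => Z r rho.+1 i s + geo (Z r rho i.+1) s.
Proof.
rewrite /Z iterSr -iter_geo -iter_YoD; congr (iter r Yo _).
apply: functional_extensionality => s.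
rewrite {1}/Yo /cv YpS tens_sum /geo /cv -big_split; apply: eq_bigr => p _ /=.
by rewrite tact_tens.
Qed.

Let iter_m1D b f h : iter b m1 (fun s => f s + h s) = fun s => iter b m1 f s + iter b m1 h s.
Proof. by elim: b => //= b ->; rewrite m1D. Qed.

Let m1_bound b G rho f : (forall s, (G < s + rho)%N -> f s = 0) ->
  forall s, (G + b < s + rho)%N -> iter b m1 f s = 0.
Proof.
move=> hf; elim: b => [|b IH] s; first by rewrite addn0; apply: hf.
move=> hs; rewrite iterS /m1 IH; last by lia.
case: s hs => [|s] hs; first by rewrite subr0.
by rewrite IH ?scaler0 ?subr0 //; lia.
Qed.

(** Each use of y_2 on the second factor costs one factor 1/(1 - z u), and after i uses at most
    min(r, a - i) more are possible because y_2^(a+1) kills the highest weight vector. So b factors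
    1 - z u clear all of them, and each raises the degree by at most one. *)
Let Z_bound R (P : {poly F}) : (forall r, (r <= R)%N -> forall s, (Gmin xi R < r + s)%N ->
      \sum_(j < s.+1) P`_j *: Yp (@f_t F l xi zs fu : M) r (s - j)%N = 0) ->
  forall r rho i b, (rho + r <= R)%N -> (i <= a)%N -> (minn r (a - i) <= b)%N ->
  forall s, (Gmin xi R + b < s + (r + rho))%N -> iter b m1 (pm P (Z r rho i)) s = 0.
Proof.
move=> hP; elim=> [|r IH] rho i b hR hi hb s hs.
  apply: (m1_bound (G := Gmin xi R) (rho := rho)) => // s' hs'.
  rewrite -(tens0 (e_ i)) -(hP rho _ s'); [| by rewrite addn0 in hR | by rewrite addnC].
  rewrite tens_sum; apply: eq_bigr => j _.
  by rewrite /scal tensZl.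
rewrite Z_rec {1}/pm cvD; last exact: scal_lin.
rewrite iter_m1D (IH rho.+1 i b) //; [| by rewrite addSnnS | | by rewrite addnS -addSn]; last first.
  by apply: leq_trans hb; rewrite leq_min geq_minr andbT (leq_trans (geq_minl _ _)).
rewrite add0r -/(pm P _) pm_geo.
move: hi; rewrite leq_eqVlt => /orP[/eqP ei|hi].
  have -> : Z r rho i.+1 = fun=> 0.
    rewrite /Z; have -> : e_ i.+1 = 0 by rewrite /e_ ei; exact: eact_Y2_top.
    elim: (r) => [|k IHk] /=; first by apply: functional_extensionality => s'; rewrite tensr0.
    rewrite IHk; apply: functional_extensionality => s'; rewrite /Yo /cv big1 // => p _.
    exact: gact0.
  have z0 A : fam_lin A -> cv A (fun=> 0 : M') = fun=> 0.
    by case=> _ A0; apply: functional_extensionality => s'; rewrite /cv big1.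
  rewrite /pm z0 ?/geo ?z0; do ?exact: scal_lin.
  elim: (b) (s) => [|k IHk] s' //=; rewrite /m1 IHk; case: s' => [|s']; rewrite ?subr0 //.
  by rewrite IHk scaler0 subr0.
case: b hb hs => [|b] hb hs; first by move: hb; lia.
rewrite iterSr m1_geo; apply: (IH rho i.+1 b) => //; lia.
Qed.

Lemma trel R : exists P : {poly F}, P`_0 = 1 /\ forall r, (r <= R)%N ->
  forall s, (Gmin (a :: xi) R < r + s)%N ->
  \sum_(j < s.+1) P`_j *: Yp (tt : M') r (s - j)%N = 0.
Proof.
have [P [P0 hP]] := @f_rel F l xi zs fu R.
pose b := minn R a.
(* The exponent b = min(R, a) is what the new part a contributes to [Gmin]. *)
exists ((1 - z *: 'X) ^+ b * P); split.
  rewrite coef0M P0 mulr1; elim: (b) => [|k IH]; first by rewrite expr0 coef1.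
  by rewrite exprS coef0M IH coefB coef1 coefZ coefX mulr0 subr0 mulr1.
move=> r hr s; rewrite Gmin_cons => hs.
have -> : \sum_(j < s.+1) ((1 - z *: 'X) ^+ b * P)`_j *: Yp (tt : M') r (s - j)%N =
    iter b m1 (pm P (Z r 0 0)) s.
  have eY : Yp (tt : M') r = Z r 0 0.
    rewrite /Yp /Z; congr (iter r Yo _); apply: functional_extensionality => s'.
    by rewrite Yp0 /delta_seq; case: eqP => // _; rewrite tens0.
  rewrite eY -[LHS]/(pm ((1 - z *: 'X) ^+ b * P) (Z r 0 0) s).
  elim: (b) (s) => [|k IH] s'; first by rewrite expr0 mul1r.
  rewrite exprS -mulrA pm_m1 iterS.
  by congr (m1 _ s'); apply: functional_extensionality.
apply: (Z_bound hP) => //; rewrite ?subn0 ?addn0 //.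
  by rewrite /b leq_min geq_minr andbT (leq_trans (geq_minl _ _)).
by move: hs; rewrite /b; lia.
Qed.

Lemma tdim : dim tT = Ddim (a :: xi).
Proof.
rewrite Ddim_cons a0 -(@f_dim F l xi zs fu) -(card_eidx a0).
by [].
Qed.

Definition fusion_cons : fusion (l + l') (a :: xi) (z :: zs) :=
  @Fusion F (l + l') (a :: xi) (z :: zs) tT tact tact_lin tact_br tsg tsg_lin tsgK tsg_act tt
    tnplus tcartan tH1 tH2 tcyc tkill tdim trel.

End Tensor.

(** * The associated graded module *)

Section SubspaceOfPred.
Variables (F : fieldType) (T : vectType F) (P : T -> Prop).
Hypothesis hP : subsp P.

(** Enlarging a subspace inside [P] while possible must stop, by dimension; deciding whether it is
    possible uses excluded middle. *)
Lemma vspace_of_subsp : exists U : {vspace T}, forall u, u \in U <-> P u.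
Proof.
suff H d : forall U : {vspace T}, (forall u, u \in U -> P u) -> (dim T - \dim U <= d)%N ->
    exists U : {vspace T}, forall u, u \in U <-> P u.
  apply: (H (dim T) 0%VS); last exact: leq_subr.
  by move=> u; rewrite memv0 => /eqP ->; case: hP.
elim: d => [|d IH] U hU hd.
  exists U => u; split; first exact: hU.
  have -> : U = fullv.
    by apply/eqP; rewrite eqEdim subvf dimvf; move: hd; rewrite leqn0 subn_eq0.
  by rewrite memvf.
case: (excluded_middle_informative (exists u, P u /\ u \notin U)) => [[u [pu nu]]|h].
  apply: (IH (U + <[u]>)%VS).
    move=> w /memv_addP[v hv [w' /vlineP[k ->] ->]].
    by apply: subspD => //; [apply: hU | apply: subspZ].
  have ne : U != (U + <[u]>)%VS.
    apply: contraNneq nu => ->; apply: (subvP (addvSr _ _)); exact: memv_line.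
  have := dimv_leqif_eq (addvSl U <[u]>) => /ltn_leqif; rewrite ne.
  lia.
exists U => u; split; first exact: hU.
move=> pu; case hu : (u \in U) => //; case: h; exists u; rewrite hu; by split.
Qed.
End SubspaceOfPred.

Section AssociatedGraded.
Variables (F : fieldType) (char0 : forall k, k.+1%:R != 0 :> F).
Variables (l : F) (xi : seq nat) (zs : seq F) (fu : fusion l xi zs).

Local Notation T := (fV fu).
Let M : gmod F := GMod (@f_lin F l xi zs fu) (@f_br F l xi zs fu).
Let t : T := @f_t F l xi zs fu.
Let act (b : gb) (r : nat) (u : T) : T := gact M b r u.

(* The filtration of the fusion module by t-degree of the words applied to [t]. *)
Inductive fil : nat -> T -> Prop :=
  | fil_gen : fil 0 t
  | fil_0 k : fil k 0
  | fil_lin k c u w : fil k u -> fil k w -> fil k (c *: u + w)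
  | fil_act k b r u : fil k u -> fil (k + r) (act b r u)
  | fil_S k u : fil k u -> fil k.+1 u.

Lemma fil_subsp k : subsp (fil k).
Proof. by split; [exact: fil_0 | move=> c u w; exact: fil_lin]. Qed.

Lemma fil_mono j k u : (j <= k)%N -> fil j u -> fil k u.
Proof. by move=> /subnK <- h; elim: (k - j)%N => // n IH; apply: fil_S. Qed.

Lemma fil_exhaust u : exists k, fil k u.
Proof.
apply: (@f_cyc F l xi zs fu (fun u => exists k, fil k u)).
- split; first by exists 0%N; apply: fil_0.
  move=> c v w [j hj] [k hk]; exists (maxn j k); apply: fil_lin.
    by apply: fil_mono hj; apply: leq_maxl.
  by apply: fil_mono hk; apply: leq_maxr.
- by move=> b r v [k hk]; exists (k + r)%N; apply: fil_act.
- by exists 0%N; apply: fil_gen.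
Qed.

Lemma fil_bounded : exists N, forall u, fil N u.
Proof.
have h (L : seq T) : exists N, forall u, u \in L -> fil N u.
  elim: L => [|v L [N hN]]; first by exists 0%N.
  have [k hk] := fil_exhaust v; exists (maxn k N) => u; rewrite inE => /orP[/eqP ->|/hN hu].
    by apply: fil_mono hk; apply: leq_maxl.
  by apply: fil_mono hu; apply: leq_maxr.
have [N hN] := h (vbasis (fullv : {vspace T})); exists N => u.
rewrite (coord_vbasis (memvf u)); apply: subsp_sum => [|i _]; first exact: fil_subsp.
apply: subspZ; first exact: fil_subsp.
apply: hN; apply: mem_nth; by rewrite size_tuple.
Qed.

Lemma filV_exists : exists Fl : nat -> {vspace T}, forall k u, u \in Fl k <-> fil k u.
Proof.
exists (fun k => proj1_sig (constructive_indefinite_description _ (vspace_of_subsp (fil_subsp k)))).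
by move=> k; case: (constructive_indefinite_description _ _).
Qed.

Section WithProj.
Variables (Fl : nat -> {vspace T}) (hFl : forall k u, u \in Fl k <-> fil k u).
Variables (N : nat) (hN : forall u, fil N u).

(* [trunc k] is the projection onto [Fl k] composed from the projections of the chain. *)
Fixpoint trunc_from (d : nat) (u : T) : T :=
  if d is d'.+1 then projv (Fl (N - d)) (trunc_from d' u) else u.
Definition trunc k u := trunc_from (N - k) u.
Definition grp (k : nat) (u : T) : T := trunc k u - (if k is k'.+1 then trunc k' u else 0).

Lemma trunc_from_lin d c u w : trunc_from d (c *: u + w) = c *: trunc_from d u + trunc_from d w.
Proof. by elim: d => //= d ->; rewrite linearP. Qed.

Lemma trunc_from_fil d u : fil (N - d) (trunc_from d u).
Proof.
case: d => [|d] /=; first by rewrite subn0; apply: hN.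
by apply/hFl; apply: memv_proj.
Qed.

Lemma trunc_from_id d k u : (k <= N - d)%N -> fil k u -> trunc_from d u = u.
Proof.
elim: d => //= d IH hk hu; rewrite IH //; last by lia.
by apply: projv_id; apply/hFl; apply: fil_mono hu.
Qed.

Lemma trunc_fil k u : fil k (trunc k u).
Proof.
rewrite /trunc; have [kN|Nk] := leqP k N.
  by have := trunc_from_fil (N - k) u; rewrite subKn.
by apply: (fil_mono (ltnW Nk)).
Qed.

Lemma trunc_id k u : fil k u -> trunc k u = u.
Proof.
move=> hu; rewrite /trunc; have [kN|Nk] := leqP k N.
  by apply: (trunc_from_id (k := k)) => //; rewrite subKn.
by rewrite (eqP (ltnW Nk : N - k == 0)%N).
Qed.

Lemma trunc_lin k c u w : trunc k (c *: u + w) = c *: trunc k u + trunc k w.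
Proof. exact: trunc_from_lin. Qed.

Lemma trunc_from_le d e u : (d <= e)%N -> trunc_from e (trunc_from d u) = trunc_from e u.
Proof.
move=> /subnK <-; elim: (e - d)%N => [|k IH] /=; last by rewrite IH.
apply: (trunc_from_id (k := (N - d)%N)) => //; exact: trunc_from_fil.
Qed.

(** The reason for composing projections: projections onto the steps of a filtration along unrelated
    complements need not be compatible. *)
Lemma trunc_le j k u : (k <= j)%N -> trunc k (trunc j u) = trunc k u.
Proof. by move=> kj; apply: trunc_from_le; lia. Qed.

Lemma grp_lin k c u w : grp k (c *: u + w) = c *: grp k u + grp k w.
Proof.
rewrite /grp trunc_lin; case: k => [|k]; first by rewrite !subr0.
by rewrite trunc_lin opprD addrACA scalerBr.
Qed.

Lemma grp0 k : grp k 0 = 0.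
Proof. by have := grp_lin k (-1) 0 0; rewrite scaler0 addr0 scaleN1r addNr. Qed.
Lemma grpD k u w : grp k (u + w) = grp k u + grp k w.
Proof. by have := grp_lin k 1 u w; rewrite !scale1r. Qed.
Lemma grpZ k c u : grp k (c *: u) = c *: grp k u.
Proof. by have := grp_lin k c u 0; rewrite grp0 !addr0. Qed.
Lemma grpB k u w : grp k (u - w) = grp k u - grp k w.
Proof. by rewrite grpD -scaleN1r grpZ scaleN1r. Qed.
Lemma grp_sum k (J : Type) (L : seq J) (f : J -> T) :
  grp k (\sum_(j <- L) f j) = \sum_(j <- L) grp k (f j).
Proof. exact: (big_morph _ (grpD k) (grp0 k)). Qed.

Lemma grp_fil k u : fil k (grp k u).
Proof.
apply: subspB; [exact: fil_subsp | exact: trunc_fil |].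
case: k => [|k]; first exact: fil_0.
by apply: fil_S; apply: trunc_fil.
Qed.

Lemma grp_big k j u : fil j u -> (j < k)%N -> grp k u = 0.
Proof.
move=> hu; case: k => // k jk; rewrite /grp !trunc_id ?subrr //.
  by apply: fil_mono hu.
by apply: fil_mono hu; apply: ltnW.
Qed.

Lemma grp_sum_trunc k u : \sum_(j < k.+1) grp j u = trunc k u.
Proof.
elim: k => [|k IH]; first by rewrite big_ord1 /grp subr0.
by rewrite big_ord_recr /= IH /grp addrC subrK.
Qed.

Lemma grp_grp j k u : grp j (grp k u) = if j == k then grp k u else 0.
Proof.
have tg i : trunc i (grp k u) = if (k <= i)%N then grp k u else 0.
  case: leqP => [ki|ik]; first by apply: trunc_id; apply: fil_mono ki _; apply: grp_fil.
  rewrite /grp; case: k ik => // k ik.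
  have := trunc_lin i (-1) (trunc k u) (trunc k.+1 u).
  rewrite scaleN1r addrC => ->; rewrite !trunc_le ?(ltnW ik) //.
  by rewrite scaleN1r addNr.
rewrite {1}/grp tg; case: j => [|j]; first by rewrite subr0 leqn0 eq_sym.
rewrite tg; case: (ltngtP k j.+1) => h /=.
- by rewrite -ltnS h subrr.
- by rewrite leqNgt (ltnW h) subr0.
- by rewrite -ltnS h ltnn subr0.
Qed.

Lemma grp_total u : u = \sum_(k < N.+1) grp k u.
Proof. by rewrite grp_sum_trunc trunc_id. Qed.

(** The splitting [grp] identifies the associated graded space with [T] itself; of the action on
    degree k only the component in degree k + r is kept. *)
Definition gract (b : gb) (r : nat) (u : T) : T := \sum_(k < N.+1) grp (k + r) (act b r (grp k u)).

(** Replacing u by its top component changes it by an element of lower filtration degree, whose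
    image has no component in degree k + r. *)
Lemma gract_grp b r k u : fil k u -> gract b r (grp k u) = grp (k + r) (act b r u).
Proof.
move=> hu; have actB v w : act b r (v - w) = act b r v - act b r w by exact: (@gactB F M b r v w).
have act0 : act b r 0 = 0 by exact: (@gact0 F M b r).
have e : grp (k + r) (act b r (grp k u)) = grp (k + r) (act b r u).
  rewrite /grp -/(grp (k + r) _) -/(grp (k + r) (act b r u)) trunc_id //.
  rewrite actB grpB; case: k hu => [|k] hu; first by rewrite act0 grp0 subr0.
  rewrite (@grp_big (k.+1 + r) (k + r) (act b r (trunc k u))) ?subr0 //.
  by apply: fil_act; apply: trunc_fil.
have [kN|Nk] := leqP k N; last first.
  have -> : grp k u = 0 by apply: (grp_big (hN u)).
  rewrite -e (grp_big (hN u) Nk) act0 grp0 /gract big1 // => i _.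
  by rewrite grp0 act0 grp0.
rewrite /gract (bigD1 (Ordinal (kN : (k < N.+1)%N))) //= grp_grp eqxx e big1 ?addr0 //.
by move=> i; rewrite -val_eqE /= => /negPf hi; rewrite grp_grp hi act0 grp0.
Qed.

Lemma gract_lin a r (k : F) (u w : T) : gract a r (k *: u + w) = k *: gract a r u + gract a r w.
Proof.
rewrite /gract scaler_sumr -big_split; apply: eq_bigr => i _ /=.
by rewrite grp_lin [act _ _ _](gact_lin (g := M)) grp_lin.
Qed.

Lemma gract_sum b r (J : Type) (L : seq J) (f : J -> T) :
  gract b r (\sum_(j <- L) f j) = \sum_(j <- L) gract b r (f j).
Proof.
apply: big_morph.
  by move=> u w; have := gract_lin b r 1 u w; rewrite !scale1r.
by have := gract_lin b r (-1) 0 0; rewrite scaler0 addr0 scaleN1r addNr.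
Qed.

Lemma gract_br a b r s (u : T) : gract a r (gract b s u) - ssign F a b *: gract b s (gract a r u)
  = gactM gract (sbr F a b) (r + s) u.
Proof.
have E c d p q k : gract c p (gract d q (grp k u)) = grp (k + q + p) (act c p (act d q (grp k u))).
  rewrite -{1}(_ : grp k (grp k u) = grp k u); last by rewrite grp_grp eqxx.
  rewrite (gract_grp d q (grp_fil k u)) gract_grp //.
  by apply: fil_act; apply: grp_fil.
have g0 c p : gract c p 0 = 0.
  by have := gract_lin c p (-1) 0 0; rewrite scaler0 addr0 scaleN1r addNr.
have gZ c p (k : F) v : gract c p (k *: v) = k *: gract c p v.
  by have := gract_lin c p k v 0; rewrite g0 !addr0.
have E2 c d p q v : gract c p (gract d q v) = \sum_(k < N.+1) gract c p (gract d q (grp k v)).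
  by rewrite {1}(grp_total v) (gract_sum d q) (gract_sum c p).
rewrite gactM_table !E2 scaler_sumr -sumrB.
rewrite (eq_bigr (fun p : int * gb => \sum_(k < N.+1) p.1%:~R *: gract p.2 (r + s) (grp k u)));
  last by move=> p _; rewrite {1}(grp_total u) gract_sum scaler_sumr.
rewrite exchange_big /=; apply: eq_bigr => k _; rewrite !E.
rewrite -!addnA [(s + r)%N]addnC -grpZ -grpB.
have -> : act a r (act b s (grp k u)) - ssign F a b *: act b s (act a r (grp k u)) =
    \sum_(p <- lie_table a b) p.1%:~R *: act p.2 (r + s) (grp k u).
  by rewrite -(gactM_table act); exact: (@f_br F l xi zs fu).
rewrite grp_sum; apply: eq_bigr => p _; rewrite grpZ; congr (_ *: _).
have := gract_grp p.2 (r + s) (grp_fil k u).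
by rewrite grp_grp eqxx => ->.
Qed.

Definition Gr : gmod F := GMod gract_lin gract_br.

Let t0 : grp 0 t = t.
Proof. by rewrite /grp subr0; apply: trunc_id; apply: fil_gen. Qed.

Lemma gract_t b r : gract b r t = grp r (act b r t).
Proof. by have := gract_grp b r fil_gen; rewrite t0. Qed.

Lemma Gr_Yp r s : Yp (t : Gr) r s = grp s (Yp (t : M) r s) /\ fil s (Yp (t : M) r s).
Proof.
elim: r s => [|r IH] s.
  rewrite !Yp0; case: eqP => [->|_]; first by rewrite t0; split=> //; apply: fil_gen.
  by rewrite grp0; split=> //; apply: fil_0.
split.
  rewrite !YpS grp_sum; apply: eq_bigr => p _.
  have [e h] := IH (s - p)%N; rewrite e [LHS](gract_grp Y2 p h) subnK //.
  by rewrite -ltnS.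
rewrite YpS; apply: subsp_sum => [|p _]; first exact: fil_subsp.
have [_ h] := IH (s - p)%N; have := fil_act Y2 p h; rewrite subnK //.
by rewrite -ltnS.
Qed.

Lemma Gr_cvS : cvS l xi (fun u => u = 0) (t : Gr).
Proof.
(* For r > 0 the current h t^r multiplies t by a scalar that may be nonzero, but its component in
   degree r is zero. *)
have hcart h c0 : cartan h -> act h 0 t = c0 *: t ->
    forall r, gract h r t - (if r == 0%N then c0 else 0) *: t = 0.
  move=> hh h0 [|r] /=; first by rewrite gract_t h0 grpZ t0 subrr.
  rewrite scale0r subr0 gract_t.
  have [c hc] := @f_cartan F l xi zs fu h r.+1 hh.
  rewrite /act /= hc grpZ (@grp_big r.+1 0) ?scaler0 //; exact: fil_gen.
split; first split.
- move=> r; have [h1 h2 h3] := @f_nplus F l xi zs fu r.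
  by split; rewrite /= gract_t /act /= ?h1 ?h2 ?h3 grp0.
- apply: hcart => //; exact: (@f_H1 F l xi zs fu).
- apply: hcart => //; exact: (@f_H2 F l xi zs fu).
move=> r s hrs; have [-> _] := Gr_Yp r s.
(* Taking R = r makes the bound exactly [Gmin xi r]; the terms j > 0 lie in filtration degree s - j,
   so they have no component in degree s. *)
have [P [P0 hP]] := @f_rel F l xi zs fu r.
have := hP r (leqnn r) s hrs; rewrite big_ord_recl P0 scale1r subn0 => /eqP.
rewrite addr_eq0 => /eqP ->; rewrite -scaleN1r grpZ grp_sum big1 ?scaler0 // => j _.
rewrite grpZ (@grp_big s (s - j.+1)) ?scaler0 //; first by have [_ h] := Gr_Yp r (s - j.+1)%N.
by case: s {hrs} j => [[]|s j] //; rewrite subSS ltnS leq_subr.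
Qed.

Lemma Gr_cyclic (u : Gr) : gen_sub (t : Gr) u.
Proof.
move=> S hS ht.
have h k v : fil k v -> S (grp k v).
  elim=> {k v} [|k|k c v w _ h1 _ h2|k b r v hv h1|k v hv _].
  - by rewrite t0.
  - by rewrite grp0; apply: (subm0 hS).
  - by rewrite grp_lin; apply: (submZD hS).
  - by rewrite -(gract_grp b r hv); apply: (subm_act hS b r h1).
  - by rewrite (grp_big hv) //; apply: (subm0 hS).
rewrite (grp_total u); apply: (subm_sum hS) => k _.
by have := h k _ (grp_fil k u); rewrite grp_grp eqxx.
Qed.

End WithProj.

Lemma graded_model : exists (W : gmod F) (w : W),
  [/\ cvS l xi (fun u => u = 0) w, forall u, gen_sub w u &
      indep_ge (fun _ : W => True) (fun u => u = 0) (Ddim xi)].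
Proof.
have [Fl hFl] := filV_exists; have [N hN] := fil_bounded.
exists (Gr hFl hN), t; split; [exact: Gr_cvS | exact: Gr_cyclic |].
exists (vbasis (fullv : {vspace T})); split=> //.
  by rewrite size_tuple dimvf (@f_dim F l xi zs fu).
move=> c hc i hi.
have fr : free (vbasis (fullv : {vspace T})) by apply: (basis_free (vbasisP _)).
have sz : size (vbasis (fullv : {vspace T})) = \dim (fullv : {vspace T}) by rewrite size_tuple.
rewrite sz in hi.
move/freeP: fr => /(_ (fun k => c k) _ (Ordinal hi)); apply.
by rewrite -(lcomb_ord _ sz).
Qed.

End AssociatedGraded.

(** * Isomorphisms from equality of dimensions *)

Section LowerBound.
Variables (F : fieldType) (char0 : forall k, k.+1%:R != 0 :> F).

Fixpoint points (n : nat) : seq F := if n is n'.+1 then n'%:R :: points n' else [::].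

Lemma mem_points n z : z \in points n -> exists2 k, (k < n)%N & z = k%:R.
Proof.
elim: n => //= n IH; rewrite inE => /orP[/eqP ->|/IH [k kn ->]]; first by exists n.
by exists k => //; apply: ltnW.
Qed.

Lemma points_fresh n : n%:R \notin points n.
Proof.
apply/negP => /mem_points [k kn /eqP]; rewrite -subr_eq0 -natrB ?(ltnW kn) //.
by apply/negP; apply: (char0_neq0 char0); rewrite subn_gt0.
Qed.

Lemma fusion_list xi : all (fun x => 0 < x)%N xi -> inhabited (fusion (0 : F) xi (points (size xi))).
Proof.
elim: xi => [|a xi IH] /=; first by move=> _; constructor; exact: fusion_nil.
case/andP=> a0 /IH [fu]; constructor; rewrite -[0]addr0.
exact: (fusion_cons char0 fu 0 a0 (points_fresh _)).
Qed.

(** All of lambda_1 is put into one factor and the others get 0, so at least one part is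
    required. *)
Lemma fusion_inhabited l xi : xi != [::] -> all (fun x => 0 < x)%N xi ->
  exists zs, inhabited (fusion (l : F) xi zs).
Proof.
case: xi => // a xi _ /= /andP[a0 /fusion_list [fu]].
exists ((size xi)%:R :: points (size xi)); constructor; rewrite -[l]add0r.
exact: (fusion_cons char0 fu l a0 (points_fresh _)).
Qed.

Definition nz (xi : seq nat) := [seq x <- xi | (0 < x)%N].

Lemma Ddim_nz xi : Ddim (nz xi) = Ddim xi.
Proof. by rewrite /Ddim big_filter_cond; apply: eq_bigl => x; rewrite andbb. Qed.

Lemma sumn_nz xi : sumn (nz xi) = sumn xi.
Proof. by elim: xi => //= x xi IH; case: x => [|x] /=; rewrite IH. Qed.

Lemma Gmin_nz xi r : Gmin (nz xi) r = Gmin xi r.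
Proof.
elim: xi => //= x xi IH; rewrite Gmin_cons -IH.
by case: x => [|x] /=; rewrite ?minn0 // Gmin_cons.
Qed.

Lemma cvS_nz (V : gmod F) l xi (S : V -> Prop) m : cvS l (nz xi) S m -> cvS l xi S m.
Proof.
by move=> [h1 h2]; split; [rewrite -sumn_nz | move=> r s; rewrite -Gmin_nz; apply: h2].
Qed.

(** Universality maps V onto the graded model, and preimages of independent vectors are independent.
    Zero parts are dropped first, as evaluation modules need a > 0. *)
Lemma isCV_indep (V : gmod F) (pi : nat -> V -> V) (v : V) l xi : has (fun x => 0 < x)%N xi ->
  isCV (l, xi) pi v -> indep_ge (fun _ : V => True) (fun u => u = 0) (Ddim xi).
Proof.
move=> hxi [_ _ _ _ huniv].
have ne : nz xi != [::] by rewrite -has_filter.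
have hall : all (fun x => 0 < x)%N (nz xi) by apply: filter_all.
have [zs [fu]] := fusion_inhabited l ne hall.
have [W [w [hw hgen [L [sL _ fL]]]]] := graded_model fu.
have [f [[flin fact] fv]] := huniv W w (cvS_cvrel char0 (cvS_nz hw)).
have f0 : f 0 = 0.
  by have := flin (-1) 0 0; rewrite scaler0 addr0 scaleN1r addNr.
have surj u' : exists u, f u = u'.
  apply: (hgen u' (fun u' => exists u, f u = u')); last by exists v.
  split; first by exists 0.
    by move=> c _ _ [u1 <-] [u2 <-]; exists (c *: u1 + u2).
  by move=> a r _ [u <-]; exists (gact V a r u).
have [g hg] : exists g : W -> V, forall u', f (g u') = u'.
  exists (fun u' => proj1_sig (constructive_indefinite_description _ (surj u'))).
  by move=> u'; case: (constructive_indefinite_description _ _).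
exists (map g L); split=> //; first by rewrite size_map sL Ddim_nz.
move=> c hc i; rewrite size_map; apply: fL.
have flc (L' : seq V) : f (lcomb c L') = lcomb c (map f L').
  rewrite /lcomb size_map !big_nat.
  have fD x y : f (x + y) = f x + f y by have := flin 1 x y; rewrite !scale1r.
  rewrite (big_morph _ fD f0); apply: eq_bigr => j /andP[_ hj].
  rewrite (nth_map 0) //; have := flin (c j) L'`_j 0; rewrite !addr0 => ->.
  by rewrite f0 addr0.
have := flc (map g L); rewrite hc f0 -map_comp => e; rewrite {1}e.
by congr lcomb; rewrite -[LHS]map_id; apply: eq_map => u' /=; rewrite hg.
Qed.

End LowerBound.

(** * Layers as graphs in a direct sum *)

Section ProductModule.
Variables (F : fieldType) (V W : gmod F).

Definition pact2 (b : gb) (r : nat) (p : V * W) : V * W := (gact V b r p.1, gact W b r p.2).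

Lemma pact2_lin a r (k : F) (u w : (V * W)%type) :
  pact2 a r (k *: u + w) = k *: pact2 a r u + pact2 a r w.
Proof. by rewrite /pact2 /= !gact_lin. Qed.

Lemma pact2_br a b r s (u : (V * W)%type) : pact2 a r (pact2 b s u) - ssign F a b *: pact2 b s (pact2 a r u)
  = gactM pact2 (sbr F a b) (r + s) u.
Proof.
have -> : gactM pact2 (sbr F a b) (r + s) u =
    (gactM (gact V) (sbr F a b) (r + s) u.1, gactM (gact W) (sbr F a b) (r + s) u.2).
  rewrite /gactM; elim: gbs => [|c L IH]; first by rewrite !big_nil.
  by rewrite !big_cons IH.
by rewrite -!gact_br.
Qed.

Definition prodmod : gmod F := GMod pact2_lin pact2_br.

Lemma Yp_prod (m : V) (w : W) r s : Yp ((m, w) : prodmod) r s = (Yp m r s, Yp w r s).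
Proof.
elim: r s => [|r IH] s; first by rewrite !Yp0; case: eqP.
rewrite !YpS; under eq_bigr => p _ do rewrite IH.
by elim/big_rec3: _ => // p y1 y2 y3 _ ->.
Qed.

Definition first_in (B : V -> Prop) (p : prodmod) : Prop := B p.1 /\ p.2 = 0.

Lemma first_in_sub B : is_submodule B -> is_submodule (first_in B).
Proof.
move=> hB; split; first by split=> //; apply: (subm0 hB).
  by move=> c u w [h1 h2] [h3 h4]; split=> /=; [apply: (submZD hB) | rewrite h2 h4 scaler0 addr0].
by move=> a r u [h1 h2]; split=> /=; [apply: (subm_act hB) | rewrite h2 gact0].
Qed.

Lemma cvS_prod l xi B (m : V) (w : W) : cvS l xi B m -> cvS l xi (fun u => u = 0) w ->
  cvS l xi (first_in B) ((m, w) : prodmod).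
Proof.
move=> [[a1 a2 a3] a4] [[b1 b2 b3] b4]; split; first split.
- by move=> r; case: (a1 r) => ? ? ?; case: (b1 r) => ? ? ?; split; split.
- by move=> r; split; [apply: a2 | apply: b2].
- by move=> r; split; [apply: a3 | apply: b3].
- by move=> r s h; rewrite Yp_prod; split; [apply: a4 | apply: b4].
Qed.

Lemma lcomb_prod c (L : seq prodmod) : lcomb c L = (lcomb c (map fst L), lcomb c (map snd L)) :> (V * W)%type.
Proof.
rewrite /lcomb !size_map !big_nat.
have E j : (j < size L)%N -> c j *: L`_j = (c j *: (map fst L)`_j, c j *: (map snd L)`_j) :> (V * W)%type.
  by move=> hj; rewrite !(nth_map 0) //; case: (L`_j).
elim/big_rec3: _ => // j y1 y2 y3 /andP[_ hj] ->.
by rewrite E.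
Qed.

End ProductModule.

Section PieceIso.
Variables (F : fieldType) (char0 : forall k, k.+1%:R != 0 :> F).
Variables (V : gmod F) (pi : nat -> V -> V) (hpi : is_grading pi).
Variables (A B : V -> Prop) (hA : is_submodule A) (hB : is_graded_submodule pi B).
Variables (l : F) (xi : seq nat) (k0 : V) (s : nat).
Hypotheses (hgood : good xi) (hs : sorted geq xi) (hcv : cvS l xi B k0).
Hypotheses (hgen : forall u, A u <-> genS B k0 u) (hdeg : pi s k0 = k0).
Hypothesis (hind : indep_ge A B (Ddim xi)).
Variables (W : gmod F) (piW : nat -> W -> W) (w : W) (hW : isCV (l, xi) piW w).

Let hB' : is_submodule B := proj1 hB.
Let zeroW : is_submodule (fun u : W => u = 0) := zero_subm W.
Let S := first_in (W := W) B.
Let hS : is_submodule S := first_in_sub W hB'.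
Let G := genS S ((k0, w) : prodmod V W).
Let hG : is_submodule G := genS_sub _ _.

Let xi0 : xi != [::].
Proof. by case: xi hgood => //; rewrite /good /= andbF. Qed.

Let hasxi : has (fun z => 0 < z)%N xi.
Proof. by case/andP: hgood. Qed.

Let hw : cvS l xi (fun u => u = 0) w.
Proof. by case: hW => _ _ _ h _; apply: cvrel_cvS. Qed.

Let indW : indep_ge (fun _ : W => True) (fun u => u = 0) (Ddim xi).
Proof. exact: isCV_indep hW. Qed.

Let SG p : S p -> G p. Proof. exact: genS_incl. Qed.

Let BA u : B u -> A u. Proof. by move=> hu; apply/hgen; apply: genS_incl. Qed.

Let G_A p : G p -> A p.1.
Proof.
apply: (genS_le (T := fun q : prodmod V W => A q.1)) => /=.
- by split=> [|c u v|a r u] /=; [apply: (subm0 hA) | apply: (submZD hA) | apply: (subm_act hA)].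
- by move=> v [/BA].
- by apply/hgen; apply: genS_gen.
Qed.

Let A_G u : A u -> exists w', G (u, w').
Proof.
move/hgen; apply: (genS_le (T := fun u => exists w', G (u, w'))).
- split; first by exists 0; apply: (subm0 hG).
    by move=> c u1 u2 [w1 h1] [w2 h2]; exists (c *: w1 + w2); apply: (submZD hG c h1 h2).
  by move=> a r u1 [w1 h1]; exists (gact W a r w1); apply: (subm_act hG a r h1).
- by move=> v hv; exists 0; apply: SG.
- by exists w; apply: genS_gen.
Qed.

Let W_G w' : exists u, G (u, w').
Proof.
case: hW => _ _ hg _ _; apply: (hg w' (fun w' => exists u, G (u, w'))).
  split; first by exists 0; apply: (subm0 hG).
    by move=> c u1 u2 [w1 h1] [w2 h2]; exists (c *: w1 + w2); apply: (submZD hG c h1 h2).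
  by move=> a r u1 [w1 h1]; exists (gact V a r w1); apply: (subm_act hG a r h1).
by exists k0; apply: genS_gen.
Qed.

(* [G] and both its projections, to [A / B] and to [W], have the same dimension modulo [S],
   [B] and [0], so [G] is the graph of an isomorphism [A / B -> W]. *)
Let graph_inj : (forall u, G (u, 0) -> B u) /\ (forall u w', B u -> G (u, w') -> w' = 0).
Proof.
have [L [sL mL spL]] := upper_bound char0 hgood hS (cvS_prod hcv hw).
have f2 : free_mod (fun u : W => u = 0) (map snd L).
  apply: (span_free (subm_subsp zeroW) (N := Ddim xi) (A := fun _ => True)) indW.
    by rewrite size_map sL.
  move=> w' _; have [u hu] := W_G w'; have [c [_ hc]] := spL _ hu.
  by exists c; move: hc; rewrite lcomb_prod.
have f1 : free_mod B (map fst L).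
  apply: (span_free (subm_subsp hB') (N := Ddim xi) (A := A)) hind.
    by rewrite size_map sL.
  move=> u /A_G [w' hu]; have [c [hc _]] := spL _ hu.
  by exists c; move: hc; rewrite lcomb_prod.
split=> [u /spL [c []]|u w' hu /spL [c []]]; rewrite lcomb_prod /= => h1 h2.
  have c0 i : (i < size L)%N -> c i = 0.
    move=> hi; apply: f2; last by rewrite size_map.
    by move/eqP: h2; rewrite sub0r oppr_eq0 => /eqP.
  suff e : lcomb c (map fst L) = 0 by move: h1; rewrite e subr0.
  by rewrite /lcomb big_nat big1 // => i /andP[_]; rewrite size_map => /c0 ->; rewrite scale0r.
have c0 i : (i < size L)%N -> c i = 0.
  move=> hi; apply: f1; last by rewrite size_map.
  by apply: (subsp_subr (subm_subsp hB') h1).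
move/eqP: h2; rewrite subr_eq0 => /eqP ->.
by rewrite /lcomb big_nat big1 // => i /andP[_]; rewrite size_map => /c0 ->; rewrite scale0r.
Qed.

Let pi_lin k c u v : pi k (c *: u + v) = c *: pi k u + pi k v.
Proof. by case: hpi => h _ _ _. Qed.
Let pi_pi i j u : pi i (pi j u) = if i == j then pi i u else 0.
Proof. by case: hpi => _ h _ _. Qed.
Let pi_act a r k u : gact V a r (pi k u) = pi (k + r)%N (gact V a r u).
Proof. by case: hpi => _ _ _ h. Qed.
Let hpiW : is_grading piW. Proof. by case: hW. Qed.
Let piW_lin k c u v : piW k (c *: u + v) = c *: piW k u + piW k v.
Proof. by case: hpiW => h _ _ _. Qed.
Let piW_pi i j u : piW i (piW j u) = if i == j then piW i u else 0.
Proof. by case: hpiW => _ h _ _. Qed.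
Let piW_act a r k u : gact W a r (piW k u) = piW (k + r)%N (gact W a r u).
Proof. by case: hpiW => _ _ _ h. Qed.
Let piW0 k : piW k 0 = 0.
Proof. by have := piW_lin k (-1) 0 0; rewrite scaler0 addr0 scaleN1r addNr. Qed.
Let pi0 k : pi k 0 = 0.
Proof. by have := pi_lin k (-1) 0 0; rewrite scaler0 addr0 scaleN1r addNr. Qed.

Let piW_low a r k u : (k < r)%N -> piW k (gact W a r u) = 0.
Proof.
move=> kr; case: hpiW => _ _ h _; have [N ->] := h u.
rewrite gact_sum (big_morph _ (_ : {morph piW k : x y / x + y}) (piW0 k)); last first.
  by move=> x y; have := piW_lin k 1 x y; rewrite !scale1r.
rewrite big1 // => j _; rewrite piW_act piW_pi.
by case: eqP => // e; move: kr; rewrite e; lia.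
Qed.

(** G is a graded submodule of the sum of V and tau_s W, since (k0, w) is homogeneous of degree s
    there; degrees below s, where tau_s W vanishes, form the second clause. *)
Let graph_graded p : G p -> (forall k, G (pi (k + s)%N p.1, piW k p.2)) /\
  (forall k, (k < s)%N -> G (pi k p.1, 0)).
Proof.
have PG q : G (q.1, q.2) -> G q by case: q.
suff : G p -> G p /\ ((forall k, G (pi (k + s) p.1, piW k p.2)) /\
  (forall k, (k < s)%N -> G (pi k p.1, 0))) by move=> h /h [].
pose T (q : prodmod V W) := G q /\ ((forall k, G (pi (k + s) q.1, piW k q.2)) /\
  (forall k, (k < s)%N -> G (pi k q.1, 0))).
apply: (genS_le (T := T)).
- split.
  + split; first exact: (subm0 hG).
    by split=> [k|k _] /=; rewrite pi0 ?piW0; apply: (subm0 hG).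
  + move=> c u v [g1 [h1 h2]] [g2 [h3 h4]]; split; first exact: (submZD hG).
    split=> [k|k ks] /=; rewrite pi_lin ?piW_lin; first exact: (submZD hG c (h1 k) (h3 k)).
    by have := submZD hG c (h2 k ks) (h4 k ks); congr G; congr pair; rewrite /= scaler0 addr0.
  + move=> a r u [g1 [h1 h2]]; split; first exact: (subm_act hG).
    split=> [k|k ks] /=.
      have [rk|kr] := leqP r k.
        have := subm_act hG a r (h1 (k - r)%N); congr G; congr pair; rewrite /= ?pi_act ?piW_act.
          by congr pi; lia.
        by congr piW; lia.
      rewrite piW_low //; have [rs|sr] := leqP r (k + s).
        have ks : (k + s - r < s)%N by lia.
        have := subm_act hG a r (h2 _ ks); congr G; congr pair; rewrite /= ?gact0 // pi_act.
        by congr pi; lia.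
      suff -> : pi (k + s)%N (gact V a r u.1) = 0 by apply: (subm0 hG).
      case: hpi => _ _ h _; have [N ->] := h u.1.
      rewrite gact_sum (big_morph _ (_ : {morph pi (k + s)%N : x y / x + y}) (pi0 _)); last first.
        by move=> x y; have := pi_lin (k + s) 1 x y; rewrite !scale1r.
      rewrite big1 // => j _; rewrite pi_act pi_pi; case: eqP => // e; lia.
    have [rk|kr] := leqP r k.
      have kr : (k - r < s)%N by lia.
      have := subm_act hG a r (h2 _ kr); congr G; congr pair; rewrite /= ?gact0 // pi_act.
      by congr pi; lia.
    suff -> : pi k (gact V a r u.1) = 0 by apply: (subm0 hG).
    case: hpi => _ _ h _; have [N ->] := h u.1.
    rewrite gact_sum (big_morph _ (_ : {morph pi k : x y / x + y}) (pi0 _)); last first.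
      by move=> x y; have := pi_lin k 1 x y; rewrite !scale1r.
    rewrite big1 // => j _; rewrite pi_act pi_pi; case: eqP => // e; lia.
- move=> v [v1 v2]; split; first by apply: SG.
  by split=> [k|k _] /=; rewrite ?v2 ?piW0; apply: SG; split=> //=; apply: (proj2 hB).
- split; first exact: genS_gen.
  case: hW => _ hw0 _ _ _; split=> [k|k ks] /=.
    have e1 : pi (k + s)%N k0 = if k == 0%N then k0 else 0.
      rewrite -{1}hdeg pi_pi -{2}[s]add0n eqn_add2r.
      by case: eqP => // ->; rewrite add0n.
    have e2 : piW k w = if k == 0%N then w else 0.
      by rewrite -{1}hw0 piW_pi; case: eqP => // ->.
    rewrite e1 e2; case: eqP => _; last exact: (subm0 hG).
    exact: genS_gen.
  have -> : pi k k0 = 0 by rewrite -hdeg pi_pi (ltn_eqF ks).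
  exact: (subm0 hG).
Qed.

Lemma piece_iso : exists q : V -> W,
  [/\ forall (c : F) u v, A u -> A v -> q (c *: u + v) = c *: q u + q v,
      forall a r u, A u -> q (gact V a r u) = gact W a r (q u),
      (forall k u, A u -> q (pi (k + s)%N u) = piW k (q u)) /\
      (forall k u, A u -> (k < s)%N -> q (pi k u) = 0),
      forall w', exists u, A u /\ q u = w'
    & forall u, A u -> (q u = 0 <-> B u)] /\ q k0 = w.
Proof.
have [hinj hwd] := graph_inj.
(* The value is the unique partner of u in G when u lies in A, and arbitrary outside A. *)
have [q hq] : exists q : V -> W, forall u, A u -> G (u, q u).
  have h u : exists w', A u -> G (u, w').
    case: (excluded_middle_informative (A u)) => [hu|nu]; last by exists 0.
    by have [w' hw'] := A_G hu; exists w'.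
  exists (fun u => proj1_sig (constructive_indefinite_description _ (h u))) => u hu.
  by case: (constructive_indefinite_description _ _) => w' /= h'; apply: h'.
have uq u w' : A u -> G (u, w') -> q u = w'.
  move=> hu hg; have := submB hG (hq u hu) hg.
  rewrite (_ : _ - _ = (0, q u - w') :> (V * W)%type); last by congr pair; rewrite /= subrr.
  by move/(hwd _ _ (subm0 hB')) /eqP; rewrite subr_eq0 => /eqP.
have Api k u : A u -> A (pi k u).
  move=> /A_G [w' /graph_graded [h1 h2]].
  have [ks|sk] := ltnP k s; first exact: (G_A (h2 k ks)).
  by have := G_A (h1 (k - s)%N); rewrite /= subnK.
exists q; split; last first.
  by apply: uq; [apply/hgen; apply: genS_gen | apply: genS_gen].
split.
- move=> c u v hu hv; apply: uq; first exact: (submZD hA).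
  exact: (submZD hG c (hq u hu) (hq v hv)).
- move=> a r u hu; apply: uq; first exact: (subm_act hA).
  exact: (subm_act hG a r (hq u hu)).
- split=> [k u hu|k u hu ks]; have [h1 h2] := graph_graded (hq u hu).
    by apply: uq; [apply: Api | apply: h1].
  by apply: uq; [apply: Api | apply: h2].
- move=> w'; have [u hu] := W_G w'; exists u; have Au := G_A hu.
  by split; [| apply: uq].
- move=> u hu; split=> [e|bu]; first by apply: hinj; rewrite -e; apply: hq.
  exact: (hwd _ _ bu (hq u hu)).
Qed.

End PieceIso.

(** * Gradings and operations on partitions *)

Section GradedSubmodules.
Variables (F : fieldType) (V : gmod F) (pi : nat -> V -> V) (hpi : is_grading pi).

Lemma grading_lin k c u v : pi k (c *: u + v) = c *: pi k u + pi k v.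
Proof. by case: hpi => h _ _ _. Qed.

Lemma grading0 k : pi k 0 = 0.
Proof. by have := grading_lin k (-1) 0 0; rewrite scaler0 addr0 scaleN1r addNr. Qed.

Lemma grading_sum k N (f : nat -> V) : pi k (\sum_(j < N) f j) = \sum_(j < N) pi k (f j).
Proof.
apply: (big_morph _ _ (grading0 k)) => u v.
by have := grading_lin k 1 u v; rewrite !scale1r.
Qed.

Lemma hom_act a r j u : pi j u = u -> pi (j + r)%N (gact V a r u) = gact V a r u.
Proof. by move=> h; case: hpi => _ _ _ e; rewrite -e h. Qed.

Lemma hom_iter a r j k u : pi j u = u ->
  pi (j + k * r)%N (iter k (gact V a r) u) = iter k (gact V a r) u.
Proof.
move=> h; elim: k => [|k IH]; first by rewrite addn0.
by rewrite iterS mulSn addnCA addnC; apply: hom_act.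
Qed.

Lemma grading_low a r k u : (k < r)%N -> pi k (gact V a r u) = 0.
Proof.
move=> kr; case: hpi => _ hpp h hact; have [N ->] := h u.
rewrite gact_sum (grading_sum k N (fun j => gact V a r (pi j u))) big1 // => j _.
by rewrite hact hpp; case: eqP => // e; lia.
Qed.

Lemma zero_graded : is_graded_submodule pi (fun u => u = 0).
Proof. by split; [apply: zero_subm | move=> k u ->; apply: grading0]. Qed.

Lemma genS_graded (S : V -> Prop) j w : is_graded_submodule pi S -> pi j w = w ->
  is_graded_submodule pi (genS S w).
Proof.
move=> [hS hSpi] hw; split=> [|k u hu]; first exact: genS_sub.
have hg := genS_sub S w.
suff [_ h] : genS S w u /\ forall k, genS S w (pi k u) by [].
move: {k} u hu; apply: genS_min.
- split.
  + by split=> [|k]; rewrite ?grading0; apply: (subm0 hg).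
  + move=> c u v [g1 h1] [g2 h2]; split=> [|k]; first exact: (submZD hg).
    by rewrite grading_lin; apply: (submZD hg).
  + move=> a r u [g1 h1]; split=> [|k]; first exact: (subm_act hg).
    have [rk|kr] := leqP r k; last by rewrite grading_low //; apply: (subm0 hg).
    case: hpi => _ _ _ e; have := e a r (k - r)%N u; rewrite subnK // => <-.
    exact: (subm_act hg).
- by move=> v hv; split=> [|k]; apply: genS_incl => //; apply: hSpi.
- split=> [|k]; first exact: genS_gen.
  case: hpi => _ hpp _ _; rewrite -[X in pi k X]hw hpp; case: eqP => [->|_]; last exact: (subm0 hg).
  by rewrite hw; apply: genS_gen.
Qed.

End GradedSubmodules.

Section PartitionOps.
Implicit Types (q : seq nat) (a x : nat).

Let size_qax q a x : (size (q ++ [:: a; x])).-1 = (size q).+1.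
Proof. by rewrite size_cat addn2. Qed.

Let nth_a q a x : nth 0%N (q ++ [:: a; x]) (size q) = a.
Proof. by rewrite nth_cat ltnn subnn. Qed.

Let nth_x q a x : nth 0%N (q ++ [:: a; x]) (size q).+1 = x.
Proof. by rewrite nth_cat ltnNge leqnSn /= subSnn. Qed.

Let take_qa q a x : take (size q).+1 (q ++ [:: a; x]) = rcons q a.
Proof. by rewrite -cat_rcons take_size_cat // size_rcons. Qed.

Lemma pminusE q a x : pminus (q ++ [:: a; x]) = rcons q (a - x)%N.
Proof. by rewrite /pminus size_qax /= nth_a nth_x take_size_cat. Qed.

Lemma phatE q a x : phat (q ++ [:: a; x]) = q ++ [:: a; (x - 1)%N].
Proof. by rewrite /phat size_qax nth_x take_qa -cats1 cat_rcons. Qed.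

Lemma ptildeE q a x : ptilde (q ++ [:: a; x]) = q ++ [:: a; (x - 2)%N].
Proof. by rewrite /ptilde size_qax nth_x take_qa -cats1 cat_rcons. Qed.

(** Among the entries equal to a the first one is raised: this keeps the list sorted and gives the
    same multiset as raising the last one. *)
Lemma pplus_bump q a x : sorted geq (q ++ [:: a; x]) ->
  let l := find (fun y => y == a) (q ++ [:: a; x]) in
  [/\ perm_eq (set_nth 0%N (rcons q a) l a.+1) (rcons q a.+1),
      sorted geq (set_nth 0%N (rcons q a) l a.+1)
    & nth 0%N (q ++ [:: a; x]) l = a].
Proof.
elim: q => [|y q IH] hs /=; first by rewrite eqxx.
have hq : sorted geq (q ++ [:: a; x]) by apply: (path_sorted hs).
have hy : all (geq y) (q ++ [:: a; x]) by apply: (order_path_min geq_trans hs).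
have [ey|ne] := eqVneq y a.
  rewrite ey; split=> //=.
    by apply/permP => P /=; rewrite -!cats1 !count_cat /=; lia.
  rewrite ey in hs; move: hs; rewrite /= -cat_rcons cat_path => /andP[h _].
  by case: (rcons q a) h => //= z zs /andP[h ->]; rewrite andbT; apply: leqW.
have [h1 h2 h3] := IH hq; split=> //=; first by rewrite perm_cons.
rewrite path_sortedE; last exact: geq_trans.
rewrite h2 andbT (perm_all _ h1) all_rcons.
move: hy; rewrite all_cat /= => /and4P[hyq hya _ _]; rewrite hyq andbT /=.
by rewrite ltn_neqAle eq_sym ne; apply: hya.
Qed.

Lemma pplusE q a x : sorted geq (q ++ [:: a; x]) ->
  perm_eq (pplus (q ++ [:: a; x])) (q ++ [:: a.+1; x.-1]) /\ sorted geq (pplus (q ++ [:: a; x])).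
Proof.
move=> hs; have [] := pplus_bump hs.
rewrite /pplus size_qax /= nth_a nth_x take_qa subn1.
set l := find _ _ => h1 h2 ->; split.
  by rewrite -cat_rcons -cats1 perm_cat2r.
have hx : all (fun y => x.-1 <= y)%N (set_nth 0%N (rcons q a) l a.+1).
  rewrite (perm_all _ h1) all_rcons.
  have hall : all (fun y => x <= y)%N (rcons q a).
    move: hs; rewrite -cat_rcons cats1 sorted_pairwise; last exact: geq_trans.
    by rewrite pairwise_rcons => /andP[].
  move: hall; rewrite all_rcons => /andP[xa xq].
  rewrite (leq_trans (leq_pred x)) ?(leq_trans xa) //=.
  by apply: sub_all xq => y; apply: leq_trans; apply: leq_pred.
case: (set_nth _ _ _ _) h2 hx => //= z zs; rewrite rcons_path => -> hall /=.
have hall' : all (fun y => x.-1 <= y)%N (z :: zs) := hall.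
exact: (allP hall' _ (mem_last z zs)).
Qed.

End PartitionOps.

(** * The filtrations of the kernel *)

Section MainSection.
Variables (F : fieldType) (char0 : forall k, k.+1%:R != 0 :> F).
Variables (V : gmod F) (pi : nat -> V -> V) (v : V) (l1 : F) (n : nat) (q : seq nat) (a x : nat).
Hypotheses (n0 : (0 < n)%N) (sq : size q = n.-1) (hs : sorted geq (q ++ [:: a; x])).
Hypotheses (x0 : (0 < x)%N) (a1 : (1 < a)%N) (HV : isCV (l1, q ++ [:: a; x]) pi v).

Let hpi : is_grading pi. Proof. by case: HV. Qed.
Let hv0 : pi 0%N v = v. Proof. by case: HV. Qed.
Let S0 (u : V) := u = 0.
Let hS0 : is_submodule S0. Proof. exact: zero_subm. Qed.
Let s := (n * x)%N.

Let ax : (x <= a)%N.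
Proof. by have [_ /=] := cat_sorted2 hs; rewrite andbT. Qed.

Let hq : all (fun z => 1 < z)%N q.
Proof.
move: hs; rewrite sorted_pairwise; last exact: geq_trans.
rewrite pairwise_cat => /and3P[/allrelP h _ _]; apply/allP => z hz.
by apply: leq_trans a1 _; apply: (h z a hz); rewrite inE eqxx.
Qed.

Let hm : cvS l1 (q ++ [:: a; x]) S0 v.
Proof. by case: HV => _ _ _ h _; apply: cvrel_cvS => //; case: (q). Qed.

Let full (u : V) : genS S0 v u.
Proof. by case: HV => _ _ h _ _ T hT _ hv; apply: h. Qed.

Let goodq c : (q != [::]) || (0 < c)%N -> good (rcons q c).
Proof. exact: good_rcons. Qed.

Let goodqac c : good (q ++ [:: a; c]).
Proof.
rewrite -cat_rcons cats1; apply: good_rcons; first by rewrite all_rcons a1.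
by rewrite -size_eq0 size_rcons.
Qed.

Let good_plus : good (q ++ [:: a.+1; x.-1]).
Proof.
rewrite -cat_rcons cats1; apply: good_rcons; first by rewrite all_rcons ltnS ltnW.
by rewrite -size_eq0 size_rcons.
Qed.

Let indT : indep_ge (genS S0 v) S0 (Ddim (q ++ [:: a; x])).
Proof.
apply: (indep_ge_weak (A := fun _ => True)) => //.
by apply: (isCV_indep char0 _ HV); case/andP: (goodqac x).
Qed.

Let K0 := fil0 S0 n x v.
Let K1 := fil1 S0 n x v.
Let K2 := fil2 S0 n x v.
Let K3 := fil3 S0 n x v.

Let hK0 : is_submodule K0. Proof. exact: fil0_sub. Qed.
Let hK1 : is_submodule K1. Proof. exact: fil1_sub. Qed.
Let hK2 : is_submodule K2. Proof. exact: fil2_sub. Qed.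
Let hK3 : is_submodule K3. Proof. exact: fil3_sub. Qed.
Let sp (T : V -> Prop) : is_submodule T -> subsp T := fun h => subm_subsp h.

Let deg0 : pi s (step0 n x v) = step0 n x v.
Proof. by have := hom_iter hpi Y2 n x hv0; rewrite add0n mulnC. Qed.

Let deg_iter j u : (j <= s)%N -> forall k, (j + k * n = s)%N -> pi j u = u ->
  pi s (iter k (gact V Y2 n) u) = iter k (gact V Y2 n) u.
Proof. by move=> _ k <- h; apply: hom_iter. Qed.

Let deg1 : pi s (step1 n x v) = step1 n x v.
Proof.
apply: (deg_iter (j := n)); rewrite /s; [nia | nia |].
by have := hom_act hpi X1 n hv0; rewrite add0n.
Qed.

Let deg2 : pi s (step2 n x v) = step2 n x v.
Proof.
apply: (deg_iter (j := n)); rewrite /s; [nia | nia |].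
by have := hom_act hpi Y3 n hv0; rewrite add0n.
Qed.

Let deg3 : pi s (step3 n x v) = step3 n x v.
Proof.
rewrite /step3; case: eqP => [_|x1]; first exact: grading0.
apply: (deg_iter (j := n + n)); rewrite /s.
- by case: (x) x0 x1 => [|[|c]] // _ _; rewrite !mulnS; lia.
- by case: (x) x0 x1 => [|[|c]] // _ _ /=; rewrite !mulnS mulnC; lia.
by apply: hom_act => //; have := hom_act hpi X1 n hv0; rewrite add0n.
Qed.

Let grS : is_graded_submodule pi S0. Proof. exact: zero_graded. Qed.
Let gr0 : is_graded_submodule pi K0. Proof. exact: (genS_graded hpi grS deg0). Qed.
Let gr3 : is_graded_submodule pi K3. Proof. exact: (genS_graded hpi grS deg3). Qed.
Let gr2 : is_graded_submodule pi K2. Proof. exact: (genS_graded hpi gr3 deg2). Qed.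
Let gr1 : is_graded_submodule pi K1. Proof. exact: (genS_graded hpi gr2 deg1). Qed.

Let i32 u : K3 u -> K2 u. Proof. exact: fil3_2. Qed.
Let i21 u : K2 u -> K1 u. Proof. exact: fil2_1. Qed.
Let i10 u : K1 u -> K0 u. Proof. exact: (fil1_0 char0 hS0 n0 sq hs x0 hm). Qed.
Let i0T u : K0 u -> genS S0 v u. Proof. by move=> _. Qed.

Let hsorted_rcons c : (c <= a)%N -> sorted geq (rcons q c).
Proof. exact: (sorted_rcons_low hs). Qed.

Lemma kernel_eq : gen_sub (iter x (gact V Y2 n) v) = K0.
Proof.
apply: functional_extensionality => u; apply: propositional_extensionality.
split=> h T hT; first by move=> _ ht; apply: h.
by move=> ht; apply: h => // w ->; apply: (subm0 hT).
Qed.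

Let piece (A B : V -> Prop) (l : F) xi k0 d : is_submodule A -> is_graded_submodule pi B ->
  good xi -> sorted geq xi -> cvS l xi B k0 -> (forall u, A u <-> genS B k0 u) ->
  pi d k0 = k0 -> indep_ge A B (Ddim xi) -> sq_cv pi A B d (l, xi).
Proof.
move=> h1 h2 h3 h4 h5 h6 h7 h8 W piW w hW.
by have [f [h _]] := piece_iso char0 hpi h1 h2 h3 h4 h5 h6 h7 h8 hW; exists f.
Qed.

Let dplus : dim_le (genS S0 v) K0 (Ddim (q ++ [:: a.+1; x.-1])).
Proof.
have h := upper_bound char0 good_plus hK0 (cvS_fil_plus char0 hS0 n0 sq hs x0 hm (perm_refl _)).
by have E u := genS_fil0_m S0 n x v u; apply: dim_le_weak h => u /E.
Qed.

Let d0 : (q != [::]) || (0 < a - x)%N -> dim_le K0 K1 (Ddim (rcons q (a - x)%N)).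
Proof.
move=> h; have h' := upper_bound char0 (goodq h) hK1 (cvS_fil0 char0 hS0 n0 sq hs x0 hm).
by apply: dim_le_weak h' => u /(genS_fil1_step0 char0 hS0 n0 sq hs x0 hm).
Qed.

Let d1 : dim_le K1 K2 (Ddim (rcons q (a - x)%N.+1)).
Proof.
by apply: (upper_bound char0 (goodq _) hK2 (cvS_fil1 char0 hS0 n0 sq hs x0 hm)); rewrite orbT.
Qed.

Let d2 : dim_le K2 K3 (Ddim (rcons q (a - x)%N.+1)).
Proof.
by apply: (upper_bound char0 (goodq _) hK3 (cvS_fil2 char0 hS0 n0 sq hs x0 hm)); rewrite orbT.
Qed.

Let d3 : dim_le K3 S0 (if x == 1%N then 0%N else Ddim (rcons q (a - x)%N.+2)).
Proof.
case: eqP => x1; last first.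
  have x2 : (1 < x)%N by move: x0 x1; case: (x) => [|[|]].
  by apply: (upper_bound char0 (goodq _) hS0 (cvS_fil3 char0 hS0 n0 sq hs x0 hm x2)); rewrite orbT.
exists [::]; split=> // u /(fil3_x1 hS0 x1); apply: spanP_incl; exact: sp.
Qed.

Let d23 := dim_le_trans (sp hK3) (sp hS0) i32 d2 d3.

(** The lower bound [indT] equals the sum of the upper bounds, so [indep_split] peels off the layers
    one at a time, each attaining its bound. *)
Let chain_lt : (x < a)%N -> [/\ indep_ge (genS S0 v) K0 (Ddim (q ++ [:: a.+1; x.-1])),
  indep_ge K0 K1 (Ddim (rcons q (a - x)%N)), indep_ge K1 K2 (Ddim (rcons q (a - x)%N.+1)),
  indep_ge K2 K3 (Ddim (rcons q (a - x)%N.+1))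
  & indep_ge K3 S0 (if x == 1%N then 0%N else Ddim (rcons q (a - x)%N.+2))].
Proof.
move=> xa; have d0' := d0 ltac:(by rewrite subn_gt0 xa orbT).
have d123 := dim_le_trans (sp hK2) (sp hS0) i21 d1 d23.
have d0123 := dim_le_trans (sp hK1) (sp hS0) i10 d0' d123.
have := indT; rewrite (Ddim_split_lt q x0 xa) => h.
have [hp h0] := indep_split (sp hK0) (sp hS0) i0T dplus d0123 h.
have [e0 h1] := indep_split (sp hK1) (sp hS0) i10 d0' d123 h0.
have [e1 h2] := indep_split (sp hK2) (sp hS0) i21 d1 d23 h1.
by have [e2 e3] := indep_split (sp hK3) (sp hS0) i32 d2 d3 h2.
Qed.

Let piece0 : (q != [::]) || (0 < a - x)%N -> indep_ge K0 K1 (Ddim (rcons q (a - x)%N)) ->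
  sq_cv pi K0 K1 s (fdata x (l1, pminus (q ++ [:: a; x]))).
Proof.
move=> h hi; rewrite pminusE /fdata /=.
apply: (piece hK0 gr1 (goodq h) _ (cvS_fil0 char0 hS0 n0 sq hs x0 hm)) => // [|u].
  by apply: hsorted_rcons; rewrite leq_subr.
by split=> /(genS_fil1_step0 char0 hS0 n0 sq hs x0 hm).
Qed.

Let pminus_phat : pminus (phat (q ++ [:: a; x])) = rcons q (a - x)%N.+1.
Proof. by rewrite phatE pminusE; congr rcons; lia. Qed.

Let sorted_odd : sorted geq (rcons q (a - x)%N.+1).
Proof. by apply: hsorted_rcons; lia. Qed.

Let piece2 : indep_ge K2 K3 (Ddim (rcons q (a - x)%N.+1)) ->
  sq_cv pi K2 K3 s (fdata x (l1, pminus (phat (q ++ [:: a; x])))).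
Proof.
move=> hi; rewrite pminus_phat /fdata /=.
by apply: (piece hK2 gr3 (goodq _) _ (cvS_fil2 char0 hS0 n0 sq hs x0 hm)); rewrite ?orbT.
Qed.

Let piece3 : (1 < x)%N -> indep_ge K3 S0 (Ddim (rcons q (a - x)%N.+2)) ->
  sq_cv pi K3 S0 s (fdata x.-1 (l1, pminus (ptilde (q ++ [:: a; x])))).
Proof.
move=> x1 hi; rewrite ptildeE pminusE /fdata /= (_ : (a - (x - 2) = (a - x).+2)%N); last by lia.
apply: (piece hK3 grS (goodq _) _ (cvS_fil3 char0 hS0 n0 sq hs x0 hm x1)); rewrite ?orbT //.
by apply: hsorted_rcons; lia.
Qed.

Lemma filtration_lt : (x < a)%N -> exists V1 V2 V3 : V -> Prop,
  [/\ is_graded_submodule pi K0 /\ is_graded_submodule pi V1 /\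
      is_graded_submodule pi V2 /\ is_graded_submodule pi V3,
      (forall u, V1 u -> K0 u) /\ (forall u, V2 u -> V1 u) /\ (forall u, V3 u -> V2 u),
      sq_cv pi K0 V1 s (fdata x (l1, pminus (q ++ [:: a; x]))) /\
      sq_cv pi V1 V2 s (fdata x.-1 (l1, pminus (phat (q ++ [:: a; x])))) /\
      sq_cv pi V2 V3 s (fdata x (l1, pminus (phat (q ++ [:: a; x]))))
    & ((1 < x)%N -> sq_cv pi V3 (fun u => u = 0) s
         (fdata x.-1 (l1, pminus (ptilde (q ++ [:: a; x]))))) /\
      (x = 1%N -> forall u, V3 u -> u = 0)].
Proof.
move=> xa; have [_ g0 g1 g2 g3] := chain_lt xa.
exists K1, K2, K3; split.
- by split; [|split; [|split]].
- by split; [|split].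
- split; first by apply: piece0 => //; rewrite subn_gt0 xa orbT.
  split; last exact: piece2.
  rewrite pminus_phat /fdata /=.
  by apply: (piece hK1 gr2 (goodq _) _ (cvS_fil1 char0 hS0 n0 sq hs x0 hm)); rewrite ?orbT.
- split=> [x1|x1 u]; last exact: fil3_x1.
  by apply: piece3 => //; have := g3; rewrite (gtn_eqF x1).
Qed.

Section EqualParts.
Hypotheses (eax : a = x) (n1 : (1 < n)%N).
Variables (ys : seq nat) (e : nat) (eq_ : q = rcons ys e).

Let x1 : (1 < x)%N. Proof. by rewrite -eax. Qed.
Let he : (1 < e)%N. Proof. by move: hq; rewrite eq_ all_rcons => /andP[]. Qed.
Let hys : all (fun z => 1 < z)%N ys. Proof. by move: hq; rewrite eq_ all_rcons => /andP[]. Qed.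

Let Kb := filb S0 n x v.
Let Ka := fila S0 n x v.
Let hKb : is_submodule Kb. Proof. exact: filb_sub. Qed.
Let hKa : is_submodule Ka. Proof. exact: fila_sub. Qed.
Let i2b u : K2 u -> Kb u. Proof. exact: fil2_b. Qed.
Let iba u : Kb u -> Ka u. Proof. exact: filb_a. Qed.
Let ia1 u : Ka u -> K1 u. Proof. exact: fila_1. Qed.

Let degb : pi (s + n - 1)%N (step1 n.-1 1 (step1 n x v)) = step1 n.-1 1 (step1 n x v).
Proof. by rewrite -addnBA // subn1; apply: hom_act. Qed.
Let dega : pi (s + n - 1)%N (step0 n.-1 1 (step1 n x v)) = step0 n.-1 1 (step1 n x v).
Proof. by rewrite -addnBA // subn1; apply: hom_act. Qed.

Let grb : is_graded_submodule pi Kb. Proof. exact: (genS_graded hpi gr2 degb). Qed.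
Let gra : is_graded_submodule pi Ka. Proof. exact: (genS_graded hpi grb dega). Qed.

Let good_yse c : good (ys ++ [:: e; c]).
Proof.
rewrite -cat_rcons cats1; apply: good_rcons; first by rewrite all_rcons he.
by rewrite -size_eq0 size_rcons.
Qed.
Let good_ysp : good (ys ++ [:: e.+1; 0%N]).
Proof.
rewrite -cat_rcons cats1; apply: good_rcons; first by rewrite all_rcons ltnS ltnW.
by rewrite -size_eq0 size_rcons.
Qed.
Let good_ys c : (0 < c)%N -> good (rcons ys c).
Proof. by move=> h; apply: good_rcons => //; rewrite h orbT. Qed.

Let cva xi : perm_eq xi (ys ++ [:: e.+1; 0%N]) -> cvS (l1 - x.-1%:R) xi Ka (step1 n x v).
Proof. exact: (cvS_fila_plus char0 hS0 n0 sq hs x0 hm eax x1 n1 eq_ he). Qed.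
Let cvb : cvS (l1 - x%:R) (rcons ys e.-1) Kb (step0 n.-1 1 (step1 n x v)).
Proof. exact: (cvS_fila char0 hS0 n0 sq hs x0 hm eax x1 n1 eq_ he). Qed.
Let cv2 : cvS (l1 - x.-1%:R) (rcons ys e) K2 (step1 n.-1 1 (step1 n x v)).
Proof. exact: (cvS_filb char0 hS0 n0 sq hs x0 hm eax x1 n1 eq_ he). Qed.

Let d1a : dim_le K1 Ka (Ddim (ys ++ [:: e.+1; 0%N])).
Proof.
have h := upper_bound char0 good_ysp hKa (cva (perm_refl _)).
by apply: dim_le_weak h => u /genS_fila_step1.
Qed.
Let dab : dim_le Ka Kb (Ddim (rcons ys e.-1)).
Proof. by apply: (upper_bound char0 (good_ys _) hKb cvb); move: he; lia. Qed.
Let db2 : dim_le Kb K2 (Ddim (rcons ys e)).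
Proof. by apply: (upper_bound char0 (good_ys _) hK2 cv2); move: he; lia. Qed.

Let d0' : dim_le K0 K1 (Ddim (rcons q (a - x)%N)).
Proof. by apply: d0; rewrite eq_ -size_eq0 size_rcons. Qed.

Lemma chain_eq : [/\ indep_ge (genS S0 v) K0 (Ddim (q ++ [:: a.+1; x.-1])),
  indep_ge K0 K1 (Ddim (rcons q (a - x)%N)) /\ indep_ge K1 Ka (Ddim (ys ++ [:: e.+1; 0%N])),
  indep_ge Ka Kb (Ddim (rcons ys e.-1)) /\ indep_ge Kb K2 (Ddim (rcons ys e)),
  indep_ge K2 K3 (Ddim (rcons q (a - x)%N.+1)) & indep_ge K3 S0 (Ddim (rcons q (a - x)%N.+2))].
Proof.
have d3' : dim_le K3 S0 (Ddim (rcons q (a - x)%N.+2)).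
  by have := d3; rewrite (_ : (x == 1%N) = false) //; move: x1; case: (x) => [|[]].
have d23' := dim_le_trans (sp hK3) (sp hS0) i32 d2 d3'.
have db := dim_le_trans (sp hK2) (sp hS0) i2b db2 d23'.
have da := dim_le_trans (sp hKb) (sp hS0) iba dab db.
have d1' := dim_le_trans (sp hKa) (sp hS0) ia1 d1a da.
have dd := dim_le_trans (sp hK1) (sp hS0) i10 d0' d1'.
have E : Ddim (q ++ [:: a; x]) = (Ddim (q ++ [:: a.+1; x.-1]) + (Ddim (rcons q (a - x)%N) +
    (Ddim (ys ++ [:: e.+1; 0%N]) + (Ddim (rcons ys e.-1) + (Ddim (rcons ys e) +
    (Ddim (rcons q (a - x)%N.+1) + Ddim (rcons q (a - x)%N.+2)))))))%N.
  by rewrite -eax eq_ (Ddim_split_eq ys he a1).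
have := indT; rewrite E => h.
have [hp h0] := indep_split (sp hK0) (sp hS0) i0T dplus dd h.
have [e0 h1] := indep_split (sp hK1) (sp hS0) i10 d0' d1' h0.
have [e1 ha] := indep_split (sp hKa) (sp hS0) ia1 d1a da h1.
have [ea hb] := indep_split (sp hKb) (sp hS0) iba dab db ha.
have [eb h2] := indep_split (sp hK2) (sp hS0) i2b db2 d23' hb.
by have [e2 e3] := indep_split (sp hK3) (sp hS0) i32 d2 d3' h2.
Qed.

Let eta_sorted : sorted geq (ys ++ [:: e; 1%N]).
Proof. by have := hsorted_rcons (c := 1) (ltnW a1); rewrite eq_ -cats1 -cats1 -catA. Qed.

Let eta0_sorted : sorted geq (ys ++ [:: e; 0%N]).
Proof. by have := hsorted_rcons (leq0n a); rewrite eq_ -cats1 -cats1 -catA. Qed.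

(** The trailing zero in the partition of this layer affects neither its sum nor [Gmin]. *)
Let cvb0 : cvS (l1 - x.-1%:R) (ys ++ [:: e; 0%N]) K2 (step1 n.-1 1 (step1 n x v)).
Proof.
have [h1 h2] := cv2; split; first by move: h1; rewrite sumn_cat sumn_rcons /= !addn0.
by move=> r t h; apply: h2; move: h; rewrite -cats1 !Gmin_cat !Gmin_cons Gmin_nil minn0 !addn0.
Qed.

Lemma filtration_eq : exists V1 V2 V3 V4 V5 : V -> Prop,
  [/\ is_graded_submodule pi K0 /\ is_graded_submodule pi V1 /\
      is_graded_submodule pi V2 /\ is_graded_submodule pi V3 /\
      is_graded_submodule pi V4 /\ is_graded_submodule pi V5,
      (forall u, V1 u -> K0 u) /\ (forall u, V2 u -> V1 u) /\ (forall u, V3 u -> V2 u) /\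
      (forall u, V4 u -> V3 u) /\ (forall u, V5 u -> V4 u),
      sq_cv pi K0 V1 s (fdata x (l1, pminus (q ++ [:: a; x]))) /\
      sq_cv pi V1 V2 s (fdata x.-1 (l1, pplus (pminus (phat (q ++ [:: a; x]))))) /\
      sq_cv pi V2 V3 (s + n - 1) (fdata x (l1, pminus (pminus (phat (q ++ [:: a; x]))))),
      sq_cv pi V3 V4 (s + n - 1) (fdata x.-1 (l1, phat (pminus (phat (q ++ [:: a; x]))))) /\
      sq_cv pi V4 V5 s (fdata x (l1, pminus (phat (q ++ [:: a; x]))))
    & sq_cv pi V5 (fun u => u = 0) s (fdata x.-1 (l1, pminus (ptilde (q ++ [:: a; x]))))].
Proof.
have [_ [g0 g1] [ga gb] g2 g3] := chain_eq.
have [hp hps] := pplusE eta_sorted.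
have hgp : good (pplus (ys ++ [:: e; 1%N])) by rewrite (good_perm hp); apply: good_ysp.
have Eh : pminus (phat (q ++ [:: a; x])) = ys ++ [:: e; 1%N].
  by rewrite phatE pminusE eq_ -cats1 -cats1 -catA eax (subKn x0).
exists K1, Ka, Kb, K2, K3; split.
- by split; [|split; [|split; [|split; [|split]]]].
- by split; [|split; [|split; [|split]]].
- split; first by apply: piece0 => //; rewrite eq_ -size_eq0 size_rcons.
  rewrite Eh pminusE (subn1 e); split.
    apply: (piece hK1 gra hgp hps (cva hp) _ deg1); last by rewrite (Ddim_perm hp).
    by move=> u; split=> /genS_fila_step1.
  have e1 : (0 < e.-1)%N by rewrite -subn1 subn_gt0.
  exact: (piece hKa grb (good_ys e1) (sorted_rcons_low eta_sorted (leq_pred e)) cvb (fun=> iff_refl _) dega ga).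
- split; last exact: piece2.
  rewrite Eh phatE.
  apply: (piece hKb gr2 (good_yse 0) eta0_sorted cvb0 _ degb _); first done.
  by move: gb; rewrite Ddim_rcons Ddim_cat !Ddim_cons Ddim_nil /= !muln1.
exact: piece3.
Qed.

End EqualParts.
(** The exact sequence also covers n = 1 and a = x, where no filtration is available and the bound
    by 16 closes the count. *)
Let indplus : indep_ge (genS S0 v) K0 (Ddim (q ++ [:: a.+1; x.-1])).
Proof.
move: ax; rewrite leq_eqVlt => /orP[/eqP exa|xa]; last by have [] := chain_lt xa.
have [E|[ys [e E]]] : q = [::] \/ exists ys e, q = rcons ys e.
  by case/lastP: (q) => [|ys e]; [left | right; exists ys, e].
  have n1 : n = 1%N by have := sq; rewrite E => /esym/eqP; move: n0; case: (n) => [|[]].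
  have d16 := dim_le_fil0_two char0 hS0 n0 sq hs x0 hm n1 (esym exa).
  have E16 : Ddim (q ++ [:: a; x]) = (Ddim (q ++ [:: a.+1; x.-1]) + 16)%N.
    by rewrite E exa /= (Ddim_split_two a1).
  have := indT; rewrite E16 => h.
  by have [] := indep_split (sp hK0) (sp hS0) i0T dplus d16 h.
have n1 : (1 < n)%N by have := sq; rewrite E size_rcons; case: (n) => [|[]].
by have [] := chain_eq (esym exa) n1 E.
Qed.

(** The layer argument with A all of V, B the kernel and shift 0. *)
Lemma quotient_map (W : gmod F) (piW : nat -> W -> W) (w : W) :
  isCV (l1, pplus (q ++ [:: a; x])) piW w -> exists phi : V -> W,
    [/\ is_modmap phi, phi v = w, forall w', exists u, phi u = w'
      & forall u, phi u = 0 <-> K0 u].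
Proof.
move=> hW; have [hp hps] := pplusE hs.
have hgp : good (pplus (q ++ [:: a; x])) by rewrite (good_perm hp); apply: good_plus.
have hgen u : genS S0 v u <-> genS K0 v u by apply: iff_sym; apply: genS_fil0_m.
have hind : indep_ge (genS S0 v) K0 (Ddim (pplus (q ++ [:: a; x]))) by rewrite (Ddim_perm hp).
have hcv := cvS_fil_plus char0 hS0 n0 sq hs x0 hm hp.
have [f [[f1 f2 _ f3 f4] fv]] :=
  piece_iso char0 hpi (genS_sub S0 v) gr0 hgp hps hcv hgen hv0 hind hW.
exists f; split=> //.
- by split=> [c u u'|b r u]; [apply: f1 | apply: f2]; apply: full.
- by move=> w'; have [u [_ hu]] := f3 w'; exists u.
- by move=> u; apply: f4; apply: full.
Qed.

Lemma Ddim_pos xi : all (fun y => 0 < y)%N xi -> Ddim xi = (4 ^ size xi * \prod_(y <- xi) y)%N.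
Proof.
elim: xi => [|y xi IH] /=; first by rewrite Ddim_nil big_nil.
by move=> /andP[y0 h]; rewrite Ddim_cons big_cons y0 IH // expnS; ring.
Qed.

Lemma dimension : dim_eq V (4 ^ n.+1 * \prod_(y <- q ++ [:: a; x]) y)%N.
Proof.
have hN : Ddim (q ++ [:: a; x]) = (4 ^ n.+1 * \prod_(y <- q ++ [:: a; x]) y)%N.
  rewrite Ddim_pos; first by rewrite size_cat sq addn2 prednK.
  rewrite all_cat /= x0 (ltnW a1) !andbT; apply: sub_all hq => y; exact: ltnW.
have [L [sL _ hL]] := upper_bound char0 (goodqac x) hS0 hm.
have fr := span_free (sp hS0) sL hL indT; rewrite -hN; exists (fun i => L`_i); split.
  move=> c hc i; pose d k := oapp c 0 (insub k : option 'I_(Ddim (q ++ [:: a; x]))).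
  have E (k : 'I_(Ddim (q ++ [:: a; x]))) : d k = c k by rewrite /d valK.
  rewrite -E; apply: fr; last by rewrite sL.
  rewrite (lcomb_ord _ sL); apply: (etrans _ hc).
  by apply: eq_bigr => k _; rewrite E.
move=> u; have [c hc] := hL u (full u); exists (fun i => c i).
by apply/eqP; rewrite /= -(lcomb_ord c sL) -subr_eq0; apply/eqP.
Qed.

End MainSection.

Theorem mainTheorem7 (F : fieldType) (charF0 : [pchar F] =i pred0)
  (l1 : F) (xi : seq nat) (n : nat)
  (Hsize : size xi = n.+1) (Hn : (0 < n)%N) (Hpart : sorted geq xi)
  (Hlast : (0 < nth 0%N xi n)%N)
  (Hcase : (nth 0%N xi n < nth 0%N xi n.-1)%N \/
           (nth 0%N xi n.-1 = nth 0%N xi n /\ (2 <= nth 0%N xi n)%N))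
  (V : gmod F) (pi : nat -> V -> V) (v : V) (HV : isCV (l1, xi) pi v) :
  let xn := nth 0%N xi n in
  let s := (n * xn)%N in
  let K := gen_sub (iter xn (gact V Y2 n) v) in
  (* short exact sequence 0 -> Ker phi -> V(xi) -> V(xi^+) -> 0 *)
  (forall (W : gmod F) (piW : nat -> W -> W) (w : W), isCV (l1, pplus xi) piW w ->
     exists phi : V -> W,
       [/\ is_modmap phi, phi v = w, forall w', exists u, phi u = w'
         & forall u, phi u = 0 <-> K u])
  /\ dim_eq V (4 ^ n.+1 * \prod_(x <- xi) x)%N
  (* (i) *)
  /\ ((nth 0%N xi n < nth 0%N xi n.-1)%N ->
      exists V1 V2 V3 : V -> Prop,
        [/\ is_graded_submodule pi K /\ is_graded_submodule pi V1 /\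
            is_graded_submodule pi V2 /\ is_graded_submodule pi V3,
            (forall u, V1 u -> K u) /\ (forall u, V2 u -> V1 u) /\ (forall u, V3 u -> V2 u),
            sq_cv pi K V1 s (fdata xn (l1, pminus xi)) /\
            sq_cv pi V1 V2 s (fdata xn.-1 (l1, pminus (phat xi))) /\
            sq_cv pi V2 V3 s (fdata xn (l1, pminus (phat xi)))
          & ((1 < xn)%N -> sq_cv pi V3 (fun u => u = 0) s (fdata xn.-1 (l1, pminus (ptilde xi)))) /\
            (xn = 1%N -> forall u, V3 u -> u = 0)])
  (* (ii) *)
  /\ (nth 0%N xi n.-1 = xn -> (2 <= xn)%N -> (2 <= n)%N ->
      exists V1 V2 V3 V4 V5 : V -> Prop,
        [/\ is_graded_submodule pi K /\ is_graded_submodule pi V1 /\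
            is_graded_submodule pi V2 /\ is_graded_submodule pi V3 /\
            is_graded_submodule pi V4 /\ is_graded_submodule pi V5,
            (forall u, V1 u -> K u) /\ (forall u, V2 u -> V1 u) /\ (forall u, V3 u -> V2 u) /\
            (forall u, V4 u -> V3 u) /\ (forall u, V5 u -> V4 u),
            sq_cv pi K V1 s (fdata xn (l1, pminus xi)) /\
            sq_cv pi V1 V2 s (fdata xn.-1 (l1, pplus (pminus (phat xi)))) /\
            sq_cv pi V2 V3 (s + n - 1) (fdata xn (l1, pminus (pminus (phat xi)))),
            sq_cv pi V3 V4 (s + n - 1) (fdata xn.-1 (l1, phat (pminus (phat xi)))) /\
            sq_cv pi V4 V5 s (fdata xn (l1, pminus (phat xi)))
          & sq_cv pi V5 (fun u => u = 0) s (fdata xn.-1 (l1, pminus (ptilde xi)))]).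
Proof.
have char0 k : k.+1%:R != 0 :> F by move/pcharf0P: charF0 => ->.
pose q := take n.-1 xi; pose a := nth 0%N xi n.-1; pose x := nth 0%N xi n.
have Exi : xi = q ++ [:: a; x].
  rewrite -{1}(cat_take_drop n.-1 xi) (drop_nth 0%N) ?Hsize; last by lia.
  rewrite prednK // (drop_nth 0%N) ?Hsize // drop_oversize ?Hsize //.
have sq : size q = n.-1 by rewrite size_take Hsize; case: ltnP => //; lia.
have a1 : (1 < a)%N by rewrite /a; case: Hcase Hlast => [|[]]; lia.
have x0 : (0 < x)%N := Hlast.
have hs : sorted geq (q ++ [:: a; x]) by rewrite -Exi.
rewrite -/x -/a; clearbody q a x; subst xi => xn s K.
rewrite /K /xn (kernel_eq v n x).
split; first by move=> W piW w; apply: (quotient_map char0 Hn sq hs x0 a1 HV).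
split; first exact: (dimension char0 Hn sq hs x0 a1 HV).
split=> [xa|eax x2 n2]; first exact: (filtration_lt char0 Hn sq hs x0 a1 HV xa).
have [ys [e E]] : exists ys e, q = rcons ys e.
  case/lastP: (q) sq => [/=|ys e _]; last by exists ys, e.
  by move: n2; case: (n) => [|[]].
exact: (filtration_eq char0 Hn sq hs x0 a1 HV eax n2 E).
Qed.
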